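(* Let $X$ be a graded $U^+$-module with representation $\pi$ and weight basis $\{x_i\}_{i\in I_X}$, $\mathrm{wt}(x_i)=\nu_i$, and let $\psi_X=\sum_{i\in I_X}x_i\otimes\psi_i$ be a right Mickelsson generator relative to $X$. Let $\tilde S_X=(\pi\otimes\mathrm{id})(\tilde{\mathcal S})\in\mathrm{End}(X)\otimes\hat B^-$. Then the components of the vector $z_X=\tilde S_X\psi_X=\sum_{i,j\in I_X}x_i\otimes\tilde S_{ij}\psi_j$ are as follows: for every $i\in I_X$ the $i$-th component (the coefficient of $x_i$) equals $$z_i=\psi_i+\sum_{i\succ\vec m\neq\varnothing}\psi_{(i,\vec m)}B^i_{\vec m}=\wp\,\psi_i ,$$ where the sum runs over all non-empty routes $\vec m=(m_1,\dots,m_k)$, $k\ge1$, in the Hasse diagram of $X$ with $i\succ m_1$.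
   Context: **Quantum group.** $\mathfrak g=\mathfrak g_-\oplus\mathfrak h\oplus\mathfrak g_+$ is a semisimple complex Lie algebra, $\mathrm R^+$ its positive roots, $\Pi$ the simple roots, $\Gamma=\mathbb Z\Pi$, $\Gamma_+=\mathbb Z_+\Pi$, $(\cdot,\cdot)$ the invariant form on $\mathfrak h^*$, $\rho$ the half-sum of positive roots, $h_\lambda\in\mathfrak h$ defined by $\mu(h_\lambda)=(\mu,\lambda)$. $q\in\mathbb C^\times$ is not a root of unity and $[z]_q=\frac{q^z-q^{-z}}{q-q^{-1}}$. $U=U_q(\mathfrak g)$ is generated by $e_\alpha,f_\alpha,q^{\pm h_\alpha}$ ($\alpha\in\Pi$) with $q^{h_\alpha}e_\beta=q^{(\alpha,\beta)}e_\beta q^{h_\alpha}$, $q^{h_\alpha}f_\beta=q^{-(\alpha,\beta)}f_\beta q^{h_\alpha}$, $[e_\alpha,f_\beta]=\delta_{\alpha\beta}[h_\alpha]_q$ and the $q$-Serre relations. $U^+,U^-,U^0$ are the subalgebras generated by the $e_\alpha$, the $f_\alpha$, the $q^{\pm h_\alpha}$; $B^\pm=U^\pm U^0$. Two comultiplications: $\Delta(f_\alpha)=f_\alpha\otimes1+q^{-h_\alpha}\otimes f_\alpha$, $\Delta(e_\alpha)=e_\alpha\otimes q^{h_\alpha}+1\otimes e_\alpha$, and $\tilde\Delta(f_\alpha)=f_\alpha\otimes1+q^{h_\alpha}\otimes f_\alpha$, $\tilde\Delta(e_\alpha)=e_\alpha\otimes q^{-h_\alpha}+1\otimes e_\alpha$,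 with $q^{\pm h_\alpha}$ group-like in both. $\check{\mathcal R}=q^{-\sum_i h_i\otimes h_i}\mathcal R$ ($\{h_i\}$ an orthonormal basis of $\mathfrak h$, $\mathcal R$ the universal R-matrix for $\Delta$), chosen to lie in the completed tensor product of $U^+$ and $U^-$ (components in $U^+[\mu]\otimes U^-[-\mu]$, $\mu\in\Gamma_+$, zero-weight component $1\otimes1$); it satisfies $\check{\mathcal R}\Delta(u)=\tilde\Delta(u)\check{\mathcal R}$ for all $u\in U$. Put $\mathcal F=\frac1{q-q^{-1}}(\check{\mathcal R}-1\otimes1)$. The classical version, $U=U(\mathfrak g)$ (with $U^0=U(\mathfrak h)$), is the limit case $q\to1$: there $\Delta=\tilde\Delta$ is the usual comultiplication, $\mathcal F=\sum_{\alpha\in\mathrm R^+}e_\alpha\otimes f_\alpha$ (root vectors dual with respect to the invariant form), $[z]_q$ becomes $z$, and the function $\varphi$ below becomes $\varphi(z)=1/z$. **Localization.** $\hat U^0$ is the ring of fractions of $U^0$ over the elements $[h_\mu-c]_q$, $0\ne\mu\in\Gamma_+$, with $c$ ranging in a subset of $\mathbb C$ depending on the weight structure of the algebra $\mathcal A$ below. A hat over an algebra or ideal denotes the corresponding extension of $U^0$ to $\hat U^0$. **The algebra $\mathcal A$.** $\mathcal A\supset U$ is a unital associative algebra, diagonalizable over $U^0$ (adjoint action) with finite-dimensional weight spaces, and free as a $U^-\otimes B^+$-bimodule under the regular actions (left $U^-$, right $B^+$). $\mathcal J_+=\mathcal J$ is the left ideal of $\mathcal A$ generated by all $e_\alpha$,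 and $\mathcal J_-$ is the right ideal generated by all $f_\alpha$, $\alpha\in\Pi$. $\hat{\mathcal V}=\hat{\mathcal A}/\hat{\mathcal J}_+$ is a left $\hat{\mathcal A}$-module and a right $\hat U^0$-module. It is supposed that there exist further extensions $\hat U\subset\breve U$, $\hat{\mathcal A}\subset\breve{\mathcal A}$, $\hat{\mathcal J}_\pm\subset\breve{\mathcal J}_\pm$ such that $\mathcal J_\pm=\breve{\mathcal J}_\pm\cap\mathcal A$, and an element $\wp\in\breve U$ of zero weight (the extremal projector) satisfying $\mathcal J_+\wp=0=\wp\mathcal J_-$, $\wp^2=\wp$, $\wp-1\in\breve{\mathcal J}_-\cap\breve{\mathcal J}_+$. These properties give an isomorphism $\hat{\mathcal V}=\hat{\mathcal A}/\hat{\mathcal J}_+\simeq\hat{\mathcal A}\wp$, $a\bmod\hat{\mathcal J}_+\mapsto a\wp$, through which $\wp\psi_i$ is understood. **Hasse diagram and routes.** A $U^+$-module $(X,\pi)$ is graded if it extends to a $U^0$-diagonalizable $B^+$-module with finite-dimensional weight spaces; all differences of weights of $X$ are assumed to lie in $\Gamma$. Fix a weight basis $\{x_i\}_{i\in I_X}$ with weights $\nu_i$. There is an arrow from $j$ to $i$ labelled $\alpha\in\Pi$ if $\pi(e_\alpha)_{ij}\ne0$ (then $\nu_i-\nu_j=\alpha$). Write $i\succ j$ if there is a path of arrows from $j$ to $i$. A route is a sequence $\vec m=(m_1,\dots,m_k)$ with $m_1\succ\dots\succ m_k$; if $i\succ m_1$ we write $i\succ\vec m$, and $(i,\vec m)$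 denotes the route $(i,m_1,\dots,m_k)$. Write $(\pi\otimes\mathrm{id})(\mathcal F)=\sum_{i,j}e_{ij}\otimes\phi_{ij}$ with $e_{ij}$ the matrix units and $\phi_{ij}\in U^-$ of weight $\nu_j-\nu_i$. For a route $\vec m=(m_1,\dots,m_k)$ put $\phi_{\vec m}=\phi_{m_1,m_2}\cdots\phi_{m_{k-1},m_k}$ (equal to $1$ if $k=1$) and $\psi_{\vec m}=\phi_{\vec m}\psi_{m_k}$. **Right Mickelsson generator.** Suppose that $\hat{\mathcal V}$ contains a submodule isomorphic to the left dual $X^*$ of $X$. Then $\psi_X=\sum_i x_i\otimes\psi_i\in X\otimes X^*\subset X\otimes\hat{\mathcal V}$ is the $U^+$-invariant tensor, where $\psi_i\in\hat{\mathcal V}$ has weight $-\nu_i$ under the adjoint action of $U^0$; invariance means $\tilde\Delta(e_\alpha)\psi_X=0$ for all $\alpha\in\Pi$, i.e. $e_\alpha\psi_i+\sum_j\pi(e_\alpha)_{ij}q^{-h_\alpha}\psi_j=0$ in $\hat{\mathcal V}$. **Cartan coefficients.** For a weight $\mu$ let $\eta_\mu=h_\mu+(\mu,\rho)-\frac12(\mu,\mu)$ and $\tilde\eta_\mu=h_\mu+(\mu,\rho)+\frac12(\mu,\mu)$; let $\varphi(z)=q^{-z}/[z]_q$. For $i\succ j$ put $B^i_j=\varphi(\eta_{\nu_i}-\eta_{\nu_j})\in\hat U^0$, and $B^i_{\vec m}=B^i_{m_1}\cdots B^i_{m_k}$ for $i\succ\vec m=(m_1,\dots,m_k)$. **The element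 $\tilde{\mathcal S}$.** For $\mu\in\Gamma_+$, $\mu\neq0$, let $\varphi(-D)$ act on $U^+[\mu]\otimes\hat B^-[-\mu]$ by $x\otimes y\mapsto x\otimes\varphi(\tilde\eta_\mu)y=x\otimes y\,\varphi(\eta_\mu)$. (Here $D=\mathrm{id}\otimes[d,-]$ with $d=\frac12\sum_ih_ih_i+h_\rho$.) In the completed tensor product of $U^+$ and $\hat B^-$ define $\tilde{\mathcal S}=\sum_{n\ge0}\tilde{\mathcal S}^{(n)}$ with $\tilde{\mathcal S}^{(0)}=1\otimes1$ and $\tilde{\mathcal S}^{(n+1)}=\varphi(-D)(\tilde{\mathcal S}^{(n)}\mathcal F)$. Write $\tilde S_X=\sum_{i,j}e_{ij}\otimes\tilde S_{ij}$. *)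

(* Defs.v *)
From HB Require Import structures.
From Stdlib Require Import Relation_Operators.
From mathcomp Require Import all_boot all_order all_algebra.
From mathcomp Require Import all_classical all_reals all_analysis.
From mathcomp Require Export complex.

Set Implicit Arguments.
Unset Strict Implicit.
Unset Printing Implicit Defensive.

Import Order.TTheory GRing.Theory Num.Theory.
Local Open Scope classical_set_scope.
Local Open Scope ring_scope.

(* The root system of a semisimple Lie algebra of rank r, with base           *)
(* Pi = {alpha_0, ..., alpha_(r-1)} and invariant form.  The root lattice     *)
(* Gamma = Z Pi is 'rV[int]_r and h^* is 'rV[C]_r, in coordinates on Pi.      *)
(* The form is rational on Gamma; its scale on each simple component is free. *)
Record rootDatum (r : nat) := RootDatum {
  gram  : 'M[rat]_r ;
  roots : seq 'rV[int]_r }.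

Definition ratform r (D : rootDatum r) (x y : 'rV[int]_r) : rat :=
  \sum_i \sum_j (x 0 i)%:~R * gram D i j * (y 0 j)%:~R.

Definition simple r (i : 'I_r) : 'rV[int]_r := delta_mx 0 i.

Definition in_GammaP r (x : 'rV[int]_r) : bool := [forall i, 0 <= x 0 i].

Record is_root_system r (D : rootDatum r) : Prop := IsRootSystem {
  gram_sym     : (gram D)^T = gram D ;
  gram_posdef  : forall x : 'rV[rat]_r, x != 0 ->
                   0 < (x *m gram D *m x^T) 0 0 ;
  roots_uniq   : uniq (roots D) ;
  roots_neq0   : 0 \notin roots D ;
  roots_simple : forall i, simple i \in roots D ;
  roots_base   : forall b, b \in roots D -> in_GammaP b || in_GammaP (- b) ;
  roots_refl   : forall b g, b \in roots D -> g \in roots D ->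
                   exists2 n : int,
                     2 * ratform D g b / ratform D b b = n%:~R
                     & g - n *: b \in roots D ;
  roots_reduced : forall b g (m n : int), b \in roots D -> g \in roots D ->
                   m != 0 -> n != 0 -> m *: b = n *: g -> g = b \/ g = - b }.

Definition posroots r (D : rootDatum r) : seq 'rV[int]_r :=
  [seq b <- roots D | in_GammaP b].

Definition cartan r (D : rootDatum r) (i j : 'I_r) : rat :=
  2 * gram D i j / gram D i i.

Section Weights.
Variables (R : realType) (r : nat) (D : rootDatum r).
Local Notation C := (complex R).
Local Notation hdual := 'rV[C]_r.

Definition form (x y : hdual) : C :=
  \sum_i \sum_j x 0 i * ratr (gram D i j) * y 0 j.

Definition emb (g : 'rV[int]_r) : hdual := map_mx (intr : int -> C) g.

(* The preimage of a weight under emb, and 0 if the weight is not in Gamma.   *)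
Definition lat (m : hdual) : 'rV[int]_r := xget 0 [set g | emb g = m].

Definition rho : hdual := 2^-1 *: \sum_(b <- posroots D) emb b.

(* A pair (m, c) stands for the affine expression h_m + c.                    *)
Definition affine := (hdual * C)%type.

Definition eta (m : hdual) : affine := (m, form m rho - 2^-1 * form m m).
Definition etat (m : hdual) : affine := (m, form m rho + 2^-1 * form m m).

End Weights.

(* [quantum hb] is the case q = exp hb; the choice of the logarithm hb fixes  *)
(* q ^ z := exp (hb z) for complex z.                                         *)
Inductive flavour (R : realType) := quantum of complex R | classical.
Arguments classical {R}.

Section QNumbers.
Variable R : realType.
Local Notation C := (complex R).

Definition cexp (z : C) : C :=
  Complex (expR (complex.Re z) * cos (complex.Im z))
          (expR (complex.Re z) * sin (complex.Im z)).

Definition qpow (hb z : C) : C := cexp (hb * z).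

Definition flavour_ok (k : flavour R) : Prop :=
  match k with
  | quantum hb => forall n, (0 < n)%N -> qpow hb 1 ^+ n != 1
  | classical => True
  end.

Definition qnum (k : flavour R) (z : C) : C :=
  match k with
  | quantum hb => (qpow hb z - qpow hb (- z)) / (qpow hb 1 - qpow hb (- 1))
  | classical => z
  end.

(* Gaussian binomials at q ^ s.                                               *)
Definition qint (k : flavour R) (s : C) (n : nat) : C :=
  qnum k (n%:R * s) / qnum k s.
Definition qfact k s n : C := \prod_(1 <= m < n.+1) qint k s m.
Definition qbin k s n m : C := qfact k s n / (qfact k s m * qfact k s (n - m)).

End QNumbers.

Section Algebra.
Variables (K : fieldType) (M : algType K).

Definition is_subalg (S : set M) : Prop :=
  [/\ S 1, forall (a : K) x y, S x -> S y -> S (a *: x + y)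
         & forall x y, S x -> S y -> S (x * y)].

Definition is_left_ideal (A J : set M) : Prop :=
  [/\ J 0, forall x y, J x -> J y -> J (x + y)
         & forall a x, A a -> J x -> J (a * x)].

Definition is_right_ideal (A J : set M) : Prop :=
  [/\ J 0, forall x y, J x -> J y -> J (x + y)
         & forall x a, J x -> A a -> J (x * a)].

Definition is_lie_subalg (S : set M) : Prop :=
  [/\ S 0, forall (a : K) x y, S x -> S y -> S (a *: x + y)
         & forall x y, S x -> S y -> S (x * y - y * x)].

Definition bilinear_on (P Q : set M) (Z : lmodType K) (b : M -> M -> Z) :=
  (forall (a : K) x x' y, P x -> P x' -> Q y ->
     b (a *: x + x') y = a *: b x y + b x' y) /\
  (forall (a : K) x y y', P x -> Q y -> Q y' ->
     b x (a *: y + y') = a *: b x y + b x y').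

(* A finite list of pairs stands for the sum of the tensors p.1 (x) p.2.      *)
(* For subspaces P and Q and lists with entries in P * Q, [tens_eq P Q s t]   *)
(* is the equality of these sums in P (x) Q: by the universal property two    *)
(* tensors are equal iff all bilinear maps agree on them.                     *)
Definition tens := seq (M * M).

Definition tens_eq (P Q : set M) (s t : tens) : Prop :=
  forall (Z : lmodType K) (b : M -> M -> Z), bilinear_on P Q b ->
    \sum_(p <- s) b p.1 p.2 = \sum_(p <- t) b p.1 p.2.

Definition tens_mul (s t : tens) : tens :=
  [seq (p.1 * p'.1, p.2 * p'.2) | p <- s, p' <- t].

(* A is free over P (x) Q, acting by (u (x) v) . a = u a v.                   *)
Definition free_bimodule (P Q A : set M) : Prop :=
  exists (I : choiceType) (b : I -> M),
  [/\ forall i, A (b i),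
      forall a, A a -> exists s : seq (M * I * M),
        (forall p, p \in s -> P p.1.1 /\ Q p.2) /\
        a = \sum_(p <- s) p.1.1 * b p.1.2 * p.2
    & forall s : seq (M * I * M),
        (forall p, p \in s -> P p.1.1 /\ Q p.2) ->
        \sum_(p <- s) p.1.1 * b p.1.2 * p.2 = 0 ->
        forall i, tens_eq P Q [seq (p.1.1, p.2) | p <- s & p.1.2 == i] [::] ].

End Algebra.

Section Enveloping.
Variables (R : realType) (r : nat) (D : rootDatum r) (k : flavour R).
Local Notation C := (complex R).
Local Notation hdual := 'rV[C]_r.

Section InAlgebra.
Variable M : unitAlgType C.
(* t i is q ^ (h_alpha_i) in the quantum case and h_alpha_i in the classical. *)
Variables e f t : 'I_r -> M.

(* q ^ (h_g), for g in Gamma; the limit at q -> 1 is 1.                       *)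
Definition qh (g : 'rV[int]_r) : M :=
  match k with
  | quantum _ => \prod_i t i ^ (g 0 i)
  | classical => 1
  end.

(* [h_m + c]_q; m is in Gamma in the quantum case.                            *)
Definition br (a : affine R r) : M :=
  match k with
  | quantum hb => (qpow hb 1 - qpow hb (- 1))^-1 *:
      (qpow hb a.2 *: qh (lat a.1) - qpow hb (- a.2) *: qh (- lat a.1))
  | classical => \sum_i a.1 0 i *: t i + a.2%:A
  end.

(* phi (h_m + c), where phi z = q ^ (- z) / [z]_q, resp. phi z = 1 / z.       *)
Definition phi (a : affine R r) : M :=
  match k with
  | quantum hb => (qpow hb (- a.2) *: qh (- lat a.1)) * (br a)^-1
  | classical => (br a)^-1
  end.

(* a has weight l, up to the relation eqv: under the adjoint action of U^0,   *)
(* q ^ h a q ^ (- h) = q ^ (l (h)) a, resp. [h, a] = l (h) a.                 *)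
Definition wt_upto (eqv : M -> M -> Prop) (l : hdual) (a : M) : Prop :=
  forall i, match k with
  | quantum hb => eqv (t i * a * (t i)^-1)
                      (qpow hb (form D (emb R (simple i)) l) *: a)
  | classical => eqv (t i * a - a * t i) (form D (emb R (simple i)) l *: a)
  end.

Definition has_weight : hdual -> M -> Prop := wt_upto (@eq M).

Definition serre (x : 'I_r -> M) (i j : 'I_r) : M :=
  let n := Num.truncn (1 - cartan D i j) in
  \sum_(m < n.+1) ((-1) ^+ m * qbin k (ratr (gram D i i / 2)) n m) *:
     (x i ^+ (n - m) * x j * x i ^+ m).

Record enveloping_relations : Prop := EnvelopingRelations {
  rel_unit : match k with
             | quantum _ => forall i, t i \is a GRing.unit
             | classical => True
             end ;
  rel_tt : forall i j, t i * t j = t j * t i ;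
  rel_te : forall j, has_weight (emb R (simple j)) (e j) ;
  rel_tf : forall j, has_weight (- emb R (simple j)) (f j) ;
  rel_ef : forall i j, e i * f j - f j * e i =
             if i == j then br (emb R (simple i), 0) else 0 ;
  rel_see : forall i j, i != j -> serre e i j = 0 ;
  rel_sff : forall i j, i != j -> serre f i j = 0 }.

Definition alg_gen (S : set M) : set M := smallest (@is_subalg _ M) S.

Definition Upos : set M := alg_gen (range e).
Definition Uneg : set M := alg_gen (range f).
Definition cartan_gens : set M :=
  match k with
  | quantum _ => range t `|` range (fun i => (t i)^-1)
  | classical => range t
  end.
Definition Uzero : set M := alg_gen cartan_gens.
Definition Bpos : set M := alg_gen (Upos `|` Uzero).
Definition Uall : set M := alg_gen (range e `|` range f `|` cartan_gens).

Definition wtspace (S : set M) (l : hdual) : set M :=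
  [set a | S a /\ has_weight l a].

End InAlgebra.

(* The subalgebra Uall of M is presented by the generators e, f, t and the    *)
(* defining relations.                                                        *)
Definition is_enveloping (M : unitAlgType C) (e f t : 'I_r -> M) : Prop :=
  enveloping_relations e f t /\
  forall (N : unitAlgType C) (e' f' t' : 'I_r -> N),
    enveloping_relations e' f' t' ->
    exists g : M -> N,
      [/\ g 1 = 1,
          forall (a : C) x y, Uall e f t x -> Uall e f t y ->
            g (a *: x + y) = a *: g x + g y,
          forall x y, Uall e f t x -> Uall e f t y -> g (x * y) = g x * g y
        & forall i, [/\ g (e i) = e' i, g (f i) = f' i & g (t i) = t' i] ].

Section Tensors.
Variable M : unitAlgType C.
Variables e f t : 'I_r -> M.
Local Notation U := (Uall e f t).

(* An element of a completed tensor product, homogeneous for the total        *)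
(* weight, is the family of its components, indexed by the weight of the      *)
(* first tensor factor.                                                       *)
Definition ctens := 'rV[int]_r -> tens M.

(* A homogeneous element of U (x) U, as a list of (weight of x, x, y).        *)
Definition htens := seq ('rV[int]_r * M * M).

Definition ctens_mulr (T : ctens) (d : htens) : ctens := fun g =>
  flatten [seq tens_mul (T (g - p.1.1)) [:: (p.1.2, p.2)] | p <- d].
Definition ctens_mull (d : htens) (T : ctens) : ctens := fun g =>
  flatten [seq tens_mul [:: (p.1.2, p.2)] (T (g - p.1.1)) | p <- d].

(* The values of Delta on generators; Deltat is obtained by inverting q.      *)
Definition Delta_e (s : int) (i : 'I_r) : htens :=
  [:: (simple i, e i, qh t (s *: simple i)); (0, 1, e i)].
Definition Delta_f (s : int) (i : 'I_r) : htens :=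
  [:: (- simple i, f i, 1); (0, qh t (- s *: simple i), f i)].
Definition Delta_h (s : int) (i : 'I_r) : htens :=
  [:: (0, qh t (s *: simple i), qh t (s *: simple i))].

Definition intertwines (T : ctens) (d d' : htens) : Prop :=
  forall g, tens_eq U U (ctens_mulr T d g) (ctens_mull d' T g).

(* Rc is the reduced universal R-matrix.  As Delta and Deltat are algebra     *)
(* morphisms, Rc Delta(u) = Deltat(u) Rc on generators gives it on U.         *)
Record is_reduced_Rmatrix (Rc : ctens) : Prop := IsReducedRmatrix {
  Rc_supp : forall g, ~~ in_GammaP g -> Rc g = [::] ;
  Rc_wt   : forall g p, p \in Rc g ->
              wtspace t (Upos e) (emb R g) p.1 /\
              wtspace t (Uneg f) (- emb R g) p.2 ;
  Rc_zero : tens_eq U U (Rc 0) [:: (1, 1)] ;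
  Rc_e : forall i, intertwines Rc (Delta_e 1 i) (Delta_e (-1) i) ;
  Rc_f : forall i, intertwines Rc (Delta_f 1 i) (Delta_f (-1) i) ;
  Rc_h : forall i, intertwines Rc (Delta_h 1 i) (Delta_h 1 i) ;
  Rc_hV : forall i, intertwines Rc (Delta_h (-1) i) (Delta_h (-1) i) }.

Definition F_of_Rmatrix (hb : C) (Rc : ctens) : ctens := fun g =>
  [seq ((qpow hb 1 - qpow hb (- 1))^-1 *: p.1, p.2)
    | p <- Rc g ++ (if g == 0 then [:: (-1, 1)] else [::])].

Definition lie_gen (S : set M) : set M := smallest (@is_lie_subalg _ M) S.

(* An invariant form on the Lie algebra g generated by e, f, t, inducing the  *)
(* given form on h^* through l |-> h_l.                                       *)
Definition is_invariant_form (kap : M -> M -> C) : Prop :=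
  let g := lie_gen (range e `|` range f `|` range t) in
  [/\ forall (a : C) x x' y, g x -> g x' -> g y ->
        kap (a *: x + x') y = a * kap x y + kap x' y,
      forall x y, g x -> g y -> kap x y = kap y x,
      forall x y z, g x -> g y -> g z ->
        kap (x * y - y * x) z = kap x (y * z - z * y)
    & forall i j, kap (t i) (t j) = ratr (gram D i j)].

(* Root vectors eb b in g_+ and fb b in g_- for the positive roots b, dual    *)
(* with respect to the invariant form.                                        *)
Record is_root_vectors (eb fb : 'rV[int]_r -> M) : Prop := IsRootVectors {
  rv_pos : forall b, b \in posroots D ->
             wtspace t (lie_gen (range e)) (emb R b) (eb b) ;
  rv_neg : forall b, b \in posroots D ->
             wtspace t (lie_gen (range f)) (- emb R b) (fb b) ;
  rv_pos_span : forall x, lie_gen (range e) x ->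
             exists c : 'rV[int]_r -> C, x = \sum_(b <- posroots D) c b *: eb b ;
  rv_neg_span : forall x, lie_gen (range f) x ->
             exists c : 'rV[int]_r -> C, x = \sum_(b <- posroots D) c b *: fb b ;
  rv_dual : exists2 kap, is_invariant_form kap &
             forall b b', b \in posroots D -> b' \in posroots D ->
               kap (eb b) (fb b') = (b == b')%:R }.

Definition F_of_root_vectors (eb fb : 'rV[int]_r -> M) : ctens := fun g =>
  [seq (eb b, fb b) | b <- posroots D & b == g].

Definition is_F (F : ctens) : Prop :=
  match k with
  | quantum hb =>
      exists2 Rc, is_reduced_Rmatrix Rc & F = F_of_Rmatrix hb Rc
  | classical =>
      exists eb fb, is_root_vectors eb fb /\ F = F_of_root_vectors eb fb
  end.

(* The tensor S~.  [box g] lists the weights in Gamma_+ whose coordinates     *)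
(* do not exceed the height of g, so that (S F)_g is the sum of the           *)
(* S_(g - c) F_c over c in box g.  Since F has no component of weight 0 the   *)
(* n-th term has none of height less than n.                                  *)
Definition height (g : 'rV[int]_r) : nat := (\sum_i `|g 0%R i|)%N.

Definition box (g : 'rV[int]_r) : seq 'rV[int]_r :=
  [seq \row_i (c i : nat)%:Z | c : {ffun 'I_r -> 'I_(height g).+1}].

Definition ctens_mul (S T : ctens) : ctens := fun g =>
  flatten [seq tens_mul (S (g - c)) (T c) | c <- box g].

Definition phiD (T : ctens) : ctens := fun g =>
  if in_GammaP g && (g != 0)
  then [seq (p.1, phi t (etat D (emb R g)) * p.2) | p <- T g]
  else [::].

Fixpoint St_term (F : ctens) (n : nat) : ctens :=
  match n with
  | 0%N => fun g => if g == 0 then [:: (1, 1)] else [::]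
  | n'.+1 => phiD (ctens_mul (St_term F n') F)
  end.

Definition St (F : ctens) : ctens := fun g =>
  flatten [seq St_term F n g | n <- iota 0 (height g).+1].

Definition left_ideal_gen (A S : set M) : set M := smallest (is_left_ideal A) S.
Definition right_ideal_gen (A S : set M) : set M :=
  smallest (is_right_ideal A) S.

Definition is_admissible (A : set M) : Prop :=
  [/\ is_subalg A, U `<=` A,
      forall a, A a -> exists s : seq M,
        (forall x, x \in s -> exists l, wtspace t A l x) /\ a = \sum_(x <- s) x
    & free_bimodule (Uneg f) (Bpos e t) A].

(* The elements h_m - c with m in Gamma_+, m != 0, and c in Cs.               *)
Definition loc (Cs : set C) : set (affine R r) :=
  [set a | exists g c, [/\ in_GammaP g, g != 0, Cs c & a = (emb R g, - c)]].

Definition loc_inv (Cs : set C) : set M :=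
  [set (br t a)^-1 | a in loc Cs].

Definition hat (Cs : set C) (S : set M) : set M := alg_gen (S `|` loc_inv Cs).

(* The denominators are inverted in M, their set is stable under the          *)
(* weights of A (so that they can be moved across A), and the elements        *)
(* phi (eta_g) and phi (etat_g) are defined.                                  *)
Definition is_localization (A : set M) (Cs : set C) : Prop :=
  [/\ forall a, loc Cs a -> br t a \is a GRing.unit,
      forall c g l x, Cs c -> wtspace t A l x -> x != 0 ->
        Cs (c + form D (emb R g) l)
    & forall g, in_GammaP g -> g != 0 ->
        loc Cs (eta D (emb R g)) /\ loc Cs (etat D (emb R g))].

(* M itself is the extension of A that contains the extension Ub of U; the    *)
(* extended ideals are generated in M by the e, resp. by the f.               *)
Record is_extremal_projector (A : set M) (Cs : set C) (Ub : set M) (P : M) :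
    Prop := IsExtremalProjector {
  ep_ext   : is_subalg Ub /\ hat Cs U `<=` Ub ;
  ep_capp  : left_ideal_gen A (range e) =
               left_ideal_gen setT (range e) `&` A ;
  ep_capm  : right_ideal_gen A (range f) =
               right_ideal_gen setT (range f) `&` A ;
  ep_in    : Ub P ;
  ep_wt    : has_weight t 0 P ;
  ep_left  : forall x, left_ideal_gen A (range e) x -> x * P = 0 ;
  ep_right : forall x, right_ideal_gen A (range f) x -> P * x = 0 ;
  ep_idem  : P * P = P ;
  ep_one   : left_ideal_gen setT (range e) (P - 1) /\
             right_ideal_gen setT (range f) (P - 1) }.

(* The left ideal J^_+ of A^.  V^ = A^ / J^_+ is represented by elements of   *)
(* A^ up to [Veq].                                                            *)
Definition Jhat (A : set M) (Cs : set C) : set M :=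
  left_ideal_gen (hat Cs A) (range e).

Definition Veq (A : set M) (Cs : set C) (a b : M) : Prop :=
  Jhat A Cs (a - b).

(* A graded U^+-module with its extension to B^+ and a weight basis x, whose  *)
(* coordinate functionals are coord; [act b] is only meaningful for b in B^+. *)
Record gradedModule := GradedModule {
  gsort :> lmodType C ;
  gidx : choiceType ;
  act : M -> gsort -> gsort ;
  xb : gidx -> gsort ;
  coord : gidx -> gsort -> C ;
  nu : gidx -> hdual ;
  act1 : forall v, act 1 v = v ;
  actM : forall a b v, Bpos e t a -> Bpos e t b ->
           act (a * b) v = act a (act b v) ;
  act_linl : forall (c : C) a b v, Bpos e t a -> Bpos e t b ->
           act (c *: a + b) v = c *: act a v + act b v ;
  act_linr : forall a (c : C) v w, Bpos e t a ->
           act a (c *: v + w) = c *: act a v + act a w ;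
  coord_lin : forall i (c : C) v w,
           coord i (c *: v + w) = c * coord i v + coord i w ;
  coord_xb : forall i j, coord i (xb j) = (i == j)%:R ;
  coord_fin : forall v, finite_set [set i | coord i v != 0] ;
  coord_sum : forall v, v = \sum_(i \in setT) coord i v *: xb i ;
  act_wt : forall i j, act (t i) (xb j) =
             let c := form D (emb R (simple i)) (nu j) in
             match k with
             | quantum hb => qpow hb c *: xb j
             | classical => c *: xb j
             end ;
  nu_diff : forall i j, exists g, nu i - nu j = emb R g ;
  nu_fin : forall l, finite_set [set i | nu i = l] }.

Section Module.
Variable X : gradedModule.
Local Notation I := (gidx X).

Definition pim (u : M) (i j : I) : C := coord i (act u (xb j)).

Definition arrow (j i : I) : Prop := exists a, pim (e a) i j != 0.

Definition succ (i j : I) : Prop := clos_trans I arrow j i.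

(* The (i, j) entry of (pi (x) id) T: only the component of weight            *)
(* nu_i - nu_j contributes.                                                   *)
Definition entry (T : ctens) (i j : I) : M :=
  \sum_(p <- T (lat (nu i - nu j))) pim p.1 i j *: p.2.

(* i, m_1, ..., m_k is a route.                                               *)
Fixpoint route (i : I) (m : seq I) : Prop :=
  match m with
  | [::] => True
  | j :: m' => succ i j /\ route j m'
  end.

Fixpoint phi_route (F : ctens) (i : I) (m : seq I) : M :=
  match m with
  | [::] => 1
  | j :: m' => entry F i j * phi_route F j m'
  end.

Definition psi_route (F : ctens) (psi : I -> M) (i : I) (m : seq I) : M :=
  phi_route F i m * psi (last i m).

Definition Bc (i j : I) : M := phi t (eta D (nu i) - eta D (nu j)).

Definition Bc_route (i : I) (m : seq I) : M := \prod_(j <- m) Bc i j.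

(* psi is the family of the images in V^ of the dual basis of X^*, under an   *)
(* embedding of X^* in V^.                                                    *)
Record is_right_Mickelsson (A : set M) (Cs : set C) (psi : I -> M) : Prop :=
  IsRightMickelsson {
  mg_in : forall i, hat Cs A (psi i) ;
  mg_wt : forall i, wt_upto t (Veq A Cs) (- nu i) (psi i) ;
  mg_free : forall (s : seq I) (c : I -> C), uniq s ->
      Veq A Cs (\sum_(i <- s) c i *: psi i) 0 -> {in s, forall i, c i = 0} ;
  mg_inv : forall a i, Veq A Cs
      (e a * psi i + \sum_(j \in [set j | pim (e a) i j != 0])
                        pim (e a) i j *: (qh t (- simple a) * psi j)) 0 }.

Definition z_comp (F : ctens) (psi : I -> M) (i : I) : M :=
  \sum_(j \in setT) entry (St F) i j * psi j.

End Module.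
End Tensors.
End Enveloping.

(* Main.v *)
(* Write S_j for the (i, j) entry of S~, F_lj for the entries of F, and
   T(z) = 1 / phi(z) = q^z [z]_q.  The definition of S~ reads
   T(etat_(nu_i - nu_j)) S_j = sum_l S_l F_lj.

   Unfolding this recursion, S_j is a sum over the routes from i to j of products
   of F's and Cartan factors.  Moving each Cartan factor to the right past the
   F's and past psi_j (modulo J^) turns it into B^i_m, which is the first equality.

   For the second one, both the intertwining property of the R-matrix and,
   classically, the invariance of the form give
     e (x) [h] = (1 (x) e + e (x) q^-h) F - F (1 (x) e + e (x) q^h)
   for e = e_alpha, h = h_alpha.  Let S' solve the recursion with etat_g replaced
   by etat_g - (alpha, g).  Because (alpha, rho) = (alpha, alpha) / 2, this
   relation shows that Y = (1 (x) e) S~ - S' (1 (x) e + e (x) q^-h) satisfies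
   T(etat_g - (alpha, g)) Y = Y F.  Induction on the height gives Y = 0, so by the
   invariance of psi_X the element e annihilates z_i modulo J^.  Hence
   z_i P = P z_i P, and P z_i P = P psi_i P because P F_ij = 0. *)
Require Import Defs.
From mathcomp Require Import all_boot all_order all_algebra.
From mathcomp Require Import all_classical all_reals all_analysis.
From mathcomp Require Import ring.

Import Order.TTheory GRing.Theory Num.Theory.
Local Open Scope classical_set_scope.
Local Open Scope ring_scope.
Local Notation form := Defs.form.
Local Notation coord := Defs.coord.
Local Notation roots := Defs.roots.

(** The recursion for Y closes because T(z) = (q^(2z) - 1) / (q - q^-1), hence T(z + w) = T(z)
    q^(2w) + T(w). The entries of e add alpha to the weight; the first summand then reproduces the
    recursion for S', and the second one, multiplied by q^-h, is the [h] in the relation for F.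
    Classically T(z) = z and q^h is read as 1, so one computation serves both flavours. Two
    obstacles shape the rest. Equality of tensors is tested on maps bilinear on all of U, while
    matrix entries of X are linear on B^+ only; they are extended to functionals on M by Zorn's
    lemma. And psi_j has a weight only modulo J^, a left ideal, so moving Cartan factors past psi_j
    requires J^ to be stable under right multiplication by the localised U^0; it is, because Cartan
    elements cross each e_alpha with a mere shift. The sums over routes are finite because each step
    of a route raises the height and only finitely many indices lie below i. The shifted
    denominators stay invertible because [Cs] is stable under the weights of nonzero vectors of
    A. *)

Section Subalgebras.
Set Implicit Arguments.
Unset Strict Implicit.
Variables (R : realType) (M : unitAlgType (complex R)).
Implicit Types (S A J : set M).

Lemma subalg_smallest S : is_subalg (alg_gen S).
Proof.
split.
- by move=> T [[]].
- by move=> a x y xS yS T TS; case: (TS) => [[_ TL _] _]; apply: TL; [apply: xS|apply: yS].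
- by move=> x y xS yS T TS; case: (TS) => [[_ _ TM] _]; apply: TM; [apply: xS|apply: yS].
Qed.

Lemma alg_gen_min S A : is_subalg A -> S `<=` A -> alg_gen S `<=` A.
Proof. exact: smallest_sub. Qed.

Lemma sub_alg_gen S : S `<=` alg_gen S.
Proof. exact: sub_gen_smallest. Qed.

Lemma alg_genS S A : S `<=` A -> alg_gen S `<=` alg_gen A.
Proof.
move=> SA; apply: alg_gen_min; first exact: subalg_smallest.
exact: subset_trans SA (@sub_alg_gen A).
Qed.

Section Closure.
Variable S : set M.
Hypothesis hS : is_subalg S.

Lemma subalg1 : S 1. Proof. by case: hS. Qed.

Lemma subalgM x y : S x -> S y -> S (x * y).
Proof. by case: hS => _ _; apply. Qed.

Lemma subalgD x y : S x -> S y -> S (x + y).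
Proof. by move=> Sx Sy; rewrite -(scale1r x); case: hS => _ + _; apply. Qed.

Lemma subalg0 : S 0.
Proof.
rewrite -(addNr 1) -(scaleN1r 1); case: hS => S1 + _; apply => //; exact: subalg1.
Qed.

Lemma subalgZ c x : S x -> S (c *: x).
Proof. by move=> Sx; rewrite -(addr0 (c *: x)); case: hS => _ + _; apply=> //; exact:
    subalg0. Qed.

Lemma subalgN x : S x -> S (- x).
Proof. by rewrite -scaleN1r; exact: subalgZ. Qed.

Lemma subalgB x y : S x -> S y -> S (x - y).
Proof. by move=> Sx Sy; apply: subalgD => //; exact: subalgN. Qed.

Lemma subalg_sum (I : eqType) (s : seq I) (G : I -> M) :
  (forall i, i \in s -> S (G i)) -> S (\sum_(i <- s) G i).
Proof.
move=> SG; rewrite big_seq; elim/big_ind: _ => //; first exact: subalg0.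
by move=> x y; exact: subalgD.
Qed.

Lemma subalg_prod (I : eqType) (s : seq I) (G : I -> M) :
  (forall i, i \in s -> S (G i)) -> S (\prod_(i <- s) G i).
Proof.
move=> SG; rewrite big_seq; elim/big_ind: _ => //; first exact: subalg1.
by move=> x y; exact: subalgM.
Qed.

Lemma subalgX x n : S x -> S (x ^+ n).
Proof. by move=> Sx; elim: n => [|n IH]; rewrite ?expr0 ?exprS; [exact: subalg1|exact:
    subalgM]. Qed.

Lemma subalgXz x (n : int) : S x -> S x^-1 -> S (x ^ n).
Proof.
case: n => n Sx SV; first exact: (subalgX n Sx).
by rewrite NegzE -exprnN -exprVn; exact: subalgX.
Qed.

End Closure.

Lemma left_ideal_smallest A S : is_left_ideal A (left_ideal_gen A S).
Proof.
split.
- by move=> T [[]].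
- by move=> x y xS yS T TS; case: (TS) => [[_ TL _] _]; apply: TL; [apply: xS|apply: yS].
- by move=> x y xS yS T TS; case: (TS) => [[_ _ TM] _]; apply: TM => //; apply: yS.
Qed.

Lemma right_ideal_smallest A S : is_right_ideal A (right_ideal_gen A S).
Proof.
split.
- by move=> T [[]].
- by move=> x y xS yS T TS; case: (TS) => [[_ TL _] _]; apply: TL; [apply: xS|apply: yS].
- by move=> x y xS yS T TS; case: (TS) => [[_ _ TM] _]; apply: TM => //; apply: xS.
Qed.

Lemma lie_subalg_smallest S : is_lie_subalg (lie_gen S).
Proof.
split.
- by move=> T [[]].
- by move=> a x y xS yS T TS; case: (TS) => [[_ TL _] _]; apply: TL; [apply: xS|apply: yS].
- by move=> x y xS yS T TS; case: (TS) => [[_ _ TM] _]; apply: TM; [apply: xS|apply: yS].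
Qed.

Lemma subalg_lie S : is_subalg S -> is_lie_subalg S.
Proof.
move=> hS; split; first exact: subalg0.
- by move=> a x y Sx Sy; apply: subalgD => //; exact: subalgZ.
- by move=> x y Sx Sy; apply: subalgB => //; exact: subalgM.
Qed.

Lemma lie_gen_sub S A : is_lie_subalg A -> S `<=` A -> lie_gen S `<=` A.
Proof. exact: smallest_sub. Qed.

End Subalgebras.

(** * Extension of linear functionals from a subspace *)

Section LinearExtension.
Set Implicit Arguments.
Unset Strict Implicit.
Variables (K : fieldType) (V : lmodType K).

Let graph := set (V * K).
Let lin_graph (G : graph) :=
  [/\ forall a x y, G x -> G y -> G (a *: x.1 + y.1, a * x.2 + y.2)
    & forall c, G (0, c) -> c = 0].

(* Zorn's lemma, applied to the graphs of partial linear functionals.         *)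
Lemma linear_extension (S : set V) (l : V -> K) :
    S 0 -> (forall a x y, S x -> S y -> S (a *: x + y)) ->
    (forall a x y, S x -> S y -> l (a *: x + y) = a * l x + l y) ->
  exists l' : V -> K, (forall a x y, l' (a *: x + y) = a * l' x + l' y) /\
    forall x, S x -> l' x = l x.
Proof.
move=> S0 SL lL.
pose G0 : graph := [set p | S p.1 /\ p.2 = l p.1].
have l0 : l 0 = 0 by have := lL (-1) 0 0 S0 S0; rewrite scaler0 addr0 mulN1r addNr.
have G0lin : lin_graph G0.
  split => [a x y [Sx ->] [Sy ->]|c [_ /= ->] //].
  by split => /=; [exact: SL|rewrite lL].
pose T := {G : graph | lin_graph G /\ G0 `<=` G}.
pose t0 : T := exist _ G0 (conj G0lin (@subset_refl _ G0)).
pose le : rel T := fun G H => `[< sval G `<=` sval H >].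
have [| | |z zmax] := @ZL_preorder T t0 le.
- by move=> x; exact/asboolP.
- by move=> x y w /asboolP xy /asboolP yw; apply/asboolP; exact: subset_trans xy yw.
- move=> B Btot.
  (* The empty chain is bounded by [t0], the graph of [l] itself; a nonempty one by its union. *)
  have [[b0 Bb0]|Bn] := pselect (exists b, B b); last first.
    by exists t0 => b Bb; case: Bn; exists b.
  pose H : graph := [set p | exists2 b, B b & sval b p].
  have Hlin : lin_graph H.
    split => [a x y [b Bb bx] [c Bc cy]|c [b Bb]].
      have [d [Bd dx dy]] : exists d, [/\ B d, sval d x & sval d y].
        have [/asboolP bc|/asboolP cb] := Btot _ _ Bb Bc.
          by exists c; split=> //; exact: bc.
        by exists b; split=> //; exact: cb.
      by exists d => //; case: (svalP d) => [[+ _] _]; apply.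
    by case: (svalP b) => [[_ +] _]; apply.
  have H0 : G0 `<=` H.
    by move=> p Gp; exists b0 => //; case: (svalP b0) => _; apply.
  exists (exist _ H (conj Hlin H0) : T) => b Bb.
  by apply/asboolP => p bp; exists b.
have [[zL z0] zG0] := svalP z.
have zfun x c d : sval z (x, c) -> sval z (x, d) -> c = d.
  move=> zc zd; have := zL (-1) _ _ zc zd; rewrite /= scaleN1r addNr.
  by move=> /z0; rewrite mulN1r addrC => /subr0_eq.
have ztot x : exists c, sval z (x, c).
  apply: contrapT => nx.
  (* A functional undefined at [x] is extended by the value 0 there. The result is still
     single-valued: a relation q.1 + a *: x = 0 with a nonzero would put [x] in the domain of
     [z]. *)
  pose H : graph := [set p | exists q : V * K, exists a, [/\ sval z q,
    p.1 = q.1 + a *: x & p.2 = q.2]].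
  have Hlin : lin_graph H.
    split => [a p q [p' [b [zp -> ->]]] [q' [c [zq -> ->]]]|c].
      exists (a *: p'.1 + q'.1, a * p'.2 + q'.2), (a * b + c); split=> //=.
        exact: zL.
      by rewrite scalerDr scalerDl scalerA addrACA.
    move=> [q [a [zq /= /esym q0 ->]]].
    have [a0|a0] := eqVneq a 0.
      by apply: z0; move: q0; rewrite a0 scale0r addr0 => <-; rewrite -surjective_pairing.
    case: nx; exists (- a^-1 * q.2).
    have z00 : sval z (0, 0) by apply: zG0; split=> //=.
    have := zL (- a^-1) q (0, 0) zq z00; rewrite /= !addr0.
    have -> : q.1 = - (a *: x) by apply/eqP; rewrite -addr_eq0 q0.
    by rewrite scalerN scaleNr opprK scalerA mulVf // scale1r.
  have zH : sval z `<=` H by move=> p zp; exists p, 0; rewrite scale0r addr0.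
  pose h : T := exist _ H (conj Hlin (subset_trans zG0 zH)).
  have /zmax /asboolP hz : le z h by apply/asboolP.
  case: nx; exists 0; apply: hz.
  exists (0, 0), 1; split => //=; last by rewrite add0r scale1r.
  by apply: (zG0 (0, 0)); split=> /=.
pose l' x := xget 0 [set c | sval z (x, c)].
have l'P x : sval z (x, l' x) by exact: (@xgetPex _ 0 _ (ztot x)).
exists l'; split => [a x y|x Sx].
  by apply: (zfun _ _ _ (l'P _)); exact: (zL a _ _ (l'P x) (l'P y)).
by apply: (zfun _ _ _ (l'P _)); exact: zG0.
Qed.

End LinearExtension.

(** * Complex powers of q *)

Section QPowers.
Set Implicit Arguments.
Unset Strict Implicit.
Variable R : realType.
Local Notation C := (complex R).

Lemma cexpD (z w : C) : cexp (z + w) = cexp z * cexp w.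
Proof.
case: z => a b; case: w => c d; rewrite /cexp /=.
apply/eqP; rewrite eq_complex /= expRD cosD sinD; apply/andP; split; apply/eqP; ring.
Qed.

Lemma cexp0 : cexp (0 : C) = 1.
Proof. by rewrite /cexp /= expR0 cos0 sin0 mulr1 mulr0. Qed.

Lemma qpowD hb (x y : C) : qpow hb (x + y) = qpow hb x * qpow hb y.
Proof. by rewrite /qpow mulrDr cexpD. Qed.

Lemma qpow0 hb : qpow hb (0 : C) = 1.
Proof. by rewrite /qpow mulr0 cexp0. Qed.

Lemma qpow_neq0 hb (x : C) : qpow hb x != 0.
Proof.
apply/eqP => q0; have := qpowD hb x (- x); rewrite subrr qpow0 q0 mul0r => /eqP.
by rewrite oner_eq0.
Qed.

Lemma qpowN hb (x : C) : qpow hb (- x) = (qpow hb x)^-1.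
Proof.
by apply: (mulfI (qpow_neq0 hb x)); rewrite -qpowD subrr qpow0 mulfV ?qpow_neq0.
Qed.

Lemma qpow_natM hb (x : C) n : qpow hb (n%:R * x) = qpow hb x ^+ n.
Proof. by elim: n => [|n IH]; rewrite ?mul0r ?qpow0 // -natr1 mulrDl mul1r qpowD IH
    exprSr. Qed.

Lemma qpow_intM hb (x : C) (n : int) : qpow hb (n%:~R * x) = qpow hb x ^ n.
Proof. by case: n => n; rewrite ?NegzE ?mulrNz ?mulNr ?qpowN qpow_natM. Qed.

(** Raising to the power [denq x] leaves q ^ numq x = 1 with an integer exponent, where the
    assumption on roots of unity applies. For complex exponents the conclusion would fail, since the
    exponential is periodic. *)
Lemma qpow_rat_eq1 hb (x : rat) : flavour_ok (quantum hb) ->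
  qpow hb (ratr x : C) = 1 -> x = 0.
Proof.
move=> hk qx.
have : qpow hb 1 ^ (numq x) = 1.
  rewrite -qpow_intM mulr1.
  have -> : (numq x)%:~R = (denq x)%:~R * ratr x :> C.
    by rewrite /ratr mulrCA mulfV ?mulr1 // intr_eq0 denq_eq0.
  by rewrite qpow_intM qx exp1rz.
have := erefl x; rewrite -[X in _ = X]divq_num_den.
case: (numq x) => n xE.
  case: n xE => [xE _|n xE qn]; first by rewrite xE mul0r.
  by case/negP: (hk n.+1 isT); apply/eqP.
rewrite NegzE => /(congr1 GRing.inv); rewrite -exprnN invrK invr1 => qn.
by have := hk n.+1 isT; rewrite qn eqxx.
Qed.

End QPowers.

(** * The form on weights and the pairing of simple roots with rho *)

Section Form.
Set Implicit Arguments.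
Unset Strict Implicit.
Variables (R : realType) (r : nat) (D : rootDatum r).
Local Notation C := (complex R).
Local Notation hdual := 'rV[C]_r.
Implicit Types (x y : hdual) (g h : 'rV[int]_r).

Lemma formDl x x' y : form D (x + x') y = form D x y + form D x' y.
Proof.
rewrite /form -big_split; apply: eq_bigr => i _; rewrite -big_split.
by apply: eq_bigr => j _; rewrite mxE !mulrDl.
Qed.

Lemma formDr x y y' : form D x (y + y') = form D x y + form D x y'.
Proof.
rewrite /form -big_split; apply: eq_bigr => i _; rewrite -big_split.
by apply: eq_bigr => j _; rewrite mxE !mulrDr.
Qed.

Lemma formZl c x y : form D (c *: x) y = c * form D x y.
Proof.
rewrite /form mulr_sumr; apply: eq_bigr => i _; rewrite mulr_sumr.
by apply: eq_bigr => j _; rewrite mxE !mulrA.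
Qed.

Lemma formZr c x y : form D x (c *: y) = c * form D x y.
Proof.
rewrite /form mulr_sumr; apply: eq_bigr => i _; rewrite mulr_sumr.
by apply: eq_bigr => j _; rewrite mxE; ring.
Qed.

Lemma form0l y : form D 0 y = 0.
Proof. by rewrite -(scale0r 0) formZl mul0r. Qed.

Lemma form0r x : form D x 0 = 0.
Proof. by rewrite -(scale0r 0) formZr mul0r. Qed.

Lemma formNl x y : form D (- x) y = - form D x y.
Proof. by rewrite -scaleN1r formZl mulN1r. Qed.

Lemma formNr x y : form D x (- y) = - form D x y.
Proof. by rewrite -scaleN1r formZr mulN1r. Qed.

Lemma form_sumr x (I : Type) (s : seq I) (G : I -> hdual) :
  form D x (\sum_(i <- s) G i) = \sum_(i <- s) form D x (G i).
Proof. by elim/big_rec2: _ => [|i u v _ <-]; rewrite ?form0r ?formDr. Qed.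

Lemma formC x y : is_root_system D -> form D x y = form D y x.
Proof.
move=> hD; rewrite /form exchange_big; apply: eq_bigr => i _; apply: eq_bigr => j _.
by rewrite -{1}(gram_sym hD) mxE; ring.
Qed.

Lemma embD g h : emb R (g + h) = emb R g + emb R h.
Proof. by apply/rowP => i; rewrite !mxE intrD. Qed.

Lemma embN g : emb R (- g) = - emb R g.
Proof. by apply/rowP => i; rewrite !mxE intrN. Qed.

Lemma embB g h : emb R (g - h) = emb R g - emb R h.
Proof. by rewrite embD embN. Qed.

Lemma emb0 : emb R (0 : 'rV[int]_r) = 0.
Proof. by apply/rowP => i; rewrite !mxE. Qed.

Lemma embZ (n : int) g : emb R (n *: g) = n%:~R *: emb R g.
Proof. by apply/rowP => i; rewrite !mxE intrM. Qed.

Lemma emb_inj : injective (@emb R r).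
Proof. by move=> g h /rowP gh; apply/rowP => i; have := gh i; rewrite !mxE =>
    /intr_inj. Qed.

Lemma embK g : lat (emb R g) = g.
Proof. by apply: emb_inj; apply: (@xgetPex _ 0 [set h | emb R h = emb R g]); exists g. Qed.

Lemma form_emb g h : form D (emb R g) (emb R h) = ratr (ratform D g h).
Proof.
rewrite /form /ratform rmorph_sum; apply: eq_bigr => i _; rewrite rmorph_sum.
by apply: eq_bigr => j _; rewrite !mxE !rmorphM /= !ratr_int.
Qed.

Lemma form_simple_emb i g :
  form D (emb R (simple i)) (emb R g) = ratr (\sum_j gram D i j * (g 0 j)%:~R).
Proof.
rewrite form_emb /ratform (bigD1 i) //= [X in _ + X]big1 ?addr0 => [|j ji].
  by congr ratr; apply: eq_bigr => j _; rewrite mxE !eqxx mul1r.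
by apply: big1 => l _; rewrite mxE (negPf ji) andbF !mul0r.
Qed.

Lemma form_emb_expand g y :
  form D (emb R g) y = \sum_i (g 0 i)%:~R * form D (emb R (simple i)) y.
Proof.
rewrite {1}/form; apply: eq_bigr => i _; rewrite /form [in RHS](bigD1 i) //=.
rewrite [X in _ * (_ + X)]big1 ?addr0 => [|j ji].
  by rewrite mulr_sumr; apply: eq_bigr => j _; rewrite !mxE !eqxx mulr1z mul1r -[LHS]mulrA.
by rewrite big1 // => l _; rewrite !mxE (negPf ji) andbF !mul0r.
Qed.

Section RootSystem.
Hypothesis hD : is_root_system D.

(** Since [g] is an integral combination of simple roots, it would have norm 0, against positive
    definiteness. *)
Lemma form_nondeg g :
  (forall i, form D (emb R (simple i)) (emb R g) = 0) -> g = 0.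
Proof.
move=> g0; apply/eqP/negP => /negP gn0.
pose x : 'rV[rat]_r := map_mx (intr : int -> rat) g.
have /(gram_posdef hD) : x != 0.
  apply: contra gn0 => /eqP/rowP x0; apply/eqP/rowP => i.
  by have := x0 i; rewrite !mxE => /eqP; rewrite intr_eq0 => /eqP.
rewrite -mulmxA mxE big1 ?ltxx // => i _.
have := g0 i; rewrite form_simple_emb => /eqP; rewrite fmorph_eq0 => /eqP gi.
by rewrite [X in _ * X]mxE; under [X in _ * X]eq_bigr do rewrite !mxE; rewrite gi mulr0.
Qed.

Lemma form_simple_neq0 i : form D (emb R (simple i)) (emb R (simple i)) != 0.
Proof.
have dn0 : delta_mx 0 i != 0 :> 'rV[rat]_r.
  by apply/negP => /eqP/rowP/(_ i); rewrite !mxE !eqxx => /eqP; rewrite oner_eq0.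
have := gram_posdef hD dn0; rewrite -rowE mxE (bigD1 i) //= big1 ?addr0.
  rewrite !mxE !eqxx mulr1 => /lt0r_neq0 gn0.
  rewrite form_simple_emb (bigD1 i) //= big1 ?addr0.
    by rewrite mxE !eqxx mulr1 fmorph_eq0.
  by move=> j ji; rewrite mxE (negPf ji) andbF mulr0.
by move=> j ji; rewrite !mxE (negPf ji) andbF mulr0.
Qed.

Lemma in_GammaPD g h : in_GammaP g -> in_GammaP h -> in_GammaP (g + h).
Proof. by move=> /forallP gP /forallP hP; apply/forallP => i; rewrite mxE addr_ge0. Qed.

Lemma in_GammaP_simple i : in_GammaP (simple i : 'rV[int]_r).
Proof. by apply/forallP => j; rewrite mxE; case: (_ && _). Qed.

(* The simple reflection permutes the positive roots other than alpha_i.      *)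
Lemma form_simple_rho i :
  form D (emb R (simple i)) (rho R D) =
  2^-1 * form D (emb R (simple i)) (emb R (simple i)).
Proof.
rewrite /rho formZr form_sumr; congr (_ * _).
set al := simple i.
have alP : al \in posroots D by rewrite mem_filter in_GammaP_simple roots_simple.
have posU : uniq (posroots D) by rewrite filter_uniq // roots_uniq.
rewrite (bigD1_seq al) //= -[RHS]addr0; congr (_ + _).
rewrite -big_filter; set L := [seq _ <- _ | _].
have LU : uniq L by rewrite filter_uniq.
pose a : hdual := emb R al.
(* The reflection involves a division, so it is formed among complex weights and pulled back by
   [lat]; [sgE] shows that on roots nothing is lost. *)
pose sg g := lat (emb R g - (2 * form D a (emb R g) / form D a a) *: a).
have sgE g : g \in roots D -> exists n : int,
    [/\ sg g = g - n *: al, g - n *: al \in roots D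
      & 2 * form D a (emb R g) = n%:~R * form D a a].
  move=> gR; have [n nE ngR] := roots_refl hD (roots_simple hD i) gR.
  have nC : 2 * form D a (emb R g) / form D a a = n%:~R.
    by rewrite (formC _ _ hD) !form_emb -(ratr_int _ n) -nE !rmorphM /= fmorphV ratr_nat.
  exists n; split => //; first by rewrite /sg nC -embZ -embB embK.
  by rewrite -nC mulfVK // form_simple_neq0.
have fsg g : g \in roots D -> form D a (emb R (sg g)) = - form D a (emb R g).
  move=> /sgE[n [-> _ nE]]; rewrite embB embZ formDr formNr formZr -nE; ring.
have LR g : g \in L -> g \in roots D by rewrite !mem_filter => /and3P[].
have sgL g : g \in L -> sg g \in L.
  rewrite mem_filter mem_filter => /and3P[gal gP gR].
  have [n [-> ngR _]] := sgE g gR.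
  (* Without such a coordinate [g] would be a multiple of alpha_i, hence alpha_i itself as the
     system is reduced. The reflection alters only coordinate i, so the image keeps a positive
     coordinate and is a positive root. *)
  have [j ji gj] : exists2 j, j != i & 0 < g 0 j.
    apply: contrapT => nj.
    have gE : g = (g 0 i) *: al.
      apply/rowP => j; rewrite !mxE eqxx /=; have [->|ji] := eqVneq j i; first by
          rewrite mulr1.
      rewrite mulr0; apply/eqP/negPn/negP => gj0; apply: nj; exists j => //.
      by rewrite lt_def gj0; move/forallP: gP; apply.
    have g1 : (1 : int) *: g = g 0 i *: al by rewrite scale1r.
    have gi0 : g 0 i != 0.
      by apply/negP => /eqP gi; move: (roots_neq0 hD); rewrite -[0](scale0r al) -gi -gE gR.
    case: (@roots_reduced _ _ hD _ _ 1 (g 0 i) gR (roots_simple hD i) isT gi0 g1) => E.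
      by rewrite -E eqxx in gal.
    have := forallP gP i; rewrite -[g]opprK -E !mxE !eqxx.
    by [].
  have sj : (g - n *: al) 0 j = g 0 j by rewrite !mxE (negPf ji) andbF mulr0 subr0.
  rewrite !mem_filter ngR andbT; apply/andP; split.
    by apply/negP => /eqP E; move: gj; rewrite -sj E mxE (negPf ji) andbF ltxx.
  have /orP[//|/forallP/(_ j)] := roots_base hD ngR.
  by rewrite mxE sj oppr_ge0 leNgt gj.
have sgK : {in L, involutive sg}.
  move=> g gL; rewrite {1}/sg fsg ?LR //.
  have [n [-> _ nE]] := sgE g (LR g gL).
  apply: emb_inj; rewrite -[X in lat X](_ : emb R g = _) ?embK // embB embZ.
  rewrite mulrN mulNr nE mulfK ?form_simple_neq0 // scaleNr opprK subrK //.
have pL : perm_eq (map sg L) L.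
  have mU : uniq (map sg L).
    by rewrite map_inj_in_uniq // => g h gL hL E; rewrite -(sgK g gL) E sgK.
  have sub : {subset map sg L <= L} by move=> _ /mapP[g gL ->]; exact: sgL.
  have [_ E] := uniq_min_size mU sub (eq_leq (esym (size_map _ _))).
  by apply: uniq_perm => //.
set S := \sum_(_ <- _) _.
(* The reflection permutes [L] and reverses the sign of the pairing with alpha_i. *)
have SN : S = - S.
  rewrite {1}/S -(perm_big _ pL) /= big_map -sumrN.
  by apply: eq_big_seq => g gL; rewrite fsg // LR.
have : 2 * S = 0 by rewrite mulr_natl mulr2n {1}SN addNr.
by move=> /eqP; rewrite mulf_eq0 pnatr_eq0 => /eqP.
Qed.

End RootSystem.
End Form.

(** * Moving Cartan elements across weight vectors *)

Section CartanCommutation.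
Set Implicit Arguments.
Unset Strict Implicit.
Variables (R : realType) (r : nat) (D : rootDatum r) (k : flavour R).
Variables (M : unitAlgType (complex R)) (t : 'I_r -> M).
Local Notation C := (complex R).
Local Notation hdual := 'rV[C]_r.
Local Notation Gam := 'rV[int]_r.
Hypothesis t_unit : match k with
                    | quantum _ => forall i, t i \is a GRing.unit
                    | classical => True
                    end.
Hypothesis t_comm : forall i j, t i * t j = t j * t i.

(* q ^ (h_g + c); the limit at q -> 1 is 1.                                   *)
Definition qexp (g : Gam) (c : C) : M :=
  match k with
  | quantum hb => qpow hb c *: qh k t g
  | classical => 1
  end.

(* The inverse q ^ z [z]_q of phi z, for z = h_g + c.                         *)
Definition phi_inv (g : Gam) (c : C) : M := br k t (emb R g, c) * qexp g c.

Lemma commrZ c (y z : M) : GRing.comm y z -> GRing.comm y (c *: z).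
Proof. by rewrite /GRing.comm -scalerAr -scalerAl => ->. Qed.

Lemma comm_qh y : (forall i, GRing.comm y (t i)) -> forall g, GRing.comm y (qh k t g).
Proof.
move=> yt g; rewrite /qh; case: k => [hb|]; last exact: commr1.
by apply: commr_prod => i _; apply: commrXz.
Qed.

Lemma comm_br y : (forall i, GRing.comm y (t i)) -> forall a, GRing.comm y (br k t a).
Proof.
move=> yt a; have := comm_qh yt; rewrite /br; case: k => [hb|] h.
  by apply: commrZ; apply: commrB; apply: commrZ; apply: h.
apply: commrD; last by apply: commrZ; exact: commr1.
by apply: commr_sum => i _; apply: commrZ; exact: yt.
Qed.

Lemma comm_brV y : (forall i, GRing.comm y (t i)) ->
  forall a, GRing.comm y (br k t a)^-1.
Proof. by move=> yt a; apply: commrV; exact: comm_br. Qed.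

Lemma comm_phi y : (forall i, GRing.comm y (t i)) -> forall a, GRing.comm y (phi k t a).
Proof.
move=> yt a; have := comm_brV yt a; have := comm_qh yt; rewrite /phi; case: k => [hb|]
    // h hV.
apply: commrM => //.
by rewrite /GRing.comm -scalerAr -scalerAl h.
Qed.

Lemma qhD g h : qh k t (g + h) = qh k t g * qh k t h.
Proof.
move: t_unit; rewrite /qh; case: k => [hb|] tu; last by rewrite mulr1.
rewrite -prodrM_comm => [|i j _ _].
  by apply: eq_bigr => i _; rewrite mxE exprzDr //; exact: tu.
by apply: commrXz; apply/commr_sym/commrXz; exact: t_comm.
Qed.

Lemma qh0 : qh k t 0 = 1.
Proof. by rewrite /qh; case: k => // hb; apply: big1 => i _; rewrite mxE expr0z. Qed.

Lemma qhVN g : qh k t g * qh k t (- g) = 1.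
Proof. by rewrite -qhD subrr qh0. Qed.

Lemma qexpD g h c d : qexp (g + h) (c + d) = qexp g c * qexp h d.
Proof.
have := qhD g h; rewrite /qexp; case: k => [hb|] E; last by rewrite mulr1.
by rewrite E qpowD -scalerAr -scalerAl scalerA mulrC.
Qed.

Lemma qexp00 : qexp 0 0 = 1.
Proof. by have := qh0; rewrite /qexp; case: k => // hb ->; rewrite qpow0 scale1r. Qed.

Lemma qexp_simple g : qexp g 0 = qh k t g.
Proof. by rewrite /qexp /qh; case: k => // hb; rewrite qpow0 scale1r. Qed.

Lemma qexpNV g c : qexp (- g) (- c) * qexp g c = 1.
Proof. by rewrite -qexpD !addNr qexp00. Qed.

Lemma qexpVN g c : qexp g c * qexp (- g) (- c) = 1.
Proof. by rewrite -qexpD !subrr qexp00. Qed.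

Lemma br_quantum hb g c : k = quantum hb ->
  br k t (emb R g, c) =
  (qpow hb 1 - qpow hb (- 1))^-1 *: (qexp g c - qexp (- g) (- c)).
Proof. by rewrite /br /qexp => ->; rewrite /= embK. Qed.

Lemma br_classical g c : k = classical ->
  br k t (emb R g, c) = \sum_i (g 0 i)%:~R *: t i + c%:A.
Proof.
by rewrite /br => -> /=; congr (_ + _); apply: eq_bigr => i _; rewrite mxE.
Qed.

Lemma phiE g c : phi k t (emb R g, c) = qexp (- g) (- c) * (br k t (emb R g, c))^-1.
Proof. by rewrite /phi /qexp; case: k => [hb|] /=; rewrite ?mul1r // embK. Qed.

Lemma phi_invK g c : br k t (emb R g, c) \is a GRing.unit ->
  phi_inv g c * phi k t (emb R g, c) = 1.
Proof.
by move=> bu; rewrite phiE /phi_inv mulrA -(mulrA (br _ _ _)) qexpVN mulr1 mulrV.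
Qed.

Lemma phi_invVK g c : br k t (emb R g, c) \is a GRing.unit ->
  phi k t (emb R g, c) * phi_inv g c = 1.
Proof.
by move=> bu; rewrite phiE /phi_inv mulrA -(mulrA _ _^-1) mulVr // mulr1 qexpNV.
Qed.

Lemma phi_inv00 : phi_inv 0 0 = 0.
Proof.
rewrite /phi_inv; move E : k => [hb|].
  by rewrite -E (br_quantum _ _ E) !oppr0 subrr scaler0 mul0r.
rewrite -E (br_classical _ _ E) scale0r addr0 big1 ?mul0r // => i _.
by rewrite mxE scale0r.
Qed.

(** In the quantum case [phi_inv] is (q^(2z) - 1) / (q - q^-1), and the two terms in q^(2w) cancel;
    classically it is z, which is additive. *)
Lemma phi_invD g h c d :
  phi_inv (g + h) (c + d) = phi_inv g c * (qexp h d * qexp h d) + phi_inv h d.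
Proof.
rewrite /phi_inv; move E : k => [hb|]; rewrite -E.
  rewrite !(br_quantum _ _ E) -!scalerAl -scalerDr; congr (_ *: _).
  have cQ : qexp h d * qexp g c = qexp g c * qexp h d.
    by rewrite -(qexpD h g d c) addrC (addrC d) qexpD.
  have aux (U U' u u' v v' : M) : U' * U = 1 -> u' * u = 1 -> v' * v = 1 ->
      U = u * v -> v * u = u * v ->
      (U - U') * U = (u - u') * u * (v * v) + (v - v') * v.
    move=> UN uN vN UE vu; rewrite !mulrBl UN uN vN UE mul1r addrA subrK.
    by congr (_ - _); rewrite -!mulrA [v * (u * v)]mulrA vu !mulrA.
  exact: (aux _ _ _ _ _ _ (qexpNV _ _) (qexpNV _ _) (qexpNV _ _) (qexpD _ _ _ _) cQ).
have Q1 a b : qexp a b = 1 by rewrite /qexp E.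
rewrite !Q1 !mulr1 !(br_classical _ _ E) addrACA -scalerDl -big_split; congr (_ + _).
by apply: eq_bigr => i _; rewrite mxE intrD scalerDl.
Qed.

(* For J = 0 the relation [twist J x a b] says that a x = x b; the two-sided  *)
(* T-submodule J allows for congruences.                                      *)
Section Twist.
Variables (J T : set M) (x : M).
Hypotheses (hT : is_subalg T) (JD : forall u v, J u -> J v -> J (u + v)).
Hypotheses (JTl : forall a u, T a -> J u -> J (a * u)).
Hypotheses (JTr : forall a u, T a -> J u -> J (u * a)).
Hypothesis (Tt : cartan_gens k t `<=` T).

Definition twist (a b : M) : Prop := J (a * x - x * b).

Lemma twistD a b a' b' : twist a b -> twist a' b' -> twist (a + a') (b + b').
Proof. by move=> h h'; rewrite /twist mulrDl mulrDr opprD addrACA; exact: JD. Qed.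

Lemma JZ c u : J u -> J (c *: u).
Proof. by move=> Ju; rewrite -(mul1r u) scalerAl; apply: JTl => //; apply: subalgZ =>
    //; exact: subalg1. Qed.

Lemma twistZ c a b : twist a b -> twist (c *: a) (c *: b).
Proof. by move=> h; rewrite /twist -scalerAl -scalerAr -scalerBr; exact: JZ. Qed.

Lemma twistN a b : twist a b -> twist (- a) (- b).
Proof. by move=> h; rewrite -(scaleN1r a) -(scaleN1r b); exact: twistZ. Qed.

Lemma twistM a b a' b' : T a -> T b' -> twist a b -> twist a' b' ->
  twist (a * a') (b * b').
Proof.
move=> Ta Tb h h'; rewrite /twist.
have -> : a * a' * x - x * (b * b') = a * (a' * x - x * b') + (a * x - x * b) * b'.
  by rewrite mulrBr mulrBl !mulrA addrA subrK.
by apply: JD; [exact: JTl|exact: JTr].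
Qed.

(** Multiply a x - x b by a^-1 on the left and by b^-1 on the right. *)
Lemma twistV a b : a \is a GRing.unit -> b \is a GRing.unit -> T a^-1 -> T b^-1 ->
  twist a b -> twist a^-1 b^-1.
Proof.
move=> ua ub Ta Tb h; rewrite /twist.
have -> : a^-1 * x - x * b^-1 = (-1) *: (a^-1 * (a * x - x * b) * b^-1).
  by rewrite mulrBr mulrBl !mulrA mulVr // mul1r mulrK // scaleN1r opprB.
by apply: JZ; apply: JTr => //; apply: JTl.
Qed.

Lemma twist1 : J 0 -> twist 1 1.
Proof. by rewrite /twist mul1r mulr1 subrr. Qed.

Lemma twistXz a b (n : int) : J 0 -> a \is a GRing.unit -> b \is a GRing.unit ->
  T a -> T b -> T a^-1 -> T b^-1 -> twist a b -> twist (a ^ n) (b ^ n).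
Proof.
move=> J0.
have aux a' b' m : T a' -> T b' -> twist a' b' -> twist (a' ^+ m) (b' ^+ m).
  move=> Ta Tb h; elim: m => [|m IH]; first by rewrite !expr0; exact: twist1.
  by rewrite !exprS; apply: twistM => //; exact: subalgX.
move=> ua ub Ta Tb TVa TVb h; case: n => n; first exact: aux.
by rewrite NegzE -!exprnN -!exprVn; apply: aux => //; exact: twistV.
Qed.

Variable l : hdual.
Hypothesis xw : wt_upto D k t (fun a b => J (a - b)) l x.
Hypothesis J0 : J 0.

Lemma T_qh g : T (qh k t g).
Proof.
move: Tt; rewrite /qh /cartan_gens; case: k => [hb|] Tt'; last exact: subalg1.
apply: (subalg_prod hT) => i _; apply: (subalgXz hT).
  by apply: Tt'; left; exists i.
by apply: Tt'; right; exists i.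
Qed.

Lemma T_qexp g c : T (qexp g c).
Proof.
have := T_qh g; rewrite /qexp; case: k => [hb|] Tg; last exact: subalg1.
exact: subalgZ.
Qed.

Lemma T_br g c : T (br k t (emb R g, c)).
Proof.
move E : k => [hb|]; rewrite -E.
  by rewrite (br_quantum _ _ E); apply: subalgZ => //; apply: subalgB => //; exact: T_qexp.
rewrite (br_classical _ _ E); apply: subalgD => //.
  apply: subalg_sum => // i _; apply: subalgZ => //; apply: Tt.
  by rewrite E; exists i.
by apply: subalgZ => //; exact: subalg1.
Qed.

Lemma T_phi g c : T (br k t (emb R g, c))^-1 -> T (phi k t (emb R g, c)).
Proof. by move=> Tb; rewrite phiE; apply: subalgM => //; exact: T_qexp. Qed.

(** Each t_i crosses x at the cost of the scalar q^(alpha_i, l); expanding (g, l) along the simple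
    roots, these scalars multiply up to q^(g, l). *)
Lemma twist_qexp g c :
  twist (qexp g c) (qexp g (c + form D (emb R g) l)).
Proof.
move: xw t_unit Tt; rewrite /qexp /qh /cartan_gens; case: k => [hb|] xw' tu Tt'.
  rewrite qpowD -scalerA; apply: twistZ.
  have -> : qpow hb (form D (emb R g) l) *: (\prod_i t i ^ g 0 i) =
      \prod_i ((qpow hb (form D (emb R (simple i)) l) *: t i) ^ g 0 i).
    rewrite form_emb_expand.
    elim/big_rec3: _ => [|i y1 y2 y3 _ IH]; first by rewrite qpow0 scale1r.
    rewrite qpowD -IH qpow_intM -scalerA.
    set q := qpow _ _; have -> : (q *: t i) ^ g 0 i = (q ^ g 0 i) *: (t i ^ g 0 i).
      case: (g 0 i) => n; first by rewrite -exprnP exprZn.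
      by rewrite NegzE -!exprnN exprZn invrZ ?unitrX ?unitfE ?qpow_neq0 ?tu.
    by rewrite -scalerAl -scalerAr.
  (* The memberships in [T] accompany the induction because [twistM] multiplies elements of [J] by
     the partial products. *)
  have aux (s : seq 'I_r) :
    T (\prod_(i <- s) (t i ^ g 0 i)) /\
    twist (\prod_(i <- s) (t i ^ g 0 i))
     (\prod_(i <- s) ((qpow hb (form D (emb R (simple i)) l) *: t i) ^ g 0 i)) /\
    T (\prod_(i <- s) ((qpow hb (form D (emb R (simple i)) l) *: t i) ^ g 0 i)).
    elim: s => [|i s [IH1 [IH2 IH3]]].
      by rewrite !big_nil; split; [exact: subalg1|split; [exact: twist1|exact: subalg1]].
    set q := qpow hb (form D (emb R (simple i)) l).
    have Ti : T (t i) by apply: Tt'; left; exists i.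
    have TVi : T (t i)^-1 by apply: Tt'; right; exists i.
    have uqt : q *: t i \is a GRing.unit.
      by rewrite scaler_unit // unitfE qpow_neq0.
    have Tqt : T (q *: t i) by exact: subalgZ.
    have TVqt : T (q *: t i)^-1.
      by rewrite invrZ // ?unitfE ?qpow_neq0 //; exact: subalgZ.
    have X1 : T (t i ^ g 0 i) by exact: subalgXz.
    have X2 : T ((q *: t i) ^ g 0 i) by exact: subalgXz.
    rewrite !big_cons; split; first exact: subalgM.
    split; last exact: subalgM.
    apply: twistM => //; apply: twistXz => //.
    have := JTr Ti (xw' i); rewrite /twist mulrBl -!mulrA mulVr // mulr1.
    by rewrite -scalerAl -scalerAr.
  by have [_ []] := aux (index_enum _).
exact: twist1.
Qed.

Lemma twist_br g c :
  twist (br k t (emb R g, c)) (br k t (emb R g, c + form D (emb R g) l)).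
Proof.
move E : k => [hb|]; rewrite -E.
  rewrite !(br_quantum _ _ E); apply: twistZ; apply: twistD; first exact: twist_qexp.
  by apply: twistN; have := twist_qexp (- g) (- c); rewrite embN formNl -opprD.
rewrite !(br_classical _ _ E).
(* Classically the shift (g, l) is distributed over the generators, each t_i taking its share
   (alpha_i, l). *)
have -> : \sum_i (g 0 i)%:~R *: t i + (c + form D (emb R g) l)%:A =
    \sum_i (g 0 i)%:~R *: (t i + (form D (emb R (simple i)) l)%:A) + c%:A.
  rewrite form_emb_expand scalerDl [c%:A + _]addrC addrA scaler_suml -big_split /=.
  by congr (_ + _); apply: eq_bigr => i _; rewrite scalerDr scalerA.
apply: twistD; last by apply: twistZ; exact: twist1.
elim/big_rec2: _ => [|i u v _ IH].
  by rewrite /twist mul0r mulr0 subrr.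
apply: twistD => //; apply: twistZ.
have := xw; rewrite E => /(_ i) /=.
by rewrite /twist mulrDr opprD addrA -scalerAr mulr1.
Qed.

Lemma twist_phi_inv g c :
  twist (phi_inv g c) (phi_inv g (c + form D (emb R g) l)).
Proof.
by apply: twistM; [exact: T_br|exact: T_qexp|exact: twist_br|exact: twist_qexp].
Qed.

Lemma twist_phi g c :
  let c' := c + form D (emb R g) l in
  br k t (emb R g, c) \is a GRing.unit -> br k t (emb R g, c') \is a GRing.unit ->
  T (br k t (emb R g, c))^-1 -> T (br k t (emb R g, c'))^-1 ->
  twist (phi k t (emb R g, c)) (phi k t (emb R g, c')).
Proof.
move=> c' u u' Tu Tu'; rewrite !phiE; apply: twistM => //; first exact: T_qexp.
  by have := twist_qexp (- g) (- c); rewrite embN formNl -opprD.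
by apply: twistV => //; exact: twist_br.
Qed.

End Twist.

Section WeightVectors.
Implicit Types (l : hdual) (x y : M).

Lemma has_weight_upto l x : has_weight D k t l x ->
  wt_upto D k t (fun a b => [set (0 : M)] (a - b)) l x.
Proof.
rewrite /has_weight /wt_upto; case: k => [hb|] h i; have -> := h i; exact: subrr.
Qed.

Lemma twist0P x a b : twist [set 0] x a b <-> a * x = x * b.
Proof. by split => [/subr0_eq|h] //; rewrite /twist /= h subrr. Qed.

(** The instance J = 0 and T = M, in which [twist] is an honest equation. *)
Let T1 : is_subalg [set: M]. Proof. by []. Qed.
Let Z1 (u v : M) : [set 0] u -> [set 0] v -> [set (0 : M)] (u + v).
Proof. by move=> /= -> ->; rewrite addr0. Qed.
Let Z2 (a u : M) : [set: M] a -> [set 0] u -> [set (0 : M)] (a * u).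
Proof. by move=> _ /= ->; rewrite mulr0. Qed.
Let Z3 (a u : M) : [set: M] a -> [set 0] u -> [set (0 : M)] (u * a).
Proof. by move=> _ /= ->; rewrite mul0r. Qed.

Lemma qexp_wt l x g c : has_weight D k t l x ->
  qexp g c * x = x * qexp g (c + form D (emb R g) l).
Proof. by move=> /has_weight_upto h; apply/twist0P; exact: (twist_qexp T1 Z1 Z2 Z3
    (@subsetT _ _) h erefl). Qed.

Lemma phi_inv_wt l x g c : has_weight D k t l x ->
  phi_inv g c * x = x * phi_inv g (c + form D (emb R g) l).
Proof. by move=> /has_weight_upto h; apply/twist0P; exact: (twist_phi_inv T1 Z1 Z2 Z3
    (@subsetT _ _) h erefl). Qed.

Lemma br_wt l x g c : has_weight D k t l x ->
  br k t (emb R g, c) * x = x * br k t (emb R g, c + form D (emb R g) l).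
Proof. by move=> /has_weight_upto h; apply/twist0P; exact: (twist_br T1 Z1 Z2 Z3
    (@subsetT _ _) h erefl). Qed.

Lemma phi_wt l x g c : has_weight D k t l x ->
  br k t (emb R g, c) \is a GRing.unit ->
  br k t (emb R g, c + form D (emb R g) l) \is a GRing.unit ->
  phi k t (emb R g, c) * x = x * phi k t (emb R g, c + form D (emb R g) l).
Proof.
move=> /has_weight_upto h u u'; apply/twist0P.
by apply: (twist_phi T1 Z1 Z2 Z3 (@subsetT _ _) h erefl).
Qed.

Lemma has_weight0 x : (forall i, GRing.comm x (t i)) -> has_weight D k t 0 x.
Proof.
move: t_unit; rewrite /has_weight /wt_upto; case: k => [hb|] tu xt i; rewrite form0r.
  by rewrite -xt (mulrK (tu i)) qpow0 scale1r.
by rewrite xt subrr scale0r.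
Qed.

Lemma has_weight00 l : has_weight D k t l 0.
Proof.
by rewrite /has_weight /wt_upto; case: k => [hb|] i; rewrite mulr0 mul0r ?subr0 scaler0.
Qed.

Lemma has_weightD l x y : has_weight D k t l x -> has_weight D k t l y ->
  has_weight D k t l (x + y).
Proof.
rewrite /has_weight /wt_upto; case: k => [hb|] hx hy i.
  by rewrite mulrDr mulrDl hx hy scalerDr.
by rewrite mulrDr mulrDl opprD addrACA hx hy scalerDr.
Qed.

Lemma has_weightZ c l x : has_weight D k t l x -> has_weight D k t l (c *: x).
Proof.
rewrite /has_weight /wt_upto; case: k => [hb|] hx i.
  by rewrite -scalerAr -scalerAl hx scalerA mulrC -scalerA.
by rewrite -scalerAr -scalerAl -scalerBr hx scalerA mulrC -scalerA.
Qed.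

Lemma has_weight_sum (I : eqType) (s : seq I) (G : I -> M) l :
  (forall i, i \in s -> has_weight D k t l (G i)) ->
  has_weight D k t l (\sum_(i <- s) G i).
Proof.
move=> h; rewrite big_seq; elim/big_ind: _ => //; first exact: has_weight00.
by move=> x y; exact: has_weightD.
Qed.

Lemma has_weightM l l' x y : has_weight D k t l x -> has_weight D k t l' y ->
  has_weight D k t (l + l') (x * y).
Proof.
move: t_unit; rewrite /has_weight /wt_upto; case: k => [hb|] tu hx hy i.
  have -> : t i * (x * y) * (t i)^-1 = (t i * x * (t i)^-1) * (t i * y * (t i)^-1).
    by rewrite !mulrA (mulrVK (tu i)).
  by rewrite hx hy formDr qpowD -scalerAl -scalerAr scalerA.
have -> : t i * (x * y) - x * y * t i = (t i * x - x * t i) * y + x * (t i * y - y * t i).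
  by rewrite mulrBl mulrBr !mulrA addrA subrK.
by rewrite hx hy formDr scalerDl -scalerAl -scalerAr.
Qed.

Lemma has_weight_quantum hb l x i : k = quantum hb -> has_weight D k t l x ->
  t i * x = qpow hb (form D (emb R (simple i)) l) *: (x * t i).
Proof.
move=> kE; move: t_unit; rewrite /has_weight /wt_upto kE => tu /(_ i) E.
by rewrite scalerAl -E (mulrVK (tu i)).
Qed.

Lemma has_weight_classical l x i : k = classical -> has_weight D k t l x ->
  t i * x = form D (emb R (simple i)) l *: x + x * t i.
Proof. by move=> kE; rewrite /has_weight /wt_upto kE => /(_ i) <-; rewrite subrK. Qed.

End WeightVectors.

End CartanCommutation.

(** [s] and [P] may differ wherever [G] vanishes, so that one fixed list can serve for many finitely
    supported sums. *)
Lemma fsum_seq (V : nmodType) (I : choiceType) (s : seq I) (P : set I) (G : I -> V) :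
  uniq s -> (forall i, P i -> G i != 0 -> i \in s) ->
  (forall i, i \in s -> ~ P i -> G i = 0) ->
  \sum_(i \in P) G i = \sum_(i <- s) G i.
Proof.
move=> us Ps sP; rewrite [RHS]fsbig_seq // [LHS]fsbig_supp [RHS]fsbig_supp.
apply: eq_fsbigl; apply/seteqP; split => i [ih Gi]; split => //.
  by apply: Ps => //; apply/eqP.
by apply: contrapT => nP; apply: Gi; exact: sP.
Qed.

Lemma eq_sum_supp (V : nmodType) (I : choiceType) (s s' : seq I) (G : I -> V) :
  uniq s -> uniq s' -> (forall i, G i != 0 -> i \in s) ->
  (forall i, G i != 0 -> i \in s') -> \sum_(i <- s) G i = \sum_(i <- s') G i.
Proof.
move=> us us' h h'; transitivity (\sum_(i \in [set: I]) G i).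
  by apply/esym/fsum_seq => // [i _ /h//|i _ []].
by apply: fsum_seq => // [i _ /h'//|i _ []].
Qed.

(** * Heights in the positive cone *)

Section LatticeHeight.
Set Implicit Arguments.
Unset Strict Implicit.
Variable r : nat.
Implicit Types g h : 'rV[int]_r.

Lemma heightD g h : in_GammaP g -> in_GammaP h ->
  height (g + h) = (height g + height h)%N.
Proof.
move=> /forallP gP /forallP hP; rewrite /height -big_split; apply: eq_bigr => i _.
have := gP i; have := hP i; rewrite mxE; by case: (g 0 i) => // a; case: (h 0 i).
Qed.

Lemma height_gt0 g : g != 0 -> (0 < height g)%N.
Proof.
apply: contraR; rewrite -leqNgt leqn0 /height sum_nat_eq0 => /forallP h.
by apply/eqP/rowP => i; rewrite mxE; apply/eqP; rewrite -absz_eq0; exact: h.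
Qed.

(** Here 0 <= h_i <= g_i <= height g for every i: the box misses no way of splitting [g] into two
    weights of Gamma_+. *)
Lemma mem_box g h : in_GammaP h -> in_GammaP (g - h) -> h \in box g.
Proof.
move=> /forallP hP /forallP ghP.
have hle i : (`|h 0%R i| < (height g).+1)%N.
  rewrite ltnS /height (bigD1 i) //=; apply: leq_trans (leq_addr _ _).
  have := hP i; have := ghP i; rewrite !mxE; case: (h 0 i) => // a.
  by case: (g 0 i) => [b|b]; rewrite ?subr_ge0 ?lez_nat.
apply/mapP; exists [ffun i => Ordinal (hle i)]; rewrite ?mem_enum //; apply/rowP => i;
    rewrite !mxE ffunE /=.
by have := hP i; case: (h 0 i).
Qed.

Lemma box_uniq g : uniq (box g).
Proof.
rewrite /box /image_mem map_inj_uniq ?enum_uniq // => u v /rowP uv; apply/ffunP => i.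
by have := uv i; rewrite !mxE => -[] /val_inj.
Qed.

End LatticeHeight.

(** * Matrix entries on graded modules *)

Section GradedModules.
Set Implicit Arguments.
Unset Strict Implicit.
Variables (R : realType) (r : nat) (D : rootDatum r) (k : flavour R).
Variables (M : unitAlgType (complex R)) (e f t : 'I_r -> M).
Local Notation C := (complex R).
Local Notation Gam := 'rV[int]_r.
Hypotheses (hD : is_root_system D) (hk : flavour_ok k).
Hypothesis hE : enveloping_relations D k e f t.
Variable X : gradedModule D k e t.
Local Notation I := (gidx X).
Local Notation wd l j := (lat (nu l - nu j) : Gam).
Implicit Types (i j l : I) (g : Gam).

Lemma e_Upos a : Upos e (e a).
Proof. by apply: sub_alg_gen; exists a. Qed.

Lemma Upos_Bpos x : Upos e x -> Bpos k e t x.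
Proof. by move=> xU; apply: sub_alg_gen; left. Qed.

Lemma t_Bpos a : Bpos k e t (t a).
Proof.
apply: sub_alg_gen; right; apply: sub_alg_gen; rewrite /cartan_gens.
by case: k => [hb|]; [left|]; exists a.
Qed.

Lemma emb_wd l j : emb R (wd l j) = nu l - nu j.
Proof. by have [g ->] := nu_diff l j; rewrite embK. Qed.

Lemma wd_add l j i : wd i l + wd l j = wd i j.
Proof. by apply: (@emb_inj R); rewrite embD !emb_wd addrA subrK. Qed.

Lemma wdxx i : wd i i = 0.
Proof. by apply: (@emb_inj R); rewrite emb_wd subrr emb0. Qed.

Lemma coord0 i : coord i (0 : X) = 0.
Proof. by have := coord_lin i (-1) (0 : X) 0; rewrite scaleN1r addNr mulN1r addNr. Qed.

Lemma coordD i (v w : X) : coord i (v + w) = coord i v + coord i w.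
Proof. by have := coord_lin i 1 v w; rewrite scale1r mul1r. Qed.

Lemma coordZ i c (v : X) : coord i (c *: v) = c * coord i v.
Proof. by have := coord_lin i c v 0; rewrite coord0 !addr0. Qed.

Lemma coord_sums i (J : Type) (s : seq J) (G : J -> X) :
  coord i (\sum_(j <- s) G j) = \sum_(j <- s) coord i (G j).
Proof. by elim/big_rec2: _ => [|j u v _ <-]; rewrite ?coord0 ?coordD. Qed.

Lemma act0r a : Bpos k e t a -> act a (0 : X) = 0.
Proof. by move=> ha; have := act_linr (-1) (0 : X) 0 ha; rewrite !scaleN1r !addNr. Qed.

Lemma actDr a (v w : X) : Bpos k e t a -> act a (v + w) = act a v + act a w.
Proof. by move=> ha; have := act_linr 1 v w ha; rewrite !scale1r. Qed.

Lemma actZr a c (v : X) : Bpos k e t a -> act a (c *: v) = c *: act a v.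
Proof. by move=> ha; have := act_linr c v 0 ha; rewrite act0r // !addr0. Qed.

Lemma act_sumr a (J : Type) (s : seq J) (G : J -> X) : Bpos k e t a ->
  act a (\sum_(j <- s) G j) = \sum_(j <- s) act a (G j).
Proof. by move=> ha; elim/big_rec2: _ => [|j u v _ <-]; rewrite ?act0r ?actDr. Qed.

Lemma coord_expand (v : X) : exists s : seq I,
  [/\ uniq s, forall i, coord i v != 0 -> i \in s
    & v = \sum_(i <- s) coord i v *: xb i].
Proof.
have /finite_seqP[s sE] := coord_fin v.
have mem i : coord i v != 0 -> i \in undup s.
  by move=> h; rewrite mem_undup; have : [set i | coord i v != 0] i by []; rewrite sE.
exists (undup s); split => //; first exact: undup_uniq.
rewrite {1}[LHS]coord_sum; apply: fsum_seq => [|i _ h|i _ []] //; first exact: undup_uniq.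
by apply: mem; apply: contraNneq h => ->; rewrite scale0r.
Qed.

Lemma pim_lin c a b i j : Bpos k e t a -> Bpos k e t b ->
  pim (c *: a + b) i j = c * pim a i j + pim b i j.
Proof. by move=> ha hb; rewrite /pim act_linl // coord_lin. Qed.

Lemma pim1 i j : pim (X := X) 1 i j = (i == j)%:R.
Proof. by rewrite /pim act1 coord_xb. Qed.

Lemma pim0 i j : pim (X := X) 0 i j = 0.
Proof.
have B0 : Bpos k e t 0 by apply: subalg0; exact: subalg_smallest.
by have := pim_lin (-1) i j B0 B0; rewrite scaleN1r addNr mulN1r addNr.
Qed.

Lemma pimZ c a i j : Bpos k e t a -> pim (X := X) (c *: a) i j = c * pim a i j.
Proof.
move=> ha; have B0 : Bpos k e t 0 by apply: subalg0; exact: subalg_smallest.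
by have := pim_lin c i j ha B0; rewrite pim0 !addr0.
Qed.

Lemma pimB a b i j : Bpos k e t a -> Bpos k e t b ->
  pim (X := X) (a - b) i j = pim a i j - pim b i j.
Proof.
by move=> ha hb; have := pim_lin (-1) i j hb ha; rewrite scaleN1r mulN1r addrC (addrC _
    (pim _ _ _)).
Qed.

Lemma pim_sum (J : eqType) (s : seq J) (c : J -> C) (G : J -> M) i j :
  (forall x, x \in s -> Bpos k e t (G x)) ->
  pim (X := X) (\sum_(x <- s) c x *: G x) i j = \sum_(x <- s) c x * pim (G x) i j.
Proof.
elim: s => [|x s IH] hs; first by rewrite !big_nil pim0.
have hB : is_subalg (Bpos k e t) by exact: subalg_smallest.
rewrite !big_cons pim_lin ?IH //.
- by move=> y ys; apply: hs; rewrite inE ys orbT.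
- by apply: hs; rewrite inE eqxx.
- by apply: (subalg_sum hB) => y ys; apply: (subalgZ hB); apply: hs; rewrite inE ys orbT.
Qed.

(** The vector [act b (xb j)] has finite support, so the matrix product is a finite sum even for
    infinite index sets. *)
Lemma pimM s a b i j : Bpos k e t a -> Bpos k e t b -> uniq s ->
  (forall l, pim a i l != 0 -> pim b l j != 0 -> l \in s) ->
  pim (X := X) (a * b) i j = \sum_(l <- s) pim a i l * pim b l j.
Proof.
move=> ha hb us hs; have [s' [us' hs' vE]] := coord_expand (act b (xb j)).
rewrite /pim in hs *; rewrite actM //; move: (act b (xb j)) vE hs hs' => v vE hs hs'.
rewrite {1}vE act_sumr // coord_sums.
under eq_bigr do rewrite actZr // coordZ mulrC.
apply: eq_sum_supp => // l.
  by move=> h; apply: hs'; apply: contraNneq h => E; rewrite E mulr0 eqxx.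
by rewrite mulf_eq0 negb_or => /andP[h1 h2]; exact: hs.
Qed.

(* The eigenvalue of t_i on vectors of weight l, for c = (alpha_i, l).         *)
Definition tchar (c : C) : C :=
  match k with quantum hb => qpow hb c | classical => c end.

Lemma tcharE (V : lmodType C) c (v : V) :
  match k with quantum hb => qpow hb c *: v | classical => c *: v end = tchar c *: v.
Proof. by rewrite /tchar; case: k. Qed.

Lemma tchar_quantum hb c : k = quantum hb -> tchar c = qpow hb c.
Proof. by rewrite /tchar => ->. Qed.

Lemma tchar_classical c : k = classical -> tchar c = c.
Proof. by rewrite /tchar => ->. Qed.

Lemma coord_act_t a l (v : X) :
  coord l (act (t a) v) = tchar (form D (emb R (simple a)) (nu l)) * coord l v.
Proof.
have [s [us hs vE]] := coord_expand v.
rewrite {1}vE act_sumr; last exact: t_Bpos.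
rewrite {2}vE !coord_sums mulr_sumr; apply: eq_bigr => j _.
rewrite actZr; last exact: t_Bpos.
rewrite act_wt /= tcharE !coordZ coord_xb.
by have [->|] := eqVneq l j; rewrite ?mulr0 // !mulr1 mulrC.
Qed.

(** Comparing the eigenvalues of [t a * x] and [x * t a] shows that nu l - nu j - g pairs to 0 with
    every simple root, and the form is nondegenerate. *)
Lemma pim_wt x g l j : Bpos k e t x -> has_weight D k t (emb R g) x ->
  pim (X := X) x l j != 0 -> nu l - nu j = emb R g.
Proof.
move=> xB xw xn0.
suff h a : form D (emb R (simple a)) (emb R (wd l j - g)) = 0.
  by have /eqP := form_nondeg hD h; rewrite subr_eq0 => /eqP <-; rewrite emb_wd.
have tB := t_Bpos a.
have hB : is_subalg (Bpos k e t) by exact: subalg_smallest.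
have tl : pim (X := X) (t a * x) l j = tchar (form D (emb R (simple a)) (nu l)) * pim x l j.
  by rewrite {1}/pim actM // coord_act_t.
have tj : pim (X := X) (x * t a) l j = tchar (form D (emb R (simple a)) (nu j)) * pim x l j.
  by rewrite {1}/pim actM // act_wt /= tcharE actZr // coordZ.
rewrite form_simple_emb; apply/eqP; rewrite fmorph_eq0; apply/eqP.
(* The pairing is rational since nu l - nu j lies in the lattice; [qpow_rat_eq1] depends on it. *)
set c := \sum_(_ < _) _; have cE : ratr c =
  form D (emb R (simple a)) (nu l) - (form D (emb R (simple a)) (emb R g) + form D (emb
      R (simple a)) (nu j)) :> C.
  by rewrite /c -form_simple_emb embB emb_wd !formDr !formNr; ring.
(* The flavour is split through an equation, because the type of [X] depends on [k]. *)
have : forall k0, k = k0 -> c = 0; last by apply.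
case=> [hb|] kE.
  have hk' : flavour_ok (quantum hb) by rewrite -kE.
  apply: (qpow_rat_eq1 hk'); rewrite cE qpowD qpowN qpowD.
  have := congr1 (fun y => pim (X := X) y l j) (has_weight_quantum (Defs.rel_unit hE) a
      kE xw).
  rewrite /= pimZ ?tl ?tj; last exact: (subalgM hB xB tB).
  rewrite !(tchar_quantum _ kE) mulrA => /(mulIf xn0) ->.
  by rewrite mulfV // mulf_neq0 ?qpow_neq0.
suff : ratr c = 0 :> C by move=> /eqP; rewrite fmorph_eq0 => /eqP.
rewrite cE; apply/eqP; rewrite subr_eq0; apply/eqP.
have := congr1 (fun y => pim (X := X) y l j) (has_weight_classical a kE xw).
rewrite /= pim_lin ?tl ?tj //; last exact: (subalgM hB xB tB).
by rewrite !(tchar_classical _ kE) -mulrDl => /(mulIf xn0).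
Qed.

Lemma succ_trans i j l : succ i j -> succ j l -> succ i l.
Proof. by move=> ij jl; exact: (Relation_Operators.t_trans _ _ _ _ _ jl ij). Qed.

Lemma pim_e_succ a i j : pim (X := X) (e a) i j != 0 -> succ i j.
Proof. by move=> h; apply: Relation_Operators.t_step; exists a. Qed.

Lemma pim_succ x i j : Upos e x -> pim (X := X) x i j != 0 -> i = j \/ succ i j.
Proof.
(* Membership in U^+ is part of [Q] because [pim] is linear and multiplicative on B^+ only. *)
pose Q := [set x | Upos e x /\ forall i j, pim (X := X) x i j != 0 -> i = j \/ succ i j].
have hU : is_subalg (Upos e) by exact: subalg_smallest.
move=> xU; suff [_ h] : Q x by exact: h.
move: x xU; apply: alg_gen_min; last first.
  by move=> _ [a _ <-]; split=> [|i' j' /pim_e_succ]; [exact: e_Upos|right].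
split.
- split; first exact: (subalg1 hU).
  by move=> i' j'; rewrite pim1; case: (eqVneq i' j') => [-> _|_]; [left|rewrite eqxx].
- move=> c x y [xU hx] [yU hy]; split; first by apply: (subalgD hU) => //; exact:
    (subalgZ hU).
  move=> i' j'; rewrite pim_lin; try exact: Upos_Bpos.
  have [->|xn0 _] := eqVneq (pim x i' j') 0; first by rewrite mulr0 add0r; exact: hy.
  exact: hx.
- move=> x y [xU hx] [yU hy]; split; first exact: (subalgM hU).
  move=> i' j'; have [s' [us' hs' _]] := coord_expand (act y (xb j' : X)).
  rewrite (@pimM s'); try exact: Upos_Bpos.
  + move=> /eqP sn0; apply: contrapT => nij; apply: sn0; apply: big1 => l _.
    apply/eqP; apply/negP => /negP; rewrite mulf_eq0 negb_or => /andP[/hx h1 /hy h2].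
    apply: nij; case: h1 => [->|h1] //; case: h2 => [<-|h2]; first by right.
    by right; exact: succ_trans h1 h2.
  + exact: us'.
  + by move=> l _; exact: hs'.
Qed.

Lemma e_wt a : has_weight D k t (emb R (simple a)) (e a).
Proof. exact: (rel_te hE). Qed.

(** Each arrow adds a simple root, and heights add up on Gamma_+, so a path cannot return to its
    start. *)
Lemma succ_wd i j : succ i j -> in_GammaP (wd i j) /\ wd i j != 0.
Proof.
elim=> [{}j {}i [a h]|{}j l {}i _ [g1 n1] _ [g2 n2]].
  rewrite (pim_wt (Upos_Bpos (e_Upos a)) (e_wt a) h) embK; split; first exact:
      in_GammaP_simple.
  by apply/negP => /eqP/rowP/(_ a); rewrite !mxE !eqxx.
rewrite -(wd_add l); split; first exact: in_GammaPD.
by apply: contraTneq (height_gt0 n1) => E; rewrite -leqNgt -(leq_add2l (height (wd i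
    l))) -heightD // E
  /height big1 // => a _; rewrite mxE.
Qed.

Lemma succ_irr i : ~ succ i i.
Proof. by move=> /succ_wd[_]; rewrite wdxx eqxx. Qed.

(** The two properties that let [entry] respect products: the weight of the first leg determines
    which component can contribute, and positivity keeps all contributing weights inside [box]. *)
Definition raising (T : ctens r M) := forall g p, p \in T g ->
  [/\ in_GammaP g, Upos e p.1 & has_weight D k t (emb R g) p.1].

Lemma entry_supp (T : ctens r M) i j : entry (X := X) T i j != 0 ->
  exists2 p, p \in T (wd i j) & pim p.1 i j != 0.
Proof.
move=> /eqP n0; apply: contrapT => nex; apply: n0; rewrite /entry big_seq big1 // => p pT.
have [->|h] := eqVneq (pim p.1 i j) 0; first by rewrite scale0r.
by case: nex; exists p.
Qed.

Lemma entry_wt (T : ctens r M) i j :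
  (forall g p, p \in T g -> has_weight D k t (- emb R g) p.2) ->
  has_weight D k t (nu j - nu i) (entry (X := X) T i j).
Proof.
move=> h; apply: has_weight_sum => p pT; apply: has_weightZ.
by rewrite -opprB -emb_wd; exact: h pT.
Qed.

(** For a fixed intermediate index l only the component of T of weight nu l - nu j has a nonzero (l,
    j) entry, so the double sum over weights and indices collapses to one over indices. *)
Lemma entry_mul (S T : ctens r M) s i j : raising S -> raising T -> uniq s ->
  i \in s -> (forall l, succ i l -> l \in s) ->
  entry (X := X) (ctens_mul S T) i j = \sum_(l <- s) entry S i l * entry T l j.
Proof.
move=> hS hT us is_ hs; rewrite {1}/entry /ctens_mul big_flatten big_map.
set g := wd i j.
pose G c l := (\sum_(a <- S (g - c)) pim a.1 i l *: a.2) * (\sum_(b <- T c) pim b.1 l j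
    *: b.2).
transitivity (\sum_(c <- box g) \sum_(l <- s) G c l).
  apply: eq_bigr => c _; rewrite /tens_mul big_allpairs_dep /=.
  under [RHS]eq_bigr do rewrite /G mulr_suml.
  rewrite [RHS]exchange_big /=; apply: eq_big_seq => a aS.
  under [RHS]eq_bigr do rewrite mulr_sumr.
  rewrite [RHS]exchange_big /=; apply: eq_big_seq => b bT.
  have [_ aU _] := hS _ _ aS; have [_ bU _] := hT _ _ bT.
  rewrite (@pimM s) //; try exact: Upos_Bpos.
    by rewrite scaler_suml; apply: eq_bigr => l _; rewrite -scalerAl -scalerAr scalerA.
  by move=> l /(pim_succ aU)[<- //|il] _; exact: hs.
rewrite exchange_big /=; apply: eq_bigr => l _.
have G0 c : c != wd l j -> G c l = 0.
  move=> cn; rewrite /G [X in _ * X]big_seq [X in _ * X]big1 ?mulr0 // => b bT.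
  have [_ bU bw] := hT _ _ bT.
  have [->|h] := eqVneq (pim b.1 l j) 0; first by rewrite scale0r.
  by rewrite (pim_wt (Upos_Bpos bU) bw h) embK eqxx in cn.
have GE : G (wd l j) l = entry S i l * entry T l j.
  by rewrite /G /g -(wd_add l) addrK.
have [cb|cb] := boolP (wd l j \in box g).
  by rewrite (bigD1_seq (wd l j)) ?box_uniq //= GE big1 ?addr0 // => c; exact: G0.
(* If that weight lies outside the box, one of the two entries is 0: otherwise both weights would be
   in Gamma_+ and [mem_box] would apply. *)
rewrite big_seq big1 => [|c cg]; last by apply: G0; apply: contraNneq cb => <-.
apply/esym/eqP; apply: contraNT cb => n0.
have /entry_supp[a aS _] : entry S i l != 0 by apply: contraNneq n0 => ->; rewrite mul0r.
have /entry_supp[b bT _] : entry T l j != 0 by apply: contraNneq n0 => ->; rewrite mulr0.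
have [h1 _ _] := hS _ _ aS; have [h2 _ _] := hT _ _ bT.
by apply: mem_box => //; rewrite /g -(wd_add l) addrK.
Qed.

End GradedModules.

(** * The commutation relation of F with the raising generators *)

Section FTensor.
Set Implicit Arguments.
Unset Strict Implicit.
Variables (R : realType) (r : nat) (D : rootDatum r) (k : flavour R).
Variables (M : unitAlgType (complex R)) (e f t : 'I_r -> M).
Local Notation C := (complex R).
Local Notation Gam := 'rV[int]_r.
Hypotheses (hD : is_root_system D) (hk : flavour_ok k).
Hypothesis hE : enveloping_relations D k e f t.
Variable X : gradedModule D k e t.
Local Notation I := (gidx X).
Local Notation wd l j := (lat (nu l - nu j) : Gam).
Local Notation U := (Uall k e f t).
Implicit Types (i j l : I) (g : Gam).

(* The matrix form of e (x) [h] = (1 (x) e + e (x) q^-h) F - F (1 (x) e + e (x) q^h). *)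
Definition F_commutes (F : ctens r M) (a : 'I_r) (s : seq I) l j :=
  pim (e a) l j *: br k t (emb R (simple a), 0) =
    e a * entry F l j
    + \sum_(n <- s) pim (e a) l n *: (qh k t (- simple a) * entry F n j)
    - entry F l j * e a
    - \sum_(n <- s) entry F l n * (pim (e a) n j *: qh k t (simple a)).

(** The test map is L x *: y. As [bilinear_on U U] asks for linearity on all of U while [pim] is
    linear on B^+ only, L is an extension of the matrix entry to M. *)
Lemma tens_eq_pim (u v : tens M) l j : tens_eq U U u v ->
  (forall p, p \in u -> Upos e p.1) -> (forall p, p \in v -> Upos e p.1) ->
  \sum_(p <- u) pim p.1 l j *: p.2 = \sum_(p <- v) pim p.1 l j *: p.2.
Proof.
move=> uv hu hv; have hB : is_subalg (Bpos k e t) by exact: subalg_smallest.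
have [L [Llin LE]] := @linear_extension _ M (Bpos k e t) (fun x => pim (X := X) x l j)
  (subalg0 hB) (fun a x y hx hy => subalgD hB (subalgZ hB a hx) hy)
  (fun a x y => @pim_lin _ _ _ _ _ _ _ X a x y l j).
have := uv M (fun x y => L x *: y).
have bil : bilinear_on U U (fun x y => L x *: y).
  split=> [a x x' y _ _ _|a x y y' _ _ _]; first by rewrite Llin scalerDl scalerA.
  by rewrite scalerDr !scalerA mulrC.
move=> /(_ bil) E.
rewrite (eq_big_seq (fun p => L p.1 *: p.2)) => [|p pu]; last first.
  by rewrite LE //; apply: Upos_Bpos; exact: hu.
rewrite [RHS](eq_big_seq (fun p => L p.1 *: p.2)) => [|p pu]; last first.
  by rewrite LE //; apply: Upos_Bpos; exact: hv.
exact: E.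
Qed.

Lemma sum_tens_mulr (u : tens M) q (G : M * M -> M) :
  \sum_(p <- tens_mul u [:: q]) G p = \sum_(p <- u) G (p.1 * q.1, p.2 * q.2).
Proof. by rewrite /tens_mul big_allpairs_dep; apply: eq_bigr => p _; rewrite big_seq1. Qed.

Lemma sum_tens_mull (u : tens M) q (G : M * M -> M) :
  \sum_(p <- tens_mul [:: q] u) G p = \sum_(p <- u) G (q.1 * p.1, q.2 * p.2).
Proof. by rewrite /tens_mul big_allpairs_dep big_seq1. Qed.

(** * The quantum case: F from the reduced R-matrix *)

Section Quantum.
Variables (hb : C) (Rc : ctens r M).
Hypotheses (kE : k = quantum hb) (hR : is_reduced_Rmatrix D k e f t Rc).
Let kap := (qpow hb 1 - qpow hb (- 1))^-1.
Let F := F_of_Rmatrix hb Rc.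

Lemma Rmatrix_raising : raising D k e t Rc.
Proof.
move=> g p pR; have [[pU pw] _] := Rc_wt hR pR; split => //.
by apply: contraLR pR => /(Rc_supp hR) ->.
Qed.

Lemma Rmatrix_F_raising : raising D k e t F.
Proof.
have hU : is_subalg (Upos e) by exact: subalg_smallest.
move=> g p /mapP[q]; rewrite mem_cat => /orP[qR|].
  have [gP qU qw] := Rmatrix_raising qR.
  by move=> -> /=; split => //; [exact: (subalgZ hU)|exact: has_weightZ].
case: eqVneq => [->|//]; rewrite inE => /eqP -> -> /=; split.
- by apply/forallP => i; rewrite mxE.
- by apply: (subalgZ hU); apply: (subalgN hU); exact: (subalg1 hU).
- rewrite emb0; apply: has_weightZ; apply: has_weight0 (Defs.rel_unit hE) _ _ => i.
  exact/commr_sym/commrN1.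
Qed.

Lemma Rmatrix_F_lowering g p : p \in F g ->
  Uneg f p.2 /\ has_weight D k t (- emb R g) p.2.
Proof.
have hU : is_subalg (Uneg f) by exact: subalg_smallest.
move=> /mapP[q]; rewrite mem_cat => /orP[qR|].
  by have [_ [qU qw]] := Rc_wt hR qR; move=> -> /=; split.
case: eqVneq => [->|//]; rewrite inE => /eqP -> -> /=; split; first exact: (subalg1 hU).
rewrite emb0 oppr0; apply: has_weight0 (Defs.rel_unit hE) _ _ => i.
exact/commr_sym/commr1.
Qed.

Lemma entry_Rmatrix_F l j : entry (X := X) F l j = kap *: (entry Rc l j - (l == j)%:R%:A).
Proof.
have hB : is_subalg (Bpos k e t) by exact: subalg_smallest.
have B1 := subalg1 hB.
rewrite /entry /F /F_of_Rmatrix big_map big_cat /= scalerBr; congr (_ + _).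
  rewrite scaler_sumr; apply: eq_big_seq => p pR; rewrite /= pimZ ?scalerA //.
  by have [_ pU _] := Rmatrix_raising pR; exact: Upos_Bpos.
have [w0|wn0] := eqVneq (wd l j) 0.
  rewrite big_seq1 /= pimZ; last exact: (subalgN hB).
  by rewrite -(scaleN1r (1 : M)) pimZ // pim1 mulN1r mulrN scaleNr scalerA.
have [lj|_] := eqVneq l j; first by rewrite lj wdxx eqxx in wn0.
by rewrite big_nil scale0r scaler0 oppr0.
Qed.

Lemma entry_Rmatrix_diag l : entry (X := X) Rc l l = 1.
Proof.
have hU : is_subalg (Upos e) by exact: subalg_smallest.
rewrite /entry wdxx (tens_eq_pim l l (Rc_zero hR)) ?big_seq1 /= ?pim1 ?eqxx ?scale1r //.
  by move=> p /Rmatrix_raising[].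
by move=> p; rewrite inE => /eqP -> /=; exact: (subalg1 hU).
Qed.

(** The diagonal entries of the R-matrix are 1, and F is formed after subtracting 1 (x) 1; this
    makes F strictly raising. *)
Lemma Rmatrix_F_succ l j : entry (X := X) F l j != 0 -> succ l j.
Proof.
move=> n0; have [p pF pn0] := entry_supp n0.
have [_ pU _] := Rmatrix_F_raising pF.
case: (pim_succ pU pn0) => // lj.
by move: n0; rewrite lj entry_Rmatrix_F entry_Rmatrix_diag eqxx scale1r subrr scaler0 eqxx.
Qed.

(** This is the (l, j) entry of R Delta(e) = Deltat(e) R, taken in weight nu l - nu j. The terms
    with e in the first leg involve R in the weight lower by alpha, which is the weight of the
    remaining entry since e itself raises by alpha. *)
Lemma Rmatrix_commutes a s l j : uniq s -> l \in s -> (forall n, succ l n -> n \in s) ->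
  \sum_(n <- s) entry Rc l n * (pim (X := X) (e a) n j *: qh k t (simple a))
    + entry Rc l j * e a
  = \sum_(n <- s) pim (e a) l n *: (qh k t (- simple a) * entry Rc n j)
    + e a * entry Rc l j.
Proof.
move=> us ls hs; have hU : is_subalg (Upos e) by exact: subalg_smallest.
have eU := @e_Upos _ _ _ e a.
have E := tens_eq_pim l j (Rc_e hR a (wd l j)).
have sumr (G : M * M -> M) : \sum_(p <- ctens_mulr Rc (Delta_e k e t 1 a) (wd l j)) G p =
    \sum_(p <- Rc (wd l j - simple a)) G (p.1 * e a, p.2 * qh k t (simple a))
    + \sum_(p <- Rc (wd l j)) G (p.1 * 1, p.2 * e a).
  by rewrite /ctens_mulr big_flatten big_map big_cons big_seq1 !sum_tens_mulr /= subr0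
      scale1r.
have suml (G : M * M -> M) : \sum_(p <- ctens_mull (Delta_e k e t (-1) a) Rc (wd l j)) G p =
    \sum_(p <- Rc (wd l j - simple a)) G (e a * p.1, qh k t (- simple a) * p.2)
    + \sum_(p <- Rc (wd l j)) G (1 * p.1, e a * p.2).
  by rewrite /ctens_mull big_flatten big_map big_cons big_seq1 !sum_tens_mull /= subr0
      scaleN1r.
rewrite sumr suml /= in E.
have -> : \sum_(n <- s) entry Rc l n * (pim (X := X) (e a) n j *: qh k t (simple a)) =
  \sum_(p <- Rc (wd l j - simple a)) pim (X := X) (p.1 * e a) l j *: (p.2 * qh k t
      (simple a)).
  transitivity (\sum_(n <- s) \sum_(p <- Rc (wd l j - simple a))
      (pim (X := X) p.1 l n *: p.2) * (pim (e a) n j *: qh k t (simple a))).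
    apply: eq_bigr => n _; rewrite -mulr_suml.
    have [->|h] := eqVneq (pim (e a) n j) 0; first by rewrite !scale0r !mulr0.
    rewrite /entry -(wd_add n j l) (pim_wt hD hk hE (Upos_Bpos eU) (e_wt hE a) h) embK
        addrK //.
  rewrite exchange_big /=; apply: eq_big_seq => p pR.
  have [_ pU _] := Rmatrix_raising pR.
  rewrite (@pimM _ _ _ _ _ _ _ X s) //; try exact: Upos_Bpos.
    by rewrite scaler_suml; apply: eq_bigr => n _; rewrite -scalerAl -scalerAr scalerA.
  by move=> n /(pim_succ pU)[<- //|h] _; exact: hs.
have -> : \sum_(n <- s) pim (X := X) (e a) l n *: (qh k t (- simple a) * entry Rc n j) =
  \sum_(p <- Rc (wd l j - simple a)) pim (X := X) (e a * p.1) l j *: (qh k t (- simple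
      a) * p.2).
  transitivity (\sum_(n <- s) \sum_(p <- Rc (wd l j - simple a))
      (pim (e a) l n * pim (X := X) p.1 n j) *: (qh k t (- simple a) * p.2)).
    apply: eq_bigr => n _.
    have [->|h] := eqVneq (pim (e a) l n) 0.
      by rewrite scale0r big1 // => p _; rewrite mul0r scale0r.
    rewrite /entry -(wd_add n j l) (pim_wt hD hk hE (Upos_Bpos eU) (e_wt hE a) h) embK
        [simple a + _]addrC addrK.
    rewrite mulr_sumr scaler_sumr; apply: eq_bigr => p _.
    by rewrite -scalerAr scalerA.
  rewrite exchange_big /=; apply: eq_big_seq => p pR.
  have [_ pU _] := Rmatrix_raising pR.
  rewrite (@pimM _ _ _ _ _ _ _ X s) //; try exact: Upos_Bpos.
    by rewrite scaler_suml.
  by move=> n /pim_e_succ h _; exact: hs.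
have mr (x : M) : entry (X := X) Rc l j * x =
    \sum_(p <- Rc (wd l j)) pim (X := X) (p.1 * 1) l j *: (p.2 * x).
  by rewrite /entry mulr_suml; apply: eq_bigr => p _; rewrite mulr1 scalerAl.
have ml (x : M) : x * entry (X := X) Rc l j =
    \sum_(p <- Rc (wd l j)) pim (X := X) (1 * p.1) l j *: (x * p.2).
  by rewrite /entry mulr_sumr; apply: eq_bigr => p _; rewrite mul1r scalerAr.
rewrite mr ml; apply: E.
- move=> p /flattenP[_ /mapP[d dE ->]] /allpairsP[[q q'] /= [qR]]; rewrite inE => /eqP
    -> ->.
  have [_ qU _] := Rmatrix_raising qR; apply: (subalgM hU) => //=.
  by move: dE; rewrite !inE => /orP[] /eqP -> //=; exact: (subalg1 hU).
- move=> p /flattenP[_ /mapP[d dE ->]] /allpairsP[[q q'] /= [+ qR]]; rewrite inE =>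
    /eqP -> ->.
  have [_ qU _] := Rmatrix_raising qR; apply: (subalgM hU) => //=.
  by move: dE; rewrite !inE => /orP[] /eqP -> //=; exact: (subalg1 hU).
Qed.

Lemma sum_delta (s : seq I) (l : I) (G : I -> M) : uniq s ->
  (G l != 0 -> l \in s) -> \sum_(n <- s) (n == l)%:R *: G n = G l.
Proof.
move=> us ls; rewrite (@eq_sum_supp _ _ s [:: l]) //.
- by rewrite big_seq1 eqxx scale1r.
- move=> n; have [->|] := eqVneq n l; first by rewrite scale1r.
  by rewrite scale0r eqxx.
- move=> n; rewrite inE; have [//|] := eqVneq n l.
  by rewrite scale0r eqxx.
Qed.

(** Put R = 1 + (q - q^-1) F in the relation for R. The contributions of 1 leave e (x) (q^h - q^-h),
    and dividing by q - q^-1 gives e (x) [h]. *)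
Lemma Rmatrix_F_commutes a s l j : uniq s -> l \in s -> (forall n, succ l n -> n \in s) ->
  F_commutes F a s l j.
Proof.
move=> us ls hs; have := @Rmatrix_commutes a s l j us ls hs; rewrite /F_commutes.
have -> : \sum_(n <- s) pim (e a) l n *: (qh k t (- simple a) * entry F n j) =
  kap *: (\sum_(n <- s) pim (e a) l n *: (qh k t (- simple a) * entry Rc n j)
          - pim (e a) l j *: qh k t (- simple a)).
  rewrite -[pim (e a) l j *: _](@sum_delta s j (fun n => pim (e a) l n *: qh k t (-
      simple a))) //; last first.
    move=> h; apply: hs; apply: (@pim_e_succ _ _ _ _ _ _ _ X a).
    by apply: contraNneq h => ->; rewrite scale0r.
  rewrite -sumrB scaler_sumr; apply: eq_bigr => n _.
  rewrite entry_Rmatrix_F -scalerAr mulrBr -scalerAr mulr1 scalerA mulrC -scalerA.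
  by congr (_ *: _); rewrite scalerBr !scalerA mulrC.
have -> : \sum_(n <- s) entry F l n * (pim (X := X) (e a) n j *: qh k t (simple a)) =
  kap *: (\sum_(n <- s) entry Rc l n * (pim (X := X) (e a) n j *: qh k t (simple a))
          - pim (e a) l j *: qh k t (simple a)).
  rewrite -[pim (e a) l j *: _](@sum_delta s l (fun n => pim (e a) n j *: qh k t
      (simple a))) //.
  rewrite -sumrB scaler_sumr; apply: eq_bigr => n _.
  by rewrite entry_Rmatrix_F -scalerAl mulrBl -scalerAl mul1r eq_sym.
rewrite entry_Rmatrix_F -scalerAr -scalerAl mulrBr mulrBl -!scalerAr -!scalerAl mulr1 mul1r.
rewrite (br_quantum _ _ _ kE) oppr0 !qexp_simple scalerA mulrC -scalerA -/kap.
set A1 := \sum_(_ <- _) _; set A2 := \sum_(_ <- _) _ => E.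
rewrite -scalerDr -!scalerBr; congr (_ *: _).
rewrite scalerBr; set d := _ *: e a; set x := entry Rc l j * e a in E *.
set y := e a * _ in E *; set p := _ *: qh _ _ _; set q := _ *: qh _ _ _.
have {E} -> : A1 = A2 + y - x by rewrite -E addrK.
rewrite (_ : y - d + (A2 - q) - (x - d) = A2 + y - x - q); last first.
  by rewrite opprB !addrA [LHS](ACl (3*1*6*4*(5*2))) /= subrr addr0.
by rewrite opprB [RHS]addrC addrA subrK.
Qed.

End Quantum.

(** * The classical case: F from dual root vectors *)

Section Classical.
Variables (eb fb : Gam -> M).
Hypotheses (kE : k = classical) (hV : is_root_vectors D k e f t eb fb).
Let F := F_of_root_vectors D eb fb.
Let pr := posroots D.

Lemma pr_uniq : uniq pr. Proof. by rewrite filter_uniq // roots_uniq. Qed.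

Lemma lie_Upos x : lie_gen (range e) x -> Upos e x.
Proof. by apply: lie_gen_sub; [apply: subalg_lie; exact: subalg_smallest|exact:
    sub_alg_gen]. Qed.

Lemma lie_Uneg x : lie_gen (range f) x -> Uneg f x.
Proof. by apply: lie_gen_sub; [apply: subalg_lie; exact: subalg_smallest|exact:
    sub_alg_gen]. Qed.

Lemma eb_Upos b : b \in pr -> Upos e (eb b).
Proof. by move=> /(rv_pos hV)[] /lie_Upos. Qed.

Lemma root_F_raising : raising D k e t F.
Proof.
move=> g p /mapP[b]; rewrite mem_filter => /andP[/eqP <- bP] -> /=.
have [bU bw] := rv_pos hV bP; split => //; last exact: lie_Upos.
by move: bP; rewrite mem_filter => /andP[].
Qed.

Lemma root_F_lowering g p : p \in F g ->
  Uneg f p.2 /\ has_weight D k t (- emb R g) p.2.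
Proof.
move=> /mapP[b]; rewrite mem_filter => /andP[/eqP <- bP] -> /=.
by have [bU bw] := rv_neg hV bP; split => //; exact: lie_Uneg.
Qed.

Lemma root_F_succ l j : entry (X := X) F l j != 0 -> succ l j.
Proof.
move=> n0; have [p pF pn0] := entry_supp n0.
have [gP pU _] := root_F_raising pF.
case: (pim_succ pU pn0) => // lj.
move: pF; rewrite lj wdxx => /mapP[b]; rewrite mem_filter => /andP[/eqP -> bP] _.
by move: bP; rewrite mem_filter => /andP[_ bR]; move: (roots_neq0 hD); rewrite bR.
Qed.

Lemma entry_root_F l j : entry (X := X) F l j = \sum_(b <- pr) pim (eb b) l j *: fb b.
Proof.
rewrite /entry big_map big_filter big_mkcond; apply: eq_big_seq => b bP /=.
case: eqVneq => // bn; have [->|h] := eqVneq (pim (eb b) l j) 0; first by rewrite scale0r.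
have [_ bw] := rv_pos hV bP.
by rewrite (pim_wt hD hk hE (Upos_Bpos (eb_Upos bP)) bw h) embK eqxx in bn.
Qed.

Let t_wt (i : 'I_r) (w : 'rV[C]_r) x (xw : has_weight D k t w x) :
  t i * x - x * t i = form D (emb R (simple i)) w *: x.
Proof. by rewrite (has_weight_classical i kE xw) addrK. Qed.

Let br_simple (i : 'I_r) : br k t (emb R (simple i), 0) = t i.
Proof.
rewrite (br_classical _ _ _ kE) scale0r addr0 (bigD1 i) //= big1 ?addr0.
  by rewrite mxE !eqxx scale1r.
by move=> j ji; rewrite mxE (negPf ji) andbF scale0r.
Qed.

(** The Jacobi identity, in the form that ad x is a derivation. *)
Let commE (x y z : M) : x * (y * z - z * y) - (y * z - z * y) * x =
  ((x * y - y * x) * z - z * (x * y - y * x)) + (y * (x * z - z * x) - (x * z - z * x) * y).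
Proof.
rewrite !mulrBr !mulrBl !mulrA !opprB !addrA.
rewrite [RHS](ACl (1*8*3*6*(2*5)*(4*7))) /=.
by rewrite ?addNr ?subrr ?addr0.
Qed.

Lemma lie_neg_t (i : 'I_r) x : lie_gen (range f) x -> lie_gen (range f) (t i * x - x * t i).
Proof.
have [L0 LL LM] := lie_subalg_smallest (range f).
move: x; suff h : lie_gen (range f) `<=`
    [set x | lie_gen (range f) x /\ lie_gen (range f) (t i * x - x * t i)].
  by move=> x /h[].
apply: lie_gen_sub; last first.
  move=> _ [j _ <-]; have fj : lie_gen (range f) (f j) by apply: sub_gen_smallest; exists j.
  split => //; rewrite (t_wt i (rel_tf hE j)) -[X in lie_gen _ X]addr0; exact: LL.
split.
- by split => //; rewrite mulr0 mul0r subrr.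
- move=> c x y [hx hx'] [hy hy']; split; first exact: LL.
  by rewrite mulrDr mulrDl -scalerAr -scalerAl opprD addrACA -scalerBr; exact: LL.
- move=> x y [hx hx'] [hy hy']; split; first exact: LM.
  rewrite commE -[X in X + _]scale1r; apply: (LL); exact: LM.
Qed.

(** On generators [e_i, f_j] is t_i or 0. On a bracket ad e_i acts as a derivation, and the
    multiples of t_i it creates are bracketed with elements of n_-, so they stay in n_-. *)
Lemma lie_neg_e (i : 'I_r) x : lie_gen (range f) x ->
  exists c : C, lie_gen (range f) (e i * x - x * e i - c *: t i).
Proof.
have [L0 LL LM] := lie_subalg_smallest (range f).
have LN u : lie_gen (range f) u -> lie_gen (range f) (- u).
  by move=> hu; rewrite -scaleN1r -[X in lie_gen _ X]addr0; exact: LL.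
have LD u v : lie_gen (range f) u -> lie_gen (range f) v -> lie_gen (range f) (u + v).
  by move=> hu hv; rewrite -(scale1r u); exact: LL.
have LZ c u : lie_gen (range f) u -> lie_gen (range f) (c *: u).
  by move=> hu; rewrite -[X in lie_gen _ X]addr0; exact: LL.
move: x; suff h : lie_gen (range f) `<=` [set x | lie_gen (range f) x /\
    exists c : C, lie_gen (range f) (e i * x - x * e i - c *: t i)].
  by move=> x /h[].
apply: lie_gen_sub; last first.
  move=> _ [j _ <-]; split; first by apply: sub_gen_smallest; exists j.
  rewrite (rel_ef hE) br_simple; case: eqP => _.
    by exists 1; rewrite scale1r subrr.
  by exists 0; rewrite scale0r subrr.
split.
- by split => //; exists 0; rewrite mulr0 mul0r scale0r !subrr.
- move=> c x y [hx [c1 hx']] [hy [c2 hy']]; split; first exact: LL.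
  exists (c * c1 + c2); rewrite mulrDr mulrDl -scalerAr -scalerAl opprD addrACA -scalerBr.
  by rewrite scalerDl opprD addrACA -scalerA -scalerBr; exact: LL.
- move=> x y [hx [c1 hx']] [hy [c2 hy']]; split; first exact: LM.
  (* A bracket contributes no Cartan term. *)
  exists 0; rewrite scale0r subr0 commE.
  have ad c (u v w : M) : u * v - v * u =
      ((u - c *: w) * v - v * (u - c *: w)) + c *: (w * v - v * w).
    rewrite mulrBl mulrBr -!scalerAl -!scalerAr scalerBr opprB !addrA.
    by rewrite [RHS](ACl (1*4*(2*5)*(3*6))) /= addNr subrr !addr0.
  apply: (LD).
    rewrite (ad c1 _ y (t i)); apply: (LD); first exact: LM.
    by apply: (LZ); exact: lie_neg_t.
  rewrite -opprB; apply: (LN); rewrite (ad c2 _ x (t i)); apply: (LD); first exact: LM.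
  by apply: (LZ); exact: lie_neg_t.
Qed.

Section InvariantForm.
Variable kap : M -> M -> C.
Let gg := lie_gen (range e `|` range f `|` range t).
Hypotheses (hkap : is_invariant_form D e f t kap)
  (hdual : forall b b', b \in pr -> b' \in pr -> kap (eb b) (fb b') = (b == b')%:R).

Let hgg : is_lie_subalg gg. Proof. exact: lie_subalg_smallest. Qed.

Let g_e (i : 'I_r) : gg (e i). Proof. by apply: sub_gen_smallest; left; left; exists i. Qed.
Let g_f (i : 'I_r) : gg (f i). Proof. by apply: sub_gen_smallest; left; right; exists i. Qed.
Let g_t (i : 'I_r) : gg (t i). Proof. by apply: sub_gen_smallest; right; exists i. Qed.
Let g_pos x : lie_gen (range e) x -> gg x.
Proof. by apply: lie_gen_sub => // _ [i _ <-]. Qed.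
Let g_neg x : lie_gen (range f) x -> gg x.
Proof. by apply: lie_gen_sub => // _ [i _ <-]. Qed.
Let g_eb b : b \in pr -> gg (eb b). Proof. by move=> /(rv_pos hV)[h _]; exact: g_pos. Qed.
Let g_fb b : b \in pr -> gg (fb b). Proof. by move=> /(rv_neg hV)[h _]; exact: g_neg. Qed.
Let g_comm x y : gg x -> gg y -> gg (x * y - y * x).
Proof. by case: hgg => _ _; apply. Qed.

Let kapC x y : gg x -> gg y -> kap x y = kap y x.
Proof. by case: hkap => _ h _ _; exact: h. Qed.

Let kap_inv x y z : gg x -> gg y -> gg z -> kap (x * y - y * x) z = kap x (y * z - z * y).
Proof. by case: hkap => _ _ h _; exact: h. Qed.

Let kap_linl c x x' y : gg x -> gg x' -> gg y -> kap (c *: x + x') y = c * kap x y +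
    kap x' y.
Proof. by case: hkap => h _ _ _; exact: h. Qed.

Let kap0 y : gg y -> kap 0 y = 0.
Proof.
case: hgg => h0 _ _ hy; have := kap_linl (-1) h0 h0 hy.
by rewrite scaleN1r addNr mulN1r addNr.
Qed.

Let kapZ c x y : gg x -> gg y -> kap (c *: x) y = c * kap x y.
Proof.
case: hgg => h0 _ _ hx hy; have := kap_linl c hx h0 hy.
by rewrite kap0 // !addr0.
Qed.

Let kap_sum (s : seq Gam) (c : Gam -> C) (G : Gam -> M) y :
  (forall b, b \in s -> gg (G b)) -> gg y ->
  gg (\sum_(b <- s) c b *: G b) /\
  kap (\sum_(b <- s) c b *: G b) y = \sum_(b <- s) c b * kap (G b) y.
Proof.
move=> + hy; elim: s => [|b s IH] hs; first by rewrite !big_nil kap0 //; case: hgg.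
have hb : gg (G b) by apply: hs; rewrite inE eqxx.
have [h1 h2] : gg (\sum_(b <- s) c b *: G b) /\
    kap (\sum_(b <- s) c b *: G b) y = \sum_(b <- s) c b * kap (G b) y.
  by apply: IH => b' b's; apply: hs; rewrite inE b's orbT.
rewrite !big_cons kap_linl // h2; split => //.
by case: hgg => _ h _; exact: h.
Qed.

(** By invariance 0 = kap(x, [t_j, t_i]) = kap([x, t_j], t_i) = - (alpha_j, g) kap(x, t_i) for every
    j, and some (alpha_j, g) is nonzero. *)
Let kap_t x g (i : 'I_r) : gg x -> g != 0 -> has_weight D k t (emb R g) x -> kap x (t
    i) = 0.
Proof.
move=> hx gn0 xw; apply/eqP; apply: contraNT gn0 => kn0; apply/eqP.
apply: (form_nondeg hD (R := R)) => j.
have := kap_inv hx (g_t j) (g_t i).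
rewrite (rel_tt hE j i) subrr (kapC hx); last by case: hgg.
rewrite kap0 // -opprB (t_wt j xw) -scaleNr kapZ // => /eqP.
by rewrite mulf_eq0 (negPf kn0) orbF oppr_eq0 => /eqP.
Qed.

Let pr_neq0 b : b \in pr -> b != 0.
Proof.
rewrite mem_filter => /andP[_ bR]; apply: contraTneq bR => ->; exact: roots_neq0.
Qed.

Let kap_eb_t b (i : 'I_r) : b \in pr -> kap (eb b) (t i) = 0.
Proof. by move=> bP; have [_ bw] := rv_pos hV bP; apply: kap_t bw; [exact: g_eb|exact:
    pr_neq0]. Qed.

Let kap_fb_t b (i : 'I_r) : b \in pr -> kap (fb b) (t i) = 0.
Proof.
move=> bP; have [_ bw] := rv_neg hV bP; rewrite -embN in bw.
by apply: kap_t bw; [exact: g_fb|rewrite oppr_eq0; exact: pr_neq0].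
Qed.

Let sum_diag (s : seq Gam) (c : Gam -> C) b : uniq s -> b \in s ->
  \sum_(d <- s) c d * (b == d)%:R = c b.
Proof.
move=> us bs; rewrite (bigD1_seq b) //= eqxx mulr1 big1 ?addr0 // => d db.
by rewrite eq_sym (negPf db) mulr0.
Qed.

(** Invariance of the form makes the matrix of ad e_a on the vectors e_b minus the transpose of its
    matrix on the f_b modulo t_a, so the n_- terms cancel. The remaining terms add up to e_a (x) t_a
    because the coefficient of t_a in [e_a, f_b] is the coordinate of e_a along e_b. *)
Lemma form_F_commutes (a : 'I_r) s l j : uniq s -> l \in s ->
  (forall n, succ l n -> n \in s) -> F_commutes F a s l j.
Proof.
move=> us ls hs; have eU := @e_Upos _ _ _ e a.
have hU : is_subalg (Upos e) by exact: subalg_smallest.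
have uP := pr_uniq.
have /choice[c cP] : forall b, exists c : C * (Gam -> C), b \in pr ->
    e a * fb b - fb b * e a = c.1 *: t a + \sum_(d <- pr) c.2 d *: fb d.
  move=> b; have [bP|_] := boolP (b \in pr); last by exists (0, fun=> 0).
  have [c1 /(rv_neg_span hV)[c2 E]] := lie_neg_e a (rv_neg hV bP).1.
  by exists (c1, c2) => _ /=; rewrite -/pr in E; rewrite -E [RHS]addrC subrK.
have /choice[c' c'P] : forall b, exists c' : Gam -> C, b \in pr ->
    e a * eb b - eb b * e a = \sum_(d <- pr) c' d *: eb d.
  move=> b; have [bP|_] := boolP (b \in pr); last by exists (fun=> 0).
  have [L0 LL LM] := lie_subalg_smallest (range e).
  have ea : lie_gen (range e) (e a) by apply: sub_gen_smallest; exists a.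
  by have [c2 E] := rv_pos_span hV (LM _ _ ea (rv_pos hV bP).1); exists c2.
have ea : lie_gen (range e) (e a) by apply: sub_gen_smallest; exists a.
have [eps epsE] := rv_pos_span hV ea; rewrite -/pr in epsE.
have kap_span (u : Gam -> C) d : d \in pr -> kap (\sum_(b <- pr) u b *: eb b) (fb d) = u d.
  move=> dP; have [_ ->] := @kap_sum pr u eb (fb d) (fun b => @g_eb b) (g_fb dP).
  rewrite -[RHS](sum_diag u uP dP); apply: eq_big_seq => b bP.
  by rewrite hdual // eq_sym.
have kap_bracket y b : b \in pr -> gg y -> kap y (e a * fb b - fb b * e a) =
    (c b).1 * kap y (t a) + \sum_(d <- pr) (c b).2 d * kap y (fb d).
  move=> bP hy; have [h1 h2] := @kap_sum pr (c b).2 fb y (fun b => @g_fb b) hy.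
  rewrite kapC //; last by apply: g_comm => //; exact: g_fb.
  rewrite cP // kap_linl // h2 (kapC hy) //; congr (_ + _).
  by apply: eq_big_seq => d dP; rewrite (kapC hy) //; exact: g_fb.
have c'E b d : b \in pr -> d \in pr -> c' b d = - (c d).2 b.
  move=> bP dP; rewrite -(kap_span (c' b) d dP) -c'P // -opprB -scaleN1r kapZ ?mulN1r;
      last 2 first.
  - by apply: g_comm => //; exact: g_eb.
  - exact: g_fb.
  rewrite kap_inv //; [|exact: g_eb|exact: g_fb].
  rewrite kap_bracket //; last exact: g_eb.
  rewrite kap_eb_t // mulr0 add0r -[(c d).2 b](sum_diag (c d).2 uP bP).
  by congr (- _); apply: eq_big_seq => b' b'P; rewrite hdual.
have epsc b : b \in pr -> eps b = (c b).1.
  move=> bP; rewrite -(kap_span eps b bP) -epsE.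
  (* kap([t_a, e_a], f_b) is computed in two ways; each carries the factor (alpha_a, alpha_a) =
     kap(t_a, t_a), which cancels. *)
  apply: (mulfI (form_simple_neq0 R hD a)).
  have := kap_inv (g_t a) (g_e a) (g_fb bP).
  rewrite (t_wt a (e_wt hE a)) kapZ //; last exact: g_fb.
  move=> ->; rewrite kap_bracket // big_seq big1 ?addr0 => [|d dP].
    rewrite mulrC; congr (_ * _); case: hkap => _ _ _ ->.
    rewrite form_simple_emb (bigD1 a) //= big1 ?addr0 => [|d da].
      by rewrite mxE !eqxx mulr1.
    by rewrite mxE (negPf da) andbF mulr0.
  by rewrite (kapC (g_t a)) ?kap_fb_t ?mulr0 //; exact: g_fb.
rewrite /F_commutes br_simple.
have q1 g : qh k t g = 1 by rewrite /qh kE.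
rewrite !q1; pose p b := pim (X := X) (eb b) l j.
have E1 : e a * entry F l j - entry F l j * e a =
    \sum_(b <- pr) (p b * (c b).1) *: t a + \sum_(b <- pr) \sum_(d <- pr) (p b * (c
        b).2 d) *: fb d.
  rewrite entry_root_F mulr_sumr mulr_suml -sumrB -big_split; apply: eq_big_seq => b bP /=.
  rewrite -scalerAr -scalerAl -scalerBr cP // scalerDr scalerA scaler_sumr; congr (_ + _).
  by apply: eq_bigr => d _; rewrite scalerA.
have E2 : \sum_(n <- s) pim (X := X) (e a) l n *: (1 * entry F n j) =
    \sum_(b <- pr) pim (X := X) (e a * eb b) l j *: fb b.
  transitivity (\sum_(n <- s) \sum_(b <- pr) (pim (X := X) (e a) l n * pim (eb b) n j)
      *: fb b).
    by apply: eq_bigr => n _; rewrite mul1r entry_root_F scaler_sumr; apply: eq_bigr =>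
        b _; rewrite scalerA.
  rewrite exchange_big /=; apply: eq_big_seq => b bP.
  rewrite (@pimM _ _ _ _ _ _ _ X s) ?scaler_suml //; try apply: Upos_Bpos => //; try
      exact: eb_Upos.
  by move=> n /pim_e_succ h _; exact: hs.
have E3 : \sum_(n <- s) entry F l n * (pim (X := X) (e a) n j *: 1) =
    \sum_(b <- pr) pim (X := X) (eb b * e a) l j *: fb b.
  transitivity (\sum_(n <- s) \sum_(b <- pr) (pim (X := X) (eb b) l n * pim (e a) n j)
      *: fb b).
    apply: eq_bigr => n _; rewrite -scalerAr mulr1 entry_root_F scaler_sumr.
    by apply: eq_bigr => b _; rewrite scalerA mulrC.
  rewrite exchange_big /=; apply: eq_big_seq => b bP.
  rewrite (@pimM _ _ _ _ _ _ _ X s) ?scaler_suml //; try apply: Upos_Bpos => //; try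
      exact: eb_Upos.
  by move=> n /(pim_succ (eb_Upos bP))[<- //|h] _; exact: hs.
have E4 : \sum_(b <- pr) pim (X := X) (e a * eb b) l j *: fb b
        - \sum_(b <- pr) pim (X := X) (eb b * e a) l j *: fb b =
    - \sum_(b <- pr) \sum_(d <- pr) (p b * (c b).2 d) *: fb d.
  rewrite exchange_big -sumrB -sumrN; apply: eq_big_seq => b bP /=.
  have hb := eb_Upos bP.
  rewrite -scalerBl -pimB; try by apply: Upos_Bpos; exact: (subalgM hU).
  rewrite c'P // pim_sum; last by move=> d dP; apply: Upos_Bpos; exact: eb_Upos.
  rewrite scaler_suml -sumrN; apply: eq_big_seq => d dP.
  by rewrite c'E // mulNr scaleNr mulrC.
rewrite E2 E3 [RHS](ACl (1*3*(2*4))) /= E1 E4 addrK.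
rewrite -scaler_suml epsE pim_sum; last by move=> d dP; apply: Upos_Bpos; exact: eb_Upos.
by congr (_ *: _); apply: eq_big_seq => b bP; rewrite epsc // mulrC.
Qed.

End InvariantForm.

Lemma root_F_commutes (a : 'I_r) s l j : uniq s -> l \in s ->
  (forall n, succ l n -> n \in s) -> F_commutes F a s l j.
Proof. by have [kap hkap hdual] := rv_dual hV; exact: form_F_commutes hkap hdual _ _ _
    _. Qed.

End Classical.

Section EitherFlavour.
Variable F : ctens r M.
Hypothesis hF : is_F D k e f t F.

(** A case split that leaves [k] abstract, since other types in the context depend on it. *)
Lemma is_F_cases :
  (exists hb Rc, [/\ k = quantum hb, is_reduced_Rmatrix D k e f t Rc & F = F_of_Rmatrix
      hb Rc])
  \/ exists eb fb, [/\ k = classical, is_root_vectors D k e f t eb fb & F =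
      F_of_root_vectors D eb fb].
Proof.
have : forall k0, k0 = k ->
  (exists hb Rc, [/\ k0 = quantum hb, is_reduced_Rmatrix D k e f t Rc & F =
      F_of_Rmatrix hb Rc])
  \/ exists eb fb, [/\ k0 = classical, is_root_vectors D k e f t eb fb & F =
      F_of_root_vectors D eb fb];
  last by apply.
case=> [hb|] kE; move: hF; rewrite /is_F -kE.
  by move=> [Rc hR FE]; left; exists hb, Rc.
by move=> [eb [fb [hV FE]]]; right; exists eb, fb.
Qed.

Lemma F_raising : raising D k e t F.
Proof.
by case: is_F_cases => [[hb [Rc [_ hR ->]]]|[eb [fb [_ hV ->]]]];
  [exact: Rmatrix_F_raising hR|exact: root_F_raising hV].
Qed.

Lemma F_lowering g p : p \in F g -> Uneg f p.2 /\ has_weight D k t (- emb R g) p.2.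
Proof.
by case: is_F_cases => [[hb [Rc [_ hR ->]]]|[eb [fb [_ hV ->]]]];
  [exact: Rmatrix_F_lowering hR g p|exact: root_F_lowering hV g p].
Qed.

Lemma F_succ l j : entry (X := X) F l j != 0 -> succ l j.
Proof.
by case: is_F_cases => [[hb [Rc [kE hR ->]]]|[eb [fb [kE hV ->]]]];
  [exact: (Rmatrix_F_succ hR)|exact: (root_F_succ hV)].
Qed.

Lemma F_commutesP a s l j : uniq s -> l \in s -> (forall n, succ l n -> n \in s) ->
  F_commutes F a s l j.
Proof.
by case: is_F_cases => [[hb [Rc [kE hR ->]]]|[eb [fb [kE hV ->]]]];
  [exact: Rmatrix_F_commutes kE hR a s l j|exact: root_F_commutes kE hV a s l j].
Qed.

End EitherFlavour.
End FTensor.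

(** * One row of S~ as a finite series *)

Section RowRecursion.
Set Implicit Arguments.
Unset Strict Implicit.
Variables (R : realType) (r : nat) (D : rootDatum r) (k : flavour R).
Variables (M : unitAlgType (complex R)) (e f t : 'I_r -> M).
Local Notation C := (complex R).
Local Notation Gam := 'rV[int]_r.
Hypotheses (hD : is_root_system D) (hk : flavour_ok k).
Hypothesis hE : enveloping_relations D k e f t.
Variable F : ctens r M.
Hypothesis hF : is_F D k e f t F.
Variable X : gradedModule D k e t.
Local Notation I := (gidx X).
Local Notation wd l j := (lat (nu l - nu j) : Gam).
Local Notation Fe := (entry (X := X) F).
Implicit Types (j l : I) (g : Gam).

Variables (i : I) (s : seq I).
Hypotheses (us : uniq s) (is_ : i \in s) (hs : forall l, succ i l -> l \in s).
Hypothesis sh : forall l, l \in s -> l = i \/ succ i l.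

Lemma s_succ l j : l \in s -> succ l j -> succ i j.
Proof. by move=> /sh[->//|il] lj; exact: succ_trans il lj. Qed.

Lemma s_closed l j : l \in s -> succ l j -> j \in s.
Proof. by move=> ls lj; apply: hs; exact: s_succ ls lj. Qed.

Lemma s_GammaP l : l \in s -> in_GammaP (wd i l).
Proof.
move=> /sh[->|/(succ_wd hD hk hE)[]//]; rewrite wdxx.
by apply/forallP => a; rewrite mxE.
Qed.

Lemma s_height l j : l \in s -> succ l j -> (height (wd i l) < height (wd i j))%N.
Proof.
move=> ls lj; have [g1 n1] := succ_wd hD hk hE lj.
by rewrite -(wd_add l j i) heightD ?s_GammaP // -{1}[height (wd i l)]addn0 ltn_add2l
    height_gt0.
Qed.

Section Coefficients.
Variable c : I -> M.

(* The i-th row of the n-th term of a matrix S with S = 1 + c (S F), where    *)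
(* the coefficient c j multiplies the j-th column from the left.              *)
Fixpoint row (n : nat) (j : I) : M :=
  match n with
  | 0%N => (i == j)%:R
  | n'.+1 => c j * \sum_(l <- s) row n' l * Fe l j
  end.

Lemma rowS_supp n j : row n.+1 j != 0 -> exists l, [/\ l \in s, row n l != 0 & succ l j].
Proof.
move=> h; have : \sum_(l <- s) row n l * Fe l j != 0.
  by apply: contraNneq h => /= ->; rewrite mulr0.
move=> /eqP n0; apply: contrapT => nex; apply: n0; rewrite big_seq big1 // => l ls.
have [->|rn0] := eqVneq (row n l) 0; first by rewrite mul0r.
have [->|/(F_succ hD hE hF) lj] := eqVneq (Fe l j) 0; first by rewrite mulr0.
by case: nex; exists l.
Qed.

Lemma rowS_succ n j : row n.+1 j != 0 -> succ i j.
Proof. by move=> /rowS_supp[l [ls _ lj]]; exact: s_succ ls lj. Qed.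

Lemma row_height n j : row n j != 0 -> (n <= height (wd i j))%N.
Proof.
elim: n j => [//|n IH] j /rowS_supp[l [ls /IH h lj]].
exact: leq_ltn_trans h (s_height ls lj).
Qed.

Lemma row_supp n j : row n j != 0 -> j \in s.
Proof.
case: n => [|n /rowS_succ/hs//] /=.
by have [<-//|_] := eqVneq i j; rewrite eqxx.
Qed.

Hypothesis c_wt : forall j, has_weight D k t 0 (c j).

Lemma row_wt n j : has_weight D k t (nu j - nu i) (row n j).
Proof.
elim: n j => [|n IH] j /=.
  have [->|_] := eqVneq i j; last exact: has_weight00.
  by rewrite subrr; apply: has_weight0 (Defs.rel_unit hE) _ _ => a; exact/commr_sym/commr1.
rewrite -[nu j - nu i]add0r; apply: (has_weightM (Defs.rel_unit hE)) => //.
apply: has_weight_sum => l _.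
have -> : nu j - nu i = (nu l - nu i) + (nu j - nu l) by rewrite [RHS]addrC addrA subrK.
apply: (has_weightM (Defs.rel_unit hE)) => //; apply: entry_wt => g p pF.
by have [] := F_lowering hE hF pF.
Qed.

(** By [row_height] the terms from this index on vanish, uniformly in the column. *)
Definition row_bound : nat := (\max_(j <- s) height (wd i j)).+1.

Lemma row_bound_height j : j \in s -> (height (wd i j) < row_bound)%N.
Proof. by move=> js; rewrite ltnS; apply: (@leq_bigmax_seq _ s xpredT (fun j => height
    (wd i j))). Qed.

Definition rowsum (j : I) : M := \sum_(0 <= n < row_bound) row n j.

Lemma rowsum_supp j : rowsum j != 0 -> j \in s.
Proof.
apply: contraR => js; apply/eqP; rewrite /rowsum big1 // => n _; apply/eqP.
by apply: contraNT js; exact: row_supp.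
Qed.

Lemma rowsum_wt j : has_weight D k t (nu j - nu i) (rowsum j).
Proof. by apply: has_weight_sum => n _; exact: row_wt. Qed.

Lemma rowsum_diag : rowsum i = 1.
Proof.
rewrite /rowsum big_nat_recl //= eqxx big1 ?addr0 // => n _; apply/eqP.
by apply/negPn/negP => /(@rowS_succ n)/(succ_irr hD hk hE).
Qed.

(** Cancelling [c j] turns the term n + 1 on the left into the n-th summand on the right. The index
    shift costs nothing: the term 0 vanishes since i and j differ, and the term [row_bound] vanishes
    by its height. *)
Lemma rowsum_rec (d : M) j : succ i j -> d * c j = 1 ->
  d * rowsum j = \sum_(l <- s) rowsum l * Fe l j.
Proof.
move=> ij dc; have js := hs ij.
transitivity (\sum_(0 <= n < row_bound) \sum_(l <- s) row n l * Fe l j); last first.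
  by rewrite exchange_big; apply: eq_bigr => l _; rewrite mulr_suml.
transitivity (\sum_(0 <= n < row_bound) d * row n.+1 j); last first.
  by apply: eq_bigr => n _ /=; rewrite mulrA dc mul1r.
rewrite -mulr_sumr; congr (_ * _).
have r0 : row 0 j = 0.
  by rewrite /=; have [E|//] := eqVneq i j; case: (succ_irr hD hk hE (i := j)); rewrite
      -{1}E.
have rN : row row_bound j = 0.
  apply/eqP; apply/negPn/negP => /row_height.
  by rewrite leqNgt row_bound_height.
transitivity (\sum_(0 <= n < row_bound.+1) row n j).
  by rewrite [RHS]big_nat_recr // rN /= addr0.
by rewrite big_nat_recl // r0 add0r.
Qed.

Lemma rowsum_trunc j m : j \in s -> (height (wd i j) < m)%N ->
  \sum_(0 <= n < m) row n j = rowsum j.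
Proof.
move=> js; have aux m' m'' : (height (wd i j) < m')%N -> (m' <= m'')%N ->
    \sum_(0 <= n < m'') row n j = \sum_(0 <= n < m') row n j.
  move=> h le; rewrite (big_cat_nat _ le) //= [X in _ + X]big_nat [X in _ + X]big1
      ?addr0 // => n /andP[ln _].
  apply/eqP; apply/negPn/negP => /row_height; rewrite leqNgt.
  by rewrite (leq_trans h ln).
move=> h; rewrite /rowsum; have [le|le] := leqP m row_bound; first by rewrite (aux m).
by rewrite (aux row_bound) ?row_bound_height // ltnW.
Qed.

(* Routes of length n starting at i inside s, listed backwards.               *)
Fixpoint revroutes (n : nat) : seq (seq I) :=
  match n with
  | 0%N => [:: [::]]
  | n'.+1 => [seq j :: m | m <- revroutes n', j <- s]
  end.

(** The share of one backward list in [row]. The default of [head] is i, the start of every route;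
    the newest coefficient stands leftmost because phi(-D) multiplies from the left. *)
Fixpoint rterm (m : seq I) : M :=
  match m with
  | [::] => 1
  | j :: m' => c j * (rterm m' * Fe (head i m') j)
  end.

(** An arbitrary additive [h] makes the induction work: peeling off the last step replaces [h] by a
    sum over j of [h j] after multiplication by [c j] and [Fe l j]. *)
Lemma sum_row_rterm n (h : I -> M -> M) : (forall j, h j 0 = 0) ->
  (forall j x y, h j (x + y) = h j x + h j y) ->
  \sum_(j <- s) h j (row n j) = \sum_(m <- revroutes n) h (head i m) (rterm m).
Proof.
elim: n h => [|n IH] h h0 hadd.
  rewrite big_seq1 /= (@eq_sum_supp _ _ s [:: i] (fun j => h j (i == j)%:R)) //.
  - by rewrite big_seq1 eqxx.
  - by move=> j; have [<-//|_] := eqVneq i j; rewrite h0 eqxx.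
  - by move=> j; rewrite inE eq_sym; have [//|_] := eqVneq i j; rewrite h0 eqxx.
have hsum j (J : Type) (u : seq J) (G : J -> M) : h j (\sum_(x <- u) G x) = \sum_(x <-
    u) h j (G x).
  by elim/big_rec2: _ => [|x y z _ <-].
rewrite /= big_allpairs_dep /=.
transitivity (\sum_(l <- s) \sum_(j <- s) h j (c j * (row n l * Fe l j))).
  by rewrite exchange_big; apply: eq_bigr => j _; rewrite mulr_sumr hsum.
apply: (IH (fun l x => \sum_(j <- s) h j (c j * (x * Fe l j)))).
- by move=> l; rewrite big1 // => j _; rewrite mul0r mulr0.
- by move=> l x y; rewrite -big_split; apply: eq_bigr => j _; rewrite mulrDl mulrDr hadd.
Qed.

Lemma rterm_wt m : has_weight D k t (nu (head i m) - nu i) (rterm m).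
Proof.
elim: m => [|j m IH] /=.
  by rewrite subrr; apply: has_weight0 (Defs.rel_unit hE) _ _ => a; exact/commr_sym/commr1.
rewrite -[_ - _]add0r; apply: (has_weightM (Defs.rel_unit hE)) => //.
have -> : nu j - nu i = (nu (head i m) - nu i) + (nu j - nu (head i m)) by rewrite
    [RHS]addrC addrA subrK.
apply: (has_weightM (Defs.rel_unit hE)) => //; apply: entry_wt => g p pF.
by have [] := F_lowering hE hF pF.
Qed.

End Coefficients.

Lemma revroutes_size n m : m \in revroutes n -> size m = n.
Proof. by elim: n m => [|n IH] m /=; [rewrite inE => /eqP ->|move=> /allpairsP[[m' j]
    /= [/IH <- _ ->]]]. Qed.

Lemma revroutes_uniq n : uniq (revroutes n).
Proof.
elim: n => [//|n IH] /=; apply: allpairs_uniq => // -[m j] [m' j'] _ _ /=.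
by move=> [-> ->].
Qed.

Lemma mem_revroutes m : {subset m <= s} -> m \in revroutes (size m).
Proof.
elim: m => [//|j m IH] h /=; apply/allpairsP; exists (m, j); split => //=.
  by apply: IH => l lm; apply: h; rewrite inE lm orbT.
by apply: h; rewrite inE eqxx.
Qed.

Lemma flatten_revroutes_uniq (u : seq nat) : uniq u -> uniq (flatten [seq revroutes n |
    n <- u]).
Proof.
elim: u => [//|n u IH] /= /andP[nu_ uu]; rewrite cat_uniq revroutes_uniq IH // andbT /=.
apply/hasPn => m /flattenP[_ /mapP[n' n'u ->] /revroutes_size mn'].
by apply: contra nu_ => /revroutes_size <-; rewrite mn'.
Qed.

Lemma phi_route_rcons l m j :
  phi_route F l (rcons m j) = phi_route F l m * Fe (last l m) j.
Proof. by elim: m l => [|a m IH] l /=; rewrite ?mul1r ?mulr1 // IH mulrA. Qed.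

Lemma phi_route_route l m : phi_route F l m != 0 -> route l m.
Proof.
elim: m l => [//|j m IH] l /= h; split.
  by apply: (F_succ hD hE hF); apply: contraNneq h => ->; rewrite mul0r.
by apply: IH; apply: contraNneq h => ->; rewrite mulr0.
Qed.

(** Each step strictly raises the height, so the height of the end bounds the length of a route. *)
Lemma route_s l m : l \in s -> route l m ->
  (forall n, n \in m -> succ l n) /\ (height (wd i l) + size m <= height (wd i (last l
      m)))%N.
Proof.
elim: m l => [|j m IH] l ls /=; first by rewrite addn0.
move=> [lj jm]; have js := s_closed ls lj; have [h1 h2] := IH j js jm; split.
  by move=> n; rewrite inE => /orP[/eqP -> //|/h1]; exact: succ_trans.
by rewrite addnS -addSn; apply: leq_trans h2; rewrite leq_add2r; exact: s_height.
Qed.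

Lemma St_term_raising n : raising D k e t (St_term D k t F n).
Proof.
have hU : is_subalg (Upos e) by exact: subalg_smallest.
elim: n => [|n IH] g p /=.
  case: eqVneq => [->|//]; rewrite inE => /eqP -> /=; split.
  - by apply/forallP => a; rewrite mxE.
  - exact: (subalg1 hU).
  - rewrite emb0; apply: has_weight0 (Defs.rel_unit hE) _ _ => a.
    exact/commr_sym/commr1.
rewrite /phiD; case: ifP => [/andP[gP _]|//] /mapP[q + ->] /=.
move=> /flattenP[_ /mapP[h _ ->]] /allpairsP[[a b] /= [aS bF ->]] /=.
have [_ aU aw] := IH _ _ aS; have [_ bU bw] := F_raising hE hF bF.
split => //; first exact: (subalgM hU).
by rewrite -(subrK h g) embD; exact: (has_weightM (Defs.rel_unit hE)).
Qed.

Lemma entry_St_term n j :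
  entry (X := X) (St_term D k t F n) i j =
  row (fun j => phi k t (etat D (emb R (wd i j)))) n j.
Proof.
set c := fun j => _.
elim: n j => [|n IH] j.
  rewrite /entry /=; case: eqVneq => [|w].
    by rewrite big_seq1 /= pim1 => _; case: eqVneq; rewrite ?scale1r ?scale0r.
  by rewrite big_nil; have [E|//] := eqVneq i j; rewrite E wdxx eqxx in w.
have recS : entry (X := X) (ctens_mul (St_term D k t F n) F) i j =
    \sum_(l <- s) row c n l * Fe l j.
  rewrite (entry_mul hD hk hE j (@St_term_raising n) (F_raising hE hF) us is_ hs).
  by apply: eq_bigr => l _; rewrite IH.
rewrite [RHS]/= -recS {1}/entry /= /phiD; case: ifPn => [_|gn].
  by rewrite big_map /entry mulr_sumr; apply: eq_bigr => p _; rewrite scalerAr.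
(* [phiD] discards weight 0 and weights outside Gamma_+, whereas [row] does not; but its later terms
   are nonzero only at indices strictly below i, where nothing is discarded. *)
rewrite big_nil; have [|/(@rowS_succ c n) ij] := eqVneq (row c n.+1 j) 0.
  by rewrite /= -recS.
by have [g1 n1] := succ_wd hD hk hE ij; rewrite g1 n1 in gn.
Qed.

Lemma entry_St j : entry (X := X) (St D k t F) i j =
  rowsum (fun j => phi k t (etat D (emb R (wd i j)))) j.
Proof.
set c := fun j => _.
transitivity (\sum_(0 <= n < (height (wd i j)).+1) row c n j).
  rewrite {1}/entry /St big_flatten big_map; apply: eq_bigr => n _.
  exact: entry_St_term.
have [js|js] := boolP (j \in s); first exact: rowsum_trunc.
rewrite big1 => [|n _]; last by apply/eqP; apply: contraNT js; exact: row_supp.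
by apply/esym/eqP; apply: contraNT js; exact: rowsum_supp.
Qed.

End RowRecursion.

(** * The action of the raising generators on S~ *)

Section Intertwining.
Set Implicit Arguments.
Unset Strict Implicit.
Variables (R : realType) (r : nat) (D : rootDatum r) (k : flavour R).
Variables (M : unitAlgType (complex R)) (e f t : 'I_r -> M).
Local Notation C := (complex R).
Local Notation Gam := 'rV[int]_r.
Hypotheses (hD : is_root_system D) (hk : flavour_ok k).
Hypothesis hE : enveloping_relations D k e f t.
Variable F : ctens r M.
Hypothesis hF : is_F D k e f t F.
Variables (A : set M) (Cs : set C).
Hypothesis hA : is_admissible D k e f t A.
Hypothesis hCs : is_localization D k t A Cs.
Variable X : gradedModule D k e t.
Local Notation I := (gidx X).
Local Notation wd l j := (lat (nu l - nu j) : Gam).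
Local Notation Fe := (entry (X := X) F).
Implicit Types (j l : I) (g : Gam).

Lemma Upos_A x : Upos e x -> A x.
Proof.
case: hA => _ UA _ _ xU; apply: UA; move: x xU; apply: alg_genS => x h; by left; left.
Qed.

Lemma Uneg_A x : Uneg f x -> A x.
Proof.
case: hA => _ UA _ _ xU; apply: UA; move: x xU; apply: alg_genS => x h; by left; right.
Qed.

Lemma loc_unit g c : loc Cs (emb R g, c) -> br k t (emb R g, c) \is a GRing.unit.
Proof. by case: hCs => h _ _; exact: h. Qed.

(** The affine expressions in [loc] have constant -c with c in [Cs], so adding a weight in [Cs] is a
    subtraction here. The nonzero vector [x] certifies that w is a weight of A. *)
Lemma loc_shift g c w x : loc Cs (emb R g, c) -> wtspace D k t A w x -> x != 0 ->
  loc Cs (emb R g, c - form D (emb R g) w).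
Proof.
move=> [g' [c' [gP gn0 cC [/emb_inj -> ->]]]] xw xn0.
case: hCs => _ h _; exists g', (c' + form D (emb R g') w).
by split => //; [exact: h xw xn0|rewrite opprD].
Qed.

Definition etac (g : Gam) : C := form D (emb R g) (rho R D) - 2^-1 * form D (emb R g)
    (emb R g).
Definition etatc (g : Gam) : C := form D (emb R g) (rho R D) + 2^-1 * form D (emb R g)
    (emb R g).

Lemma loc_eta g : in_GammaP g -> g != 0 -> loc Cs (emb R g, etac g).
Proof. by move=> gP gn0; case: hCs => _ _ /(_ g gP gn0)[]. Qed.

Lemma loc_etat g : in_GammaP g -> g != 0 -> loc Cs (emb R g, etatc g).
Proof. by move=> gP gn0; case: hCs => _ _ /(_ g gP gn0)[]. Qed.

Lemma phi_wt0 a : has_weight D k t 0 (phi k t a).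
Proof.
apply: (has_weight0 D (Defs.rel_unit hE)) => i; apply/commr_sym/comm_phi => j.
exact: (rel_tt hE).
Qed.

Variables (i : I) (s : seq I).
Hypotheses (us : uniq s) (is_ : i \in s) (hs : forall l, succ i l -> l \in s).
Hypothesis sh : forall l, l \in s -> l = i \/ succ i l.

Let Scoef (j : I) : M := phi k t (etat D (emb R (wd i j))).
Let S := rowsum F i s Scoef.

Section OneSimpleRoot.
Variable a : 'I_r.
Hypothesis en0 : e a != 0.
Let al := simple a.

(** The constant of etat_g - (alpha, g): with this shift T crosses e_alpha and becomes T(etat_g),
    the factor in the recursion for S. *)
Let ch g : C := etatc g - form D (emb R al) (emb R g).
Let Scoef' (j : I) : M := phi k t (emb R (wd i j), ch (wd i j)).
Let S' := rowsum F i s Scoef'.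

Let tu := Defs.rel_unit hE.
Let tt := rel_tt hE.

Let ea_wt : wtspace D k t A (emb R al) (e a).
Proof. by split; [apply: Upos_A; exact: e_Upos|exact: (rel_te hE)]. Qed.

Let S_rec j : succ i j ->
  phi_inv k t (wd i j) (etatc (wd i j)) * S j = \sum_(l <- s) S l * Fe l j.
Proof.
move=> ij; have [gP gn0] := succ_wd hD hk hE ij.
apply: (rowsum_rec hD hk hE hF hs sh ij).
by apply: (phi_invK tu tt); apply: loc_unit; exact: loc_etat.
Qed.

Let ch_unit j : succ i j -> br k t (emb R (wd i j), ch (wd i j)) \is a GRing.unit.
Proof.
move=> ij; have [gP gn0] := succ_wd hD hk hE ij.
apply: loc_unit; rewrite /ch (formC _ _ hD).
by apply: loc_shift ea_wt en0; exact: loc_etat.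
Qed.

Let S'_rec j : succ i j ->
  phi_inv k t (wd i j) (ch (wd i j)) * S' j = \sum_(l <- s) S' l * Fe l j.
Proof.
move=> ij; apply: (rowsum_rec hD hk hE hF hs sh ij).
by apply: (phi_invK tu tt); exact: ch_unit.
Qed.

Let S_diag : S i = 1. Proof. exact: (rowsum_diag hD hk hE hF sh). Qed.
Let S'_diag : S' i = 1. Proof. exact: (rowsum_diag hD hk hE hF sh). Qed.

Let no_return l : l \in s -> ~ succ l i.
Proof. by move=> /(s_succ sh) h /h; exact: (succ_irr hD hk hE). Qed.

(** The recursion persists at l = i: there T(0) = 0, and no entry of F leads back to i. *)
Let S'_rec_all l : l \in s ->
  phi_inv k t (wd i l) (ch (wd i l)) * S' l = \sum_(n <- s) S' n * Fe n l.
Proof.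
move=> /sh[->|]; last exact: S'_rec.
have -> : phi_inv k t (wd i i) (ch (wd i i)) = 0.
  by rewrite wdxx /ch /etatc emb0 !form0l !form0r mulr0 addr0 subr0 phi_inv00.
rewrite mul0r big_seq big1 // => n ns.
have [->|/(F_succ hD hE hF) ni] := eqVneq (Fe n i) 0; first by rewrite mulr0.
by case: (no_return ns ni).
Qed.

(** Here (alpha, rho) = (alpha, alpha) / 2 enters: it cancels the terms that do not depend on g. *)
Let ch_add g : ch (g + al) = ch g + form D (emb R al) (emb R g).
Proof.
rewrite /ch /etatc embD !formDl !formDr (form_simple_rho R hD a).
rewrite -/al (formC (emb R g) (emb R al) hD).
set p := form D (emb R al) (emb R al); set q := form D (emb R al) (emb R g).
by field.
Qed.

Let S'_wt l : has_weight D k t (- emb R (wd i l)) (S' l).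
Proof. by rewrite emb_wd opprB; apply: (rowsum_wt hE hF) => j; exact: phi_wt0. Qed.

(** With z = h_g + ch g and w = h_alpha + (alpha, g), split T(z + w) = T(z) q^(2w) + T(w). Crossing
    S', of weight -g, removes the constant (alpha, g). The first part becomes the recursion for S'
    times q^h, and the second gives [h] because T(h) q^-h = [h]. *)
Let S'_step l j : l \in s -> pim (e a) l j != 0 ->
  phi_inv k t (wd i j) (ch (wd i j)) * (S' l * qh k t (- al)) =
  (\sum_(n <- s) S' n * Fe n l) * qh k t al + S' l * br k t (emb R al, 0).
Proof.
move=> ls lj0; have w := pim_wt hD hk hE (Upos_Bpos (e_Upos a)) (e_wt hE a) lj0.
have -> : wd i j = wd i l + al by rewrite -(wd_add l j i) w embK.
rewrite ch_add (phi_invD tu tt) mulrDl; set d := form _ _ _.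
have Q : qexp k t al d * S' l = S' l * qh k t al.
  by rewrite (qexp_wt tu al d (S'_wt l)) formNr subrr qexp_simple.
have -> : phi_inv k t (wd i l) (ch (wd i l)) * (qexp k t al d * qexp k t al d) *
    (S' l * qh k t (- al)) = (\sum_(n <- s) S' n * Fe n l) * qh k t al.
  rewrite -S'_rec_all // -!mulrA; congr (_ * _).
  rewrite [qexp k t al d * (S' l * _)]mulrA Q -mulrA (qhVN tu tt) mulr1 Q //.
congr (_ + _); rewrite mulrA (phi_inv_wt tu al d (S'_wt l)) formNr subrr /phi_inv
    qexp_simple.
by rewrite -!mulrA (qhVN tu tt) mulr1.
Qed.

Let Y j : M := e a * S j - S' j * e a - \sum_(l <- s) S' l * (pim (X := X) (e a) l j *:
    qh k t (- al)).

Let Y_diag : Y i = 0.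
Proof.
rewrite /Y S_diag S'_diag mulr1 mul1r subrr sub0r big_seq big1 ?oppr0 // => l ls.
have [->|/pim_e_succ h] := eqVneq (pim (e a) l i) 0; first by rewrite scale0r mulr0.
by case: (no_return ls h).
Qed.

(** The third term of Y leaves S' (e (x) [h]) through [S'_step]; the relation for F rewrites exactly
    this surplus, after which everything regroups as Y F. *)
Let Y_rec j : succ i j ->
  phi_inv k t (wd i j) (ch (wd i j)) * Y j = \sum_(l <- s) Y l * Fe l j.
Proof.
move=> ij; set g := wd i j; rewrite /Y !mulrBr.
have -> : phi_inv k t g (ch g) * (e a * S j) = \sum_(l <- s) e a * S l * Fe l j.
  rewrite mulrA (phi_inv_wt tu g _ (e_wt hE a)) (formC (emb R g) _ hD) -/al subrK
      -mulrA S_rec //.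
  by rewrite mulr_sumr; apply: eq_bigr => l _; rewrite mulrA.
have -> : phi_inv k t g (ch g) * (S' j * e a) = \sum_(l <- s) S' l * Fe l j * e a.
  by rewrite mulrA S'_rec // mulr_suml.
have -> : phi_inv k t g (ch g) * (\sum_(l <- s) S' l * (pim (X := X) (e a) l j *: qh k
    t (- al))) =
    \sum_(l <- s) S' l * (\sum_(n <- s) Fe l n * (pim (X := X) (e a) n j *: qh k t al)
                          + pim (X := X) (e a) l j *: br k t (emb R al, 0)).
  transitivity (\sum_(l <- s) ((\sum_(n <- s) S' n * Fe n l) * (pim (X := X) (e a) l j
      *: qh k t al)
      + S' l * (pim (X := X) (e a) l j *: br k t (emb R al, 0)))).
    rewrite mulr_sumr; apply: eq_big_seq => l ls.
    have [->|h] := eqVneq (pim (e a) l j) 0; first by rewrite !scale0r !mulr0 addr0.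
    by rewrite -!scalerAr -scalerDr S'_step.
  rewrite big_split; under [RHS]eq_bigr do rewrite mulrDr.
  rewrite [RHS]big_split; congr (_ + _).
  under eq_bigr do rewrite mulr_suml.
  rewrite exchange_big; apply: eq_bigr => l _; rewrite mulr_sumr.
  by apply: eq_bigr => n _; rewrite mulrA.
rewrite -!sumrB.
transitivity (\sum_(l <- s) ((e a * S l - S' l * e a) * Fe l j
    - S' l * (\sum_(n <- s) pim (X := X) (e a) l n *: (qh k t (- al) * Fe n j)))).
  apply: eq_big_seq => l ls.
  rewrite (F_commutesP hD hk hE hF a j us ls (fun n => s_closed hs sh ls)).
  set u := \sum_(n <- s) Fe l n * _; set v := \sum_(n <- s) _ *: _.
  rewrite [u + _]addrC subrK mulrBl mulrBr mulrDr !mulrA opprB opprD !addrA.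
  by rewrite subrK.
rewrite sumrB; under [RHS]eq_bigr do rewrite mulrBl.
rewrite [RHS]sumrB; congr (_ - _).
under eq_bigr do rewrite mulr_sumr.
rewrite exchange_big; apply: eq_bigr => n _; rewrite mulr_suml; apply: eq_bigr => l _.
by rewrite -!scalerAr -!scalerAl mulrA.
Qed.

Lemma e_rowsum j : j \in s ->
  e a * S j = S' j * e a + \sum_(l <- s) S' l * (pim (X := X) (e a) l j *: qh k t (- al)).
Proof.
move=> js; apply/eqP; rewrite -subr_eq0 opprD addrA; apply/eqP; rewrite -/(Y j).
have [m] := ubnP (height (wd i j)); elim: m j js => [//|m IH] j js jm.
have [->|ij] := sh js; first exact: Y_diag.
have : phi_inv k t (wd i j) (ch (wd i j)) * Y j = 0.
  rewrite Y_rec // big_seq big1 // => l ls.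
  have [->|/(F_succ hD hE hF) lj] := eqVneq (Fe l j) 0; first by rewrite mulr0.
  rewrite IH ?mul0r //; apply: leq_trans (s_height hD hk hE sh ls lj) _.
  by rewrite -ltnS.
move=> /(congr1 (fun y => Scoef' j * y)); rewrite mulr0 mulrA.
by rewrite /Scoef' (phi_invVK tu tt) ?mul1r // ; exact: ch_unit.
Qed.

End OneSimpleRoot.

(** The invariance of psi_X holds modulo J^ only; right multiplication by P turns it into the
    equality assumed here, while the factors S' merely multiply it from the left. *)
Lemma raising_kills (psi : I -> M) (P : M) (a : 'I_r) :
  (forall l, l \in s -> (e a * psi l + \sum_(j <- s) pim (X := X) (e a) l j *: (qh k t
      (- simple a) * psi j)) * P = 0) ->
  e a * (\sum_(j <- s) S j * psi j) * P = 0.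
Proof.
(* A nonzero [e a] is a vector of A of weight alpha, which makes the denominators of S'
   invertible. *)
move=> inv; have [->|en0] := eqVneq (e a) 0; first by rewrite !mul0r.
pose S' := rowsum F i s (fun j => phi k t (emb R (wd i j),
  etatc (wd i j) - form D (emb R (simple a)) (emb R (wd i j)))).
have -> : e a * (\sum_(j <- s) S j * psi j) =
    \sum_(l <- s) S' l * (e a * psi l + \sum_(j <- s) pim (X := X) (e a) l j *: (qh k t
        (- simple a) * psi j)).
  rewrite mulr_sumr.
  transitivity (\sum_(j <- s) (S' j * e a * psi j
      + \sum_(l <- s) S' l * (pim (X := X) (e a) l j *: (qh k t (- simple a) * psi j)))).
    apply: eq_big_seq => j js; rewrite mulrA (e_rowsum en0 js) mulrDl; congr (_ + _).
    by rewrite mulr_suml; apply: eq_bigr => l _; rewrite -mulrA scalerAl.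
  rewrite big_split; under [RHS]eq_bigr do rewrite mulrDr mulrA.
  rewrite [RHS]big_split; congr (_ + _); rewrite exchange_big.
  by apply: eq_bigr => l _; rewrite mulr_sumr.
by rewrite mulr_suml big_seq big1 // => l ls; rewrite -mulrA inv // mulr0.
Qed.

End Intertwining.

(** * Expansion over routes modulo the left ideal *)

Section RouteExpansion.
Set Implicit Arguments.
Unset Strict Implicit.
Variables (R : realType) (r : nat) (D : rootDatum r) (k : flavour R).
Variables (M : unitAlgType (complex R)) (e f t : 'I_r -> M).
Local Notation C := (complex R).
Local Notation Gam := 'rV[int]_r.
Hypotheses (hD : is_root_system D) (hk : flavour_ok k).
Hypothesis hE : enveloping_relations D k e f t.
Variable F : ctens r M.
Hypothesis hF : is_F D k e f t F.
Variables (A : set M) (Cs : set C).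
Hypothesis hA : is_admissible D k e f t A.
Hypothesis hCs : is_localization D k t A Cs.
Variable X : gradedModule D k e t.
Local Notation I := (gidx X).
Local Notation wd l j := (lat (nu l - nu j) : Gam).
Local Notation Fe := (entry (X := X) F).
Local Notation J := (Jhat k e t A Cs).
Implicit Types (j l : I) (g : Gam).

Let tu := Defs.rel_unit hE.
Let tt := rel_tt hE.

Definition hatU0 : set M := alg_gen (cartan_gens k t `|` loc_inv k t Cs).

Lemma hatU0_subalg : is_subalg hatU0. Proof. exact: subalg_smallest. Qed.
Lemma hatA_subalg : is_subalg (hat k t Cs A). Proof. exact: subalg_smallest. Qed.

Lemma cartan_hatU0 : cartan_gens k t `<=` hatU0.
Proof. by move=> x h; apply: sub_alg_gen; left. Qed.

Lemma locV_hatU0 a : loc Cs a -> hatU0 (br k t a)^-1.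
Proof. by move=> h; apply: sub_alg_gen; right; exists a. Qed.

Lemma A_hatA x : A x -> hat k t Cs A x.
Proof. by move=> Ax; apply: sub_alg_gen; left. Qed.

Lemma hatU0_hatA : hatU0 `<=` hat k t Cs A.
Proof.
apply: alg_gen_min; first exact: hatA_subalg.
move=> x [xt|xl]; last by apply: sub_alg_gen; right.
apply: A_hatA; case: hA => _ UA _ _; apply: UA; apply: sub_alg_gen; by right.
Qed.

Lemma Jhat_ideal : is_left_ideal (hat k t Cs A) J.
Proof. exact: left_ideal_smallest. Qed.

(** A generator b of the localised U^0 satisfies e_a b = b' e_a with b' a shifted or rescaled copy
    of b, so right multiplication by b sends generators of the left ideal into it. *)
Lemma Jhat_mulr b u : hatU0 b -> J u -> J (u * b).
Proof.
have [J0 JD JM] := Jhat_ideal; have hT := hatA_subalg.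
have Je a x : hat k t Cs A x -> J (x * e a).
  by move=> hx; apply: JM => //; apply: sub_gen_smallest; exists a.
move=> bU; move: b bU u; suff h : hatU0 `<=` [set b | forall u, J u -> J (u * b)] by
    move=> b /h.
apply: alg_gen_min.
  split=> [u Ju|c x y hx hy u Ju|x y hx hy u Ju] /=; first by rewrite mulr1.
    rewrite mulrDr -scalerAr -[u * x]mul1r scalerAl; apply: JD; last exact: hy.
    by apply: JM; [apply: (subalgZ hT); exact: (subalg1 hT)|exact: hx].
  by rewrite mulrA; apply: hy; exact: hx.
move=> b hb; have bT : hat k t Cs A b.
  by apply: hatU0_hatA; apply: sub_alg_gen.
have key a : exists2 b', hat k t Cs A b' & e a * b = b' * e a.
  have eaw := e_wt hE a.
  case: hb => [|[[w c] wl <-]].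
    have tT i : hat k t Cs A (t i).
      apply: hatU0_hatA; apply: cartan_hatU0; rewrite /cartan_gens.
      by case: (k) => [hb|]; [left|]; exists i.
    have : forall k0, k0 = k -> cartan_gens k0 t b -> exists2 b', hat k t Cs A b' & e a
        * b = b' * e a;
      last by apply.
    case=> [hb|] kE /=.
      have tu' i : t i \is a GRing.unit by move: tu; rewrite -kE.
      have E i := has_weight_quantum tu i (esym kE) eaw.
      have n0 i : qpow hb (form D (emb R (simple i)) (emb R (simple a))) != 0 by exact:
          qpow_neq0.
      move=> [[i _ bE]|[i _ bE]].
        exists ((qpow hb (form D (emb R (simple i)) (emb R (simple a))))^-1 *: b).
          exact: (subalgZ hT).
        by rewrite -bE -scalerAl E scalerA mulVf // scale1r.
      exists (qpow hb (form D (emb R (simple i)) (emb R (simple a))) *: b).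
        exact: (subalgZ hT).
      rewrite -bE; apply: (mulrI (tu' i)); apply: (mulIr (tu' i)).
      by rewrite -!mulrA mulVr // mulr1 -scalerAl -scalerAr mulVKr // E.
    move=> [i _ bE]; exists (b - (form D (emb R (simple i)) (emb R (simple a)))%:A).
      by apply: (subalgB hT) => //; apply: (subalgZ hT); exact: (subalg1 hT).
    by rewrite -bE mulrBl (has_weight_classical i (esym kE) eaw) -scalerAl mul1r addrC
        addKr.
  (* For an inverted denominator the shifted one must be invertible too; [loc_shift] provides this
     when [e a] is nonzero. *)
  have [->|en0] := eqVneq (e a) 0.
    by exists 0; rewrite ?mulr0 ?mul0r //; exact: (subalg0 hT).
  have [g gE] : exists g, w = emb R g by case: wl => [g [c' [_ _ _ [-> _]]]]; exists g.
  rewrite gE in wl *.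
  have wl' : loc Cs (emb R g, c - form D (emb R g) (emb R (simple a))).
    apply: (loc_shift hCs wl _ en0); split => //; apply: (Upos_A hA); exact: e_Upos.
  exists (br k t (emb R g, c - form D (emb R g) (emb R (simple a))))^-1.
    by apply: hatU0_hatA; exact: locV_hatU0.
  have u1 := loc_unit hCs wl; have u2 := loc_unit hCs wl'.
  apply: (mulrI u2); apply: (mulIr u1).
  rewrite -!mulrA mulVr // mulr1 mulrA mulrV // mul1r.
  by rewrite (br_wt tu g _ eaw) subrK.
move=> u Ju; move: u Ju; suff h : J `<=` [set u | J (u * b)] by move=> u /h.
apply: smallest_sub; last by move=> _ [a _ <-]; have [b' b'T E] := key a; rewrite /= E;
    exact: Je.
split=> [|x y hx hy|x y hx hy] /=.
- by rewrite mul0r.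
- by rewrite mulrDl; exact: JD.
- by rewrite -mulrA; exact: JM.
Qed.

Lemma Jhat_mull b u : hatU0 b -> J u -> J (b * u).
Proof. by case: Jhat_ideal => _ _ JM /hatU0_hatA; exact: JM. Qed.

Lemma Jhat_add u v : J u -> J v -> J (u + v).
Proof. by case: Jhat_ideal => _ h _; exact: h. Qed.

Lemma Jhat_sum (T : eqType) (u : seq T) (G : T -> M) :
  (forall x, x \in u -> J (G x)) -> J (\sum_(x <- u) G x).
Proof.
case: Jhat_ideal => J0 JD _ h; rewrite big_seq; elim/big_ind: _ => // x y; exact: JD.
Qed.

Variables (i : I) (s : seq I).
Hypotheses (us : uniq s) (is_ : i \in s) (hs : forall l, succ i l -> l \in s).
Hypothesis sh : forall l, l \in s -> l = i \/ succ i l.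
Hypothesis hB : forall j, succ i j -> loc Cs (eta D (nu i) - eta D (nu j)).
Let Scoef (j : I) : M := phi k t (etat D (emb R (wd i j))).

(* The constant of the argument h_g + c of phi which the factor at the stop n *)
(* of a route gets when it is moved to the right end l of the route.          *)
Let stop (n l : I) : C := etac R D (wd i n) + form D (emb R (wd i n)) (nu l - nu n).

Let prod_move (x : M) (u : seq I) (P Q : I -> M) :
  (forall n, n \in u -> P n * x = x * Q n) ->
  (\prod_(n <- u) P n) * x = x * \prod_(n <- u) Q n.
Proof.
elim: u => [|n u IH] h; first by rewrite !big_nil mulr1 mul1r.
rewrite !big_cons -mulrA IH; last by move=> m mu; apply: h; rewrite inE mu orbT.
by rewrite mulrA h ?inE ?eqxx // mulrA.
Qed.

Lemma last_rev (T : Type) (x : T) (m : seq T) : last x (rev m) = head x m.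
Proof. by case: m => // y m; rewrite rev_cons last_rcons. Qed.

(** The Cartan factors are moved right one step at a time. The alternative is forced: crossing an
    entry of F preserves invertibility of the denominators only if that entry is nonzero, and
    otherwise both sides vanish. *)
Lemma rterm_route m :
  (rterm F i Scoef m = 0 /\ phi_route F i (rev m) = 0) \/
  [/\ forall n, n \in m -> succ i n,
      forall n, n \in m -> loc Cs (emb R (wd i n), stop n (head i m))
    & rterm F i Scoef m = phi_route F i (rev m) *
        \prod_(n <- rev m) phi k t (emb R (wd i n), stop n (head i m))].
Proof.
elim: m => [|j m IH]; first by right; split => //=; rewrite big_nil mulr1.
rewrite rev_cons phi_route_rcons last_rev /=.
case: IH => [[-> ->]|[h1 h2 h3]]; first by left; rewrite !mul0r mulr0.
have [F0|Fn0] := eqVneq (Fe (head i m) j) 0; first by left; rewrite F0 !mulr0.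
right; set l := head i m in Fn0 *.
have lj := F_succ hD hE hF Fn0.
have il : l = i \/ succ i l.
  by rewrite /l; case: (m) h1 => [|n m'] h1 /=; [left|right; apply: h1; rewrite inE eqxx].
have ij : succ i j by case: il => [<- //|il]; exact: succ_trans il lj.
have [gP gn0] := succ_wd hD hk hE ij.
have Fw : has_weight D k t (nu j - nu l) (Fe l j).
  by apply: entry_wt => g p pF; have [] := F_lowering hE hF pF.
have stop_step n : stop n l + form D (emb R (wd i n)) (nu j - nu l) = stop n j.
  by rewrite /stop -addrA -formDr; congr (_ + form _ _ _); rewrite addrC addrA subrK.
have loc_step n : n \in m -> loc Cs (emb R (wd i n), stop n j).
  move=> nm; have [p pF pn0] := entry_supp Fn0.
  have [_ pU pw] := F_raising hE hF pF.
  have -> : stop n j = stop n l - form D (emb R (wd i n)) (emb R (wd l j)).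
    by rewrite -(stop_step n) -formNr (emb_wd l j) opprB.
  (* The constant drops by the pairing with nu l - nu j, so the certificate must have this weight:
     it is the first leg of a tensor in F, nonzero because its matrix entry is. *)
  apply: (loc_shift hCs (h2 n nm) (x := p.1)); first by split => //; exact: (Upos_A hA).
  by apply: contraNneq pn0 => ->; rewrite pim0.
have stop_jj : stop j j = etac R D (wd i j) by rewrite /stop subrr form0r addr0.
split.
- by move=> n; rewrite inE => /orP[/eqP ->|/h1].
- move=> n; rewrite inE => /orP[/eqP ->|/loc_step //].
  by rewrite stop_jj; exact: (loc_eta hCs).
rewrite big_rcons /= stop_jj.
have xw : has_weight D k t (- emb R (wd i j)) (rterm F i Scoef m * Fe l j).
  have -> : - emb R (wd i j) = (nu l - nu i) + (nu j - nu l).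
    by rewrite emb_wd opprB [RHS]addrC addrA subrK.
  apply: (has_weightM tu) => //; apply: (rterm_wt hE hF) => n; exact: (phi_wt0 hE).
(* The newest factor stands to the left of a product of weight -g, and crossing it replaces etat_g
   by etat_g - (g, g) = eta_g. *)
have etaE : etatc R D (wd i j) + form D (emb R (wd i j)) (- emb R (wd i j)) = etac R D
    (wd i j).
  by rewrite /etatc /etac formNr; field.
have -> : Scoef j * (rterm F i Scoef m * Fe l j) =
    rterm F i Scoef m * Fe l j * phi k t (emb R (wd i j), etac R D (wd i j)).
  rewrite -etaE; apply: (phi_wt tu xw).
    by apply: (loc_unit hCs); exact: (loc_etat hCs).
  by rewrite etaE; apply: (loc_unit hCs); exact: (loc_eta hCs).
rewrite h3 !mulrA; congr (_ * _); rewrite -!mulrA; congr (_ * _).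
apply: prod_move => n; rewrite mem_rev => nm; rewrite -(stop_step n).
apply: (phi_wt tu Fw); apply: (loc_unit hCs); first exact: h2.
by rewrite stop_step; exact: loc_step.
Qed.

Variable psi : I -> M.
Hypothesis psi_wt : forall l, wt_upto D k t (Veq k e t A Cs) (- nu l) (psi l).

Lemma phi_route_A l m : A (phi_route F l m).
Proof.
have hAs : is_subalg A by case: hA.
elim: m l => [|j m IH] l /=; first exact: (subalg1 hAs).
apply: (subalgM hAs) => //; apply: (subalg_sum hAs) => p pF; apply: (subalgZ hAs).
by apply: (Uneg_A hA); have [] := F_lowering hE hF pF.
Qed.

(** The Cartan factors cross psi_l, whose weight is known only modulo J^; hence [twist] with J = J^
    over the localised U^0. The prefix of F's is harmless, as it multiplies from the left. *)
Lemma rterm_psi m : J (rterm F i Scoef m * psi (head i m) -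
  psi_route F psi i (rev m) * Bc_route i (rev m)).
Proof.
have [J0 JD JM] := Jhat_ideal.
rewrite /psi_route last_rev; case: (rterm_route m) => [[-> ->]|[h1 h2 ->]].
  by rewrite !mul0r subrr.
rewrite -!mulrA -mulrBr; apply: JM; first by apply: A_hatA; exact: phi_route_A.
set l := head i m; rewrite /Bc_route.
have locB n : n \in rev m -> loc Cs (emb R (wd i n), stop n l + form D (emb R (wd i n))
    (- nu l))
  /\ Bc i n = phi k t (emb R (wd i n), stop n l + form D (emb R (wd i n)) (- nu l)).
  rewrite mem_rev => nm.
  (* The pairings with nu l cancel, so the factor depends on i and n only; the rest is -(x-y, x-y)/2
     - (x-y, y) = (y, y)/2 - (x, x)/2. *)
  have <- : eta D (nu i) - eta D (nu n) =
      (emb R (wd i n), stop n l + form D (emb R (wd i n)) (- nu l)).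
    rewrite /stop /etac emb_wd; congr pair => /=.
    by rewrite !(formDl, formNl, formDr, formNr) (formC (nu n) (nu i) hD); field.
  by split => //; exact: hB (h1 n nm).
have tw n : n \in rev m -> twist J (psi l)
    (phi k t (emb R (wd i n), stop n l)) (Bc i n).
  move=> nm; have [B1 B2] := locB n nm; rewrite B2.
  have A1 : loc Cs (emb R (wd i n), stop n l) by apply: h2; rewrite -mem_rev.
  apply: (twist_phi tu hatU0_subalg Jhat_add Jhat_mull Jhat_mulr cartan_hatU0 (@psi_wt
      l) J0).
  - exact: (loc_unit hCs).
  - exact: (loc_unit hCs).
  - exact: locV_hatU0.
  - exact: locV_hatU0.
have Tphi g c : loc Cs (emb R g, c) -> hatU0 (phi k t (emb R g, c)).
  by move=> h; apply: (T_phi hatU0_subalg cartan_hatU0); exact: locV_hatU0.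
have : forall n, n \in rev m -> hatU0 (phi k t (emb R (wd i n), stop n l)) /\ hatU0 (Bc
    i n).
  move=> n nm; have [B1 B2] := locB n nm; rewrite B2; split; apply: Tphi => //.
  by apply: h2; rewrite -mem_rev.
move: tw; elim: (rev m) => [|n u IH] tw Tn.
  by rewrite !big_nil mulr1 mul1r subrr.
rewrite !big_cons -/(twist J (psi l) _ _).
have sub n' : n' \in u -> n' \in n :: u by rewrite inE orbC => ->.
have [T1 T2] : hatU0 (phi k t (emb R (wd i n), stop n l)) /\ hatU0 (\prod_(n' <- u) Bc
    i n').
  split; first by case: (Tn n); rewrite ?inE ?eqxx.
  by apply: (subalg_prod hatU0_subalg) => n' /sub/Tn[].
apply: (twistM Jhat_add Jhat_mull Jhat_mulr) => //.
  by apply: tw; rewrite inE eqxx.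
by apply: IH => n' /sub; [exact: tw|exact: Tn].
Qed.

(** [revroutes] lists all words in [s], routes or not; a word that is not a route contains a
    vanishing entry of F and is discarded by the assumption on [G]. Starting at 1 excludes the empty
    route. *)
Lemma sum_routes (G : seq I -> M) (N := row_bound i s) :
  (forall m, phi_route F i m = 0 -> G m = 0) ->
  \sum_(m \in [set m : seq I | m <> [::] /\ route i m]) G m =
  \sum_(1 <= n < N) \sum_(m <- revroutes s n) G (rev m).
Proof.
move=> G0.
pose L := [seq rev m | m <- flatten [seq revroutes s n | n <- index_iota 1 N]].
transitivity (\sum_(m <- L) G m); last by rewrite big_map big_flatten big_map.
apply: fsum_seq.
- rewrite map_inj_uniq; last exact: (can_inj revK).
  by apply: (flatten_revroutes_uniq us); exact: iota_uniq.
- move=> m [mn0 rm] _; have [h1 h2] := route_s hD hk hE hs sh is_ rm.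
  rewrite -[m]revK; apply: map_f; apply/flattenP; exists (revroutes s (size m)); last first.
    by rewrite -size_rev; apply: mem_revroutes => n; rewrite mem_rev => /h1; exact: hs.
  apply: map_f; rewrite mem_index_iota; apply/andP; split.
    by rewrite lt0n size_eq0; apply/eqP.
  have ls : last i m \in s.
    have := mem_last i m; rewrite inE => /orP[/eqP ->//|/h1]; exact: hs.
  apply: leq_ltn_trans (row_bound_height i ls); apply: leq_trans h2; exact: leq_addl.
- move=> _ /mapP[m /flattenP[_ /mapP[n nN ->] mn] ->] nr; apply: G0.
  move: nN; rewrite mem_index_iota => /andP[n1 _].
  apply/eqP/negPn/negP => /(phi_route_route hD hE hF) rt; apply: nr; split => //.
  by move=> /(congr1 size); rewrite size_rev (revroutes_size mn) => E; rewrite E in n1.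
Qed.

Lemma z_comp_rowsum : z_comp F psi i = \sum_(j <- s) rowsum F i s Scoef j * psi j.
Proof.
rewrite /z_comp (@fsum_seq _ _ s) // => [|j _ h|j _ []] //.
  by apply: eq_bigr => j _; rewrite (entry_St hD hk hE hF us is_ hs sh).
apply: (rowsum_supp hD hE hF is_ hs sh (c := Scoef)).
by apply: contraNneq h; rewrite (entry_St hD hk hE hF us is_ hs sh) => ->; rewrite mul0r.
Qed.

Lemma z_comp_routes : Veq k e t A Cs (z_comp F psi i)
  (psi i + \sum_(m \in [set m : seq I | m <> [::] /\ route i m])
             psi_route F psi i m * Bc_route i m).
Proof.
rewrite /Veq sum_routes => [|m m0]; last by rewrite /psi_route m0 !mul0r.
rewrite z_comp_rowsum.
have -> : \sum_(j <- s) rowsum F i s Scoef j * psi j =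
    \sum_(0 <= n < row_bound i s) \sum_(m <- revroutes s n) rterm F i Scoef m * psi
        (head i m).
  rewrite /rowsum; under eq_bigr do rewrite mulr_suml.
  rewrite exchange_big; apply: eq_bigr => n _.
  apply: (@sum_row_rterm _ _ _ _ _ _ _ F X i s us is_ Scoef n (fun j x => x * psi j)).
    by move=> j; rewrite mul0r.
  by move=> j x y; rewrite mulrDl.
rewrite big_ltn // big_seq1 /= mul1r opprD addrACA subrr add0r -sumrB.
apply: Jhat_sum => n _; rewrite -sumrB; apply: Jhat_sum => m _; exact: rterm_psi.
Qed.

End RouteExpansion.

(** * The extremal projector *)

Section ExtremalProjector.
Set Implicit Arguments.
Unset Strict Implicit.
Variables (R : realType) (r : nat) (D : rootDatum r) (k : flavour R).
Variables (M : unitAlgType (complex R)) (e f t : 'I_r -> M).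
Local Notation C := (complex R).
Hypotheses (hD : is_root_system D) (hk : flavour_ok k).
Hypothesis hE : enveloping_relations D k e f t.
Variables (A : set M) (Cs : set C) (Ub : set M) (P : M).
Hypothesis hA : is_admissible D k e f t A.
Hypothesis hP : is_extremal_projector D k e f t A Cs Ub P.

Lemma Jhat_P u : Jhat k e t A Cs u -> u * P = 0.
Proof.
move: u; apply: smallest_sub; last first.
  by move=> _ [a _ <-] /=; apply: (ep_left hP); apply: sub_gen_smallest; exists a.
split=> [|x y /= hx hy|x y _ /= hy]; first by rewrite /= mul0r.
- by rewrite mulrDl hx hy addr0.
- by rewrite -mulrA hy mulr0.
Qed.

(** An element of U^- is a scalar modulo the right ideal of the f's, so P x is a multiple of P and
    has weight 0. It also has weight g, and as q is not a root of unity a nonzero vector cannot have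
    both weights. *)
Lemma P_lowering x g : Uneg f x -> has_weight D k t (emb R g) x -> g != 0 -> P * x = 0.
Proof.
have hAs : is_subalg A by case: hA.
have [J0 JD JM] := right_ideal_smallest A (range f).
move=> xU xw gn0.
have [c Px] : exists c : C, P * x = c *: P.
  suff [c [_ xc]] : exists c : C, A x /\ right_ideal_gen A (range f) (x - c%:A).
    exists c; apply/eqP; rewrite -subr_eq0; apply/eqP.
    by rewrite -(ep_right hP xc) mulrBr -scalerAr mulr1.
  move: x xU {xw}; apply: alg_gen_min; last first.
    move=> _ [a _ <-]; exists 0; rewrite scale0r subr0; split.
      by apply: (Uneg_A hA); apply: sub_alg_gen; exists a.
    by apply: sub_gen_smallest; exists a.
  split.
  - by exists 1; rewrite scale1r subrr; split => //; exact: (subalg1 hAs).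
  - move=> a x y [c [xA xc]] [d [yA yd]]; exists (a * c + d); split.
      by apply: (subalgD hAs) => //; exact: (subalgZ hAs).
    rewrite scalerDl opprD addrACA; apply: JD => //.
    rewrite -scalerA -scalerBr -[_ - _]mulr1 scalerAr; apply: JM => //.
    by apply: (subalgZ hAs); exact: (subalg1 hAs).
  - move=> x y [c [xA xc]] [d [yA yd]]; exists (c * d); split; first exact: (subalgM hAs).
    (* Scalar parts multiply, with a remainder built from right multiples of x - c and y - d. *)
    have -> : x * y - (c * d)%:A = (x - c%:A) * y + (y - d%:A) * c%:A.
      by rewrite !mulrBl -!scalerAl -!scalerAr !mulr1 !mul1r scalerA addrA subrK mulrC.
    by apply: JD; apply: JM => //; apply: (subalgZ hAs); exact: (subalg1 hAs).
have tu := Defs.rel_unit hE.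
have w1 := has_weightM tu (ep_wt hP) xw.
have w0 : has_weight D k t 0 (P * x) by rewrite Px; apply: has_weightZ; exact: (ep_wt hP).
rewrite add0r in w1.
apply/eqP; apply: contraNT gn0 => n0; apply/eqP.
apply: (form_nondeg hD (R := R)) => i.
have : forall k0, k = k0 -> form D (emb R (simple i)) (emb R g) = 0; last by apply.
case=> [hb|] kE.
  have := has_weight_quantum tu i kE w1; rewrite (has_weight_quantum tu i kE w0) form0r
      qpow0 => E.
  have tP : P * x * t i != 0.
    have ui : t i \is a GRing.unit by move: tu; rewrite kE.
    by apply: contraNneq n0 => E'; apply/eqP; apply: (mulIr ui); rewrite mul0r.
  have hk' : flavour_ok (quantum hb) by rewrite -kE.
  rewrite form_simple_emb.
  suff -> : \sum_j gram D i j * (g 0 j)%:~R = 0 by rewrite rmorph0.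
  apply: (qpow_rat_eq1 hk'); rewrite -form_simple_emb.
  apply/esym/eqP; rewrite -subr_eq0; have /eqP := E; rewrite -subr_eq0 -scalerBl scaler_eq0.
  by rewrite (negPf tP) orbF.
have := has_weight_classical i kE w1; rewrite (has_weight_classical i kE w0) form0r scale0r.
move=> /addIr/esym/eqP; rewrite scaler_eq0 (negPf n0) orbF => /eqP //.
Qed.

End ExtremalProjector.

Theorem proposition5p2 (R : realType) (r : nat) (D : rootDatum r)
    (k : flavour R) (M : unitAlgType (complex R)) (e f t : 'I_r -> M)
    (F : ctens r M)
    (A : set M) (Cs : set (complex R)) (Ub : set M) (P : M)
    (X : gradedModule D k e t) (psi : gidx X -> M)
    (hD : is_root_system D)
    (hk : flavour_ok k)
    (hU : is_enveloping D k e f t)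
    (hF : is_F D k e f t F)
    (hA : is_admissible D k e f t A)
    (hCs : is_localization D k t A Cs)
    (hP : is_extremal_projector D k e f t A Cs Ub P)
    (hB : forall i j : gidx X, succ i j -> loc Cs (eta D (nu i) - eta D (nu j)))
    (hpsi : is_right_Mickelsson A Cs psi) :
  forall i : gidx X, finite_set [set j | succ i j] ->
    Veq k e t A Cs (z_comp F psi i)
      (psi i + \sum_(m \in [set m : seq (gidx X) | m <> [::] /\ route i m])
                  psi_route F psi i m * Bc_route i m)
    /\ z_comp F psi i * P = P * (psi i * P).
Proof.
move=> i /finite_seqP[s0 s0E]; have hE := hU.1.
pose s := undup (i :: s0).
have us : uniq s := undup_uniq _.
have is_ : i \in s by rewrite mem_undup inE eqxx.
have s0P l : succ i l <-> l \in s0.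
  by have : [set j | succ i j] l <-> [set` s0] l by rewrite s0E.
have hs l : succ i l -> l \in s by move=> /s0P h; rewrite mem_undup inE h orbT.
have sh l : l \in s -> l = i \/ succ i l.
  by rewrite mem_undup inE => /orP[/eqP ->|/s0P]; [left|right].
have part1 := z_comp_routes hD hk hE hF hA hCs us is_ hs sh (hB i) (mg_wt hpsi).
split => //.
have zE := z_comp_rowsum hD hk hE hF us is_ hs sh psi.
have e_z a : e a * z_comp F psi i * P = 0.
  rewrite zE; apply: (raising_kills hD hk hE hF hA hCs us hs sh) => l ls.
  have := Jhat_P hP (mg_inv hpsi a l); rewrite subr0.
  rewrite (@fsum_seq _ _ s) //.
  - by move=> j aj _; apply: hs; apply: (s_succ sh ls); exact: pim_e_succ aj.
  - by move=> j _ /negP; rewrite negbK => /eqP ->; rewrite scale0r.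
have Pz : P * (z_comp F psi i * P) = z_comp F psi i * P.
  (* P - 1 lies in the left ideal of M generated by the e's, and each e kills z P whatever stands to
     its left. *)
  have kill y : left_ideal_gen setT (range e) y -> y * (z_comp F psi i * P) = 0.
    move: y; apply: smallest_sub; last by move=> _ [a _ <-]; rewrite /= mulrA.
    split=> [|x y /= hx hy|x y _ /= hy]; first by rewrite /= mul0r.
      by rewrite mulrDl hx hy addr0.
    by rewrite -mulrA hy mulr0.
  have := kill _ (ep_one hP).1; rewrite mulrBl mul1r => /eqP; rewrite subr_eq0 => /eqP //.
(* Multiplied by P on the right, the congruence of the first part becomes an equality. *)
rewrite -Pz; have := Jhat_P hP part1; rewrite mulrBl mulrDl => /eqP.
rewrite subr_eq0 => /eqP ->; rewrite mulrDr -[RHS]addr0; congr (_ + _).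
rewrite (sum_routes hD hk hE hF us is_ hs sh) => [|m m0]; last by rewrite /psi_route m0
    !mul0r.
rewrite mulr_suml mulr_sumr big_nat big1 // => n /andP[n1 _].
rewrite mulr_suml mulr_sumr big_seq big1 // => m /revroutes_size mn.
rewrite /psi_route -!mulrA; move: n1; rewrite -mn -(size_rev m).
case: (rev m) => [//|j m'] _ /=; rewrite !mulrA.
suff -> : P * entry F i j = 0 by rewrite !mul0r.
have [->|/(F_succ hD hE hF) ij] := eqVneq (entry F i j) 0; first by rewrite mulr0.
have [gP gn0] := succ_wd hD hk hE ij.
apply: (P_lowering hD hk hE hA hP (g := - lat (nu i - nu j))); last by rewrite oppr_eq0.
- have hN : is_subalg (Uneg f) by exact: subalg_smallest.
  apply: (subalg_sum hN) => p pF; apply: (subalgZ hN).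
  by have [] := F_lowering hE hF pF.
- rewrite embN emb_wd opprB; apply: entry_wt => g p pF.
  by have [] := F_lowering hE hF pF.
Qed.
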